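(* Let $a,q\in(0,\infty)$ satisfy $1<a<\frac1q$. Then the spectral measure $\rho_0$ of the pair $(u,\mu)\in\mathcal{D}^+$ with $u$ having the form $$u(x)=\frac12\sum_{n\in\mathbb{N}}\omega_ne^{-|x-x_n|}$$ and the coefficients given by $$x_n=\log\Big(\sum_{k=0}^{n-1}\frac{(aq)^k}{(q;q)_k}\Big),\qquad \omega_n=\frac{(q;q)_{n-1}}{a^n}\sum_{k=0}^{n-1}\frac{(aq)^k}{(q;q)_k},$$ for all $n\in\mathbb{N}$, is $$\rho_0=(q/a;q)_\infty\sum_{n=0}^\infty\frac{a^{-n}q^{n^2}}{(q/a;q)_n(q;q)_n}\,\delta_{aq^{-n}-1}.$$
   Context: $q$-notation: $(c;q)_n=\prod_{j=1}^n(1-cq^{j-1})$ and $(c;q)_\infty=\prod_{j=1}^\infty(1-cq^{j-1})$. $\delta_\lambda$ is the unit Dirac measure at $\lambda$. Phase space. $\mathcal{D}$ is the set of all pairs $(u,\mu)$ where $u\in H^1_{\mathrm{loc}}(\mathbb{R})$ is real-valued and $\mu$ is a positive Borel measure on $\mathbb{R}$ with $\int_B u^2+u'^2\,dx\le\mu(B)$ for every Borel set $B\subseteq\mathbb{R}$ such that, with $\upsilon$ the positive Borel measure defined by $\mu(B)=\upsilon(B)+\int_B u^2+u'^2\,dx$, one has $$\int_{-\infty}^0 e^{-s}(u(s)^2+u'(s)^2)\,ds+\int_{-\infty}^0 e^{-s}\upsilon(ds)<\infty,\qquad \limsup_{x\to\infty}e^{x}\Big(\int_x^\infty e^{-s}(u(s)+u'(s))^2ds+\int_x^\infty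 e^{-s}\upsilon(ds)\Big)<\infty.$$ The real distribution $\omega\in H^{-1}_{\mathrm{loc}}(\mathbb{R})$ is $\omega=u-u''$, that is, $\omega(h)=\int_{\mathbb{R}}uh\,dx+\int_{\mathbb{R}}u'h'\,dx$ for $h\in H^1(\mathbb{R})$ with compact support. $\mathcal{D}^+$ is the set of all $(u,\mu)\in\mathcal{D}$ such that $\omega$ is a positive Borel measure and $\upsilon$ vanishes identically (so such a pair is determined by $u$ via $\mu(B)=\int_Bu^2+u'^2\,dx$). Spectral measure. For $z\in\mathbb{C}$, a solution of $-f''+\frac14 f=z\,\omega f+z^2\upsilon f$ is a function $f\in H^1_{\mathrm{loc}}(\mathbb{R})$ with $\int f'h'\,dx+\frac14\int fh\,dx=z\,\omega(fh)+z^2\int fh\,d\upsilon$ for all compactly supported $h\in H^1(\mathbb{R})$; its quasi-derivative $f^{[1]}$ is the unique left-continuous function with $f^{[1]}=f'+\frac12 f-z(u+u')f$ a.e. There are (known) solutions $\phi(z,\cdot),\theta(z,\cdot)$ with $\phi(z,x)\sim e^{x/2}$, $\theta(z,x)\sim e^{-x/2}$, $\phi^{[1]}(z,x)\sim e^{x/2}$, $\theta^{[1]}(z,x)=o(e^{x/2})$ as $x\to-\infty$. The Weyl--Titchmarsh function $m(z)=-\lim_{x\to\infty}\frac{\theta(z,x)}{z\phi(z,x)}$, $z\in\mathbb{C}\setminus\mathbb{R}$, has the form $m(z)=\int_{\mathbb{R}}\frac{z}{\lambda(\lambda-z)}\rho(d\lambda)$ for a unique positive Borel measure $\rho$ on $\mathbb{R}$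 with $\int\frac{\rho(d\lambda)}{1+\lambda^2}<\infty$ and $0\notin\operatorname{supp}\rho$; $\rho$ is the spectral measure of $(u,\mu)$. (Known: $(u,\mu)\mapsto\rho$ is a bijection from $\mathcal{D}$ onto the set of all such measures, and it restricts to a bijection from $\mathcal{D}^+$ onto those supported in $(0,\infty)$.) *)

(* Defs.v *)
From HB Require Import structures.
From mathcomp Require Import all_boot all_order all_algebra complex.
From mathcomp Require Import all_classical all_reals all_analysis.

Set Implicit Arguments.
Unset Strict Implicit.
Unset Printing Implicit Defensive.

Import Order.TTheory GRing.Theory Num.Theory.
Import numFieldNormedType.Exports.

Local Open Scope classical_set_scope.
Local Open Scope ring_scope.
Local Open Scope complex_scope.

(* The usual topology of the complex numbers, so that [F --> l] makes sense in
   [R[i]]. *)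
HB.instance Definition _ (R : rcfType) :=
  PseudoPointedMetric.copy R[i] (R[i]^o).
HB.instance Definition _ (R : rcfType) := GRing.ComAlgebra.copy R[i] (R[i]^o).
HB.instance Definition _ (R : rcfType) := NormedModule.copy R[i] (R[i]^o).

Section qseries.
Context {R : realType}.
Implicit Types (c q : R) (n : nat).

Definition qpoch c q n : R := \prod_(1 <= j < n.+1) (1 - c * q ^+ j.-1).

Definition qpoch_inf c q : R := limn (qpoch c q).

End qseries.

Section Sobolev.
Context {R : realType}.
Implicit Types (f g : R -> R) (F G : R -> R[i]).

Local Notation leb := (@lebesgue_measure R).

(* H^1_loc(R) consists of the locally absolutely continuous functions with
   locally square integrable derivative; elements are continuous
   representatives, and the weak derivative is only determined a.e. *)
Definition is_weak_derivative f g :=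
  [/\ measurable_fun setT g,
      locally_integrable setT (fun x => g x ^+ 2) &
      forall x y, x <= y ->
        f y - f x = \int[leb]_(t in `[x, y]) g t].

Definition H1loc f := exists g, is_weak_derivative f g.

Definition wderiv f : R -> R := get [set g | is_weak_derivative f g].

Definition H1locC F := H1loc (fun x => complex.Re (F x)) /\ H1loc (fun x => complex.Im (F x)).

Definition wderivC F (x : R) : R[i] :=
  wderiv (fun x => complex.Re (F x)) x +i* wderiv (fun x => complex.Im (F x)) x.

(* Compactly supported elements of H^1(R). *)
Definition H1cC F :=
  H1locC F /\ compact (closure [set x | F x != 0]).

Definition intC (m : {measure set (measurableTypeR R) -> \bar R}) F : R[i] :=
  (\int[m]_x complex.Re (F x)) +i* (\int[m]_x complex.Im (F x)).

End Sobolev.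

Section CamassaHolm.
Context {R : realType}.
Local Notation measureR := {measure set (measurableTypeR R) -> \bar R}.
Implicit Types (u : R -> R) (mu ups rho : measureR) (z : R[i]).
Implicit Types (f h : R -> R[i]) (phi theta : R[i] -> R -> R[i]).

Local Notation leb := (@lebesgue_measure R).

Definition locally_finite mu :=
  forall K : set R, compact K -> (mu K < +oo)%E.

Definition energy u (B : set R) : \bar R :=
  (\int[leb]_(x in B) (u x ^+ 2 + wderiv u x ^+ 2)%:E)%E.

Definition is_upsilon u mu ups :=
  forall B, measurable B -> mu B = (ups B + energy u B)%E.

(* The integral from [x] to [y] against a measure is taken over [[x, y)]. *)
Definition left_decay u ups :=
  ((\int[leb]_(s in `]-oo, 0%R])
      (expR (- s) * (u s ^+ 2 + wderiv u s ^+ 2))%:E < +oo) /\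
   (\int[ups]_(s in `]-oo, 0%R[) (expR (- s))%:E < +oo))%E.

Definition right_decay u ups :=
  (limf_esup (fun x : R => (expR x)%:E *
     (\int[leb]_(s in `[x, +oo[) (expR (- s) * (u s + wderiv u s) ^+ 2)%:E +
      \int[ups]_(s in `[x, +oo[) (expR (- s))%:E)) +oo%R < +oo)%E.

(* Local finiteness is part of the convention for positive Borel measures: it
   makes [ups] unique, and integrals of compactly supported continuous
   functions finite. *)
Definition phase_space u mu :=
  [/\ H1loc u,
      locally_finite mu,
      forall B, measurable B -> (energy u B <= mu B)%E &
      exists ups, [/\ is_upsilon u mu ups, left_decay u ups &
                      right_decay u ups]].

(* The distribution omega = u - u''. *)
Definition omega u h : R[i] :=
  intC leb (fun x => (u x)%:C * h x) +
  intC leb (fun x => (wderiv u x)%:C * wderivC h x).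

Definition phase_space_pos u mu :=
  [/\ phase_space u mu,
      exists w : measureR, locally_finite w /\
        forall h, H1cC h -> omega u h = intC w h &
      exists ups, is_upsilon u mu ups /\
        forall B, measurable B -> ups B = 0%E].

(* - f'' + f / 4 = z omega f + z ^ 2 upsilon f *)
Definition is_solution u ups z f :=
  H1locC f /\
  forall h, H1cC h ->
    intC leb (fun x => wderivC f x * wderivC h x) +
      4^-1 * intC leb (fun x => f x * h x) =
    z * omega u (fun x => f x * h x) +
      z ^+ 2 * intC ups (fun x => f x * h x).

Definition is_quasi_derivative u z f (f1 : R -> R[i]) :=
  (forall x, f1 t @[t --> x^'-] --> f1 x) /\
  {ae leb, forall x, f1 x =
     wderivC f x + 2^-1 * f x - z * (u x + wderiv u x)%:C * f x}.

Definition fundamental_system u ups phi theta :=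
  forall z, exists phi1 theta1 : R -> R[i],
    [/\ is_solution u ups z (phi z) /\ is_solution u ups z (theta z),
        is_quasi_derivative u z (phi z) phi1 /\
          is_quasi_derivative u z (theta z) theta1,
        phi z x / (expR (x / 2))%:C @[x --> -oo] --> (1 : R[i]) /\
          theta z x / (expR (- x / 2))%:C @[x --> -oo] --> (1 : R[i]) &
        phi1 x / (expR (x / 2))%:C @[x --> -oo] --> (1 : R[i]) /\
          theta1 x / (expR (x / 2))%:C @[x --> -oo] --> (0 : R[i])].

(* [m] is only constrained on the nonreal numbers. *)
Definition is_Weyl_Titchmarsh u ups (m : R[i] -> R[i]) :=
  exists phi theta, fundamental_system u ups phi theta /\
    forall z, complex.Im z != 0 ->
      - (theta z x / (z * phi z x)) @[x --> +oo] --> m z.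

Definition measure_support rho : set R :=
  [set x | forall U, open_nbhs x U -> (0 < rho U)%E].

Definition is_spectral_measure u mu rho :=
  [/\ (\int[rho]_l ((1 + l ^+ 2)^-1)%:E < +oo)%E,
      ~ measure_support rho 0 &
      exists ups (m : R[i] -> R[i]),
        [/\ is_upsilon u mu ups, is_Weyl_Titchmarsh u ups m &
            forall z, complex.Im z != 0 ->
              m z = intC rho (fun l => z / (l%:C * (l%:C - z)))]].

End CamassaHolm.

Section coefficients.
Context {R : realType}.
Variables a q : R.

(* [ch_x] and [ch_omega] are meaningful for indices n >= 1. *)
Definition ch_sum (n : nat) : R :=
  \sum_(0 <= k < n) (a * q) ^+ k / qpoch q q k.

Definition ch_x (n : nat) : R := ln (ch_sum n).

Definition ch_omega (n : nat) : R := qpoch q q n.-1 / a ^+ n * ch_sum n.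

Definition ch_u (x : R) : R :=
  2^-1 * limn (fun N => \sum_(1 <= n < N.+1)
                          ch_omega n * expR (- `|x - ch_x n|)).

Definition ch_rho (B : set R) : \bar R :=
  ((qpoch_inf (q / a) q)%:E *
   \sum_(0 <= n <oo) ((a ^- n * q ^+ (n ^ 2)) /
                      (qpoch (q / a) q n * qpoch q q n))%:E *
     \d_(a * q ^- n - 1)%R B)%E.

End coefficients.

(* Main.v *)
(* The substitution f(x) = exp(-x/2) g(exp x) turns the spectral problem for [u]
   into a Krein string carrying the masses (q;q)_n / a^(n+1) at the points
   exp(x_(n+1)).  The slopes A_n of g on the successive intervals satisfy the
   three-term recursion of the polynomials P_n = sum of [n choose k]_q (1+z;q)_k
   a^(-k), and the Weyl-Titchmarsh function is a ratio of limits of such slopes.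
   A q-binomial computation based on the Durfee identity
   sum of q^(m^2) b^m (b q^(m+1);q)_oo / (q;q)_m = 1
   shows that the integral of P_n against the claimed measure is 1 for n = 0 and
   0 otherwise.  Hence Y_n = the integral of P_n / (z - lambda) satisfies the same
   recursion for n >= 1, with an inhomogeneous initial step; since
   Y_n tends to 0, comparing it with the slopes of the two solutions normalised
   at -oo expresses their limits through Y_0, and this is the representation of
   the Weyl-Titchmarsh function.  The limit of the slopes of phi is nonzero for
   nonreal z by a Green identity.  On the line, phi, theta and u are all explicit
   superpositions of the kernels sinh (k (x - x_n)^+), for k = 1/2 or k = 1,
   whose weak equation follows from integration by parts. *)

(* The hypothesis a > 1 makes the string masses summable, keeps every atom a q^-m - 1 at or above a
   - 1 > 0, and makes P_n decay like a^-n at each atom. The hypothesis a q < 1 makes the string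
   finite, so the knots x_n stay in a bounded interval and u is elementary on both sides of them.
   Only the integrals of the P_n are needed, not orthogonality: under the integral of P_(n+1) / (z -
   lambda), replacing 1 + lambda by 1 + z in the recursion costs q^(n+1) times the integral of
   P_(n+1), which is 0. The kernel z / (lambda (lambda - z)) is 1 / (lambda - z) - 1 / lambda, and
   the integral of 1 / lambda is the total mass of the string. The same mass, times z, is the slope
   that theta must have at -oo, because u + u' = total e^x there. The functions on the line are only
   absolutely continuous with infinitely many accumulating knots. Hence integration by parts rests
   on Fubini, and sums are exchanged with integrals through geometric majorants. *)
Require Import Defs.
From HB Require Import structures.
From mathcomp Require Import all_boot all_order all_algebra complex.
From mathcomp Require Import all_classical all_reals all_analysis.
From mathcomp Require Import measurable_realfun.
From mathcomp Require Import ring lra zify.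

Import Order.TTheory GRing.Theory Num.Theory.
Import numFieldNormedType.Exports.
Import Normc.

Local Open Scope classical_set_scope.
Local Open Scope ring_scope.
Local Open Scope complex_scope.

(** * The polynomials P_n: contiguous relations and the three-term recursion *)

Section q_binomial_sums.
Context {K : comNzRingType}.
Implicit Types (q w b c : K) (n : nat).

(* The sum over [k] of [n choose k]_q (w;q)_k b^k. *)
Fixpoint rs q n w b : K :=
  if n is n'.+1 then rs q n' w (b * q) + (1 - w) * b * rs q n' (q * w) b
  else 1.

Lemma rs_0 q w b : rs q 0 w b = 1.
Proof. by []. Qed.

Lemma rs_S q n w b :
  rs q n.+1 w b = rs q n w (b * q) + (1 - w) * b * rs q n (q * w) b.
Proof. by []. Qed.

(** A first-order q-difference relation in b: scaling the k-th summand by 1 - q^k turns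
    [n+1 choose k] into (1 - q^(n+1)) [n choose k-1]. The induction needs w and b free, since the
    recursion shifts both. *)
Lemma rs_mulb q n w b :
  rs q n.+1 w (b * q) =
  rs q n.+1 w b - (1 - q ^+ n.+1) * (1 - w) * b * rs q n (q * w) b.
Proof.
elim: n w b => [|n IH] w b; first by rewrite /=; ring.
rewrite rs_S [in RHS]rs_S (IH w (b * q)) (IH (q * w) b) (rs_S q n (q * w) b).
rewrite !exprS; ring.
Qed.

Lemma rs_mulw q n w b :
  rs q n.+1 (q * w) b = rs q n.+1 w b + w * b * (1 - q ^+ n.+1) * rs q n (q * w) b.
Proof.
elim: n w b => [|n IH] w b; first by rewrite /=; ring.
rewrite (rs_S q n.+1 (q * w)) (rs_S q n.+1 w).
rewrite (IH w (b * q)) (IH (q * w) b).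
rewrite (rs_S q n (q * w) b) !exprS; ring.
Qed.

(** Combining the b-shift and the w-shift with the recursion leaves [q * w] as the only shifted
    argument, in a single term. This is what later removes that term from the three-term
    recursion. *)
Lemma rs_succ q n w b :
  rs q n w b = w * rs q n.+1 w b + (1 - w) * (1 - w * b) * rs q n (q * w) b.
Proof.
rewrite rs_S; case: n => [|n]; first by rewrite /=; ring.
rewrite rs_mulb rs_mulw; ring.
Qed.

Lemma rs_three_term q n w b :
  rs q n.+2 w b = (1 + b - b * w * q ^+ n.+1) * rs q n.+1 w b -
                  b * (1 - q ^+ n.+1) * rs q n w b.
Proof.
rewrite (rs_S q n.+1) rs_mulb rs_mulw (rs_succ q n w b); ring.
Qed.

(** The factor 1 - w b kills the shifted term of [rs_succ]. This is the situation at the lowest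
    atom, where w = a and b = 1/a. *)
Lemma rs_wb1 q n w b : w * b = 1 -> rs q n w b = b ^+ n.
Proof.
move=> wb; elim: n => [|n IH]; first by rewrite expr0.
by rewrite exprS -IH (rs_succ q n) wb subrr mulr0 mul0r addr0 mulrA (mulrC b) wb mul1r.
Qed.

End q_binomial_sums.

(** * Finite and infinite q-Pochhammer products: bounds and convergence *)

Section qpoch.
Context {R : realType}.
Implicit Types (c q : R) (n m : nat).

Lemma qpoch0 c q : qpoch c q 0 = 1.
Proof. by rewrite /qpoch big_geq. Qed.

Lemma qpochS c q n : qpoch c q n.+1 = qpoch c q n * (1 - c * q ^+ n).
Proof. by rewrite /qpoch big_nat_recr. Qed.

Lemma qpoch_add c q n m : qpoch c q (n + m) = qpoch c q n * qpoch (c * q ^+ n) q m.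
Proof.
elim: m => [|m IH]; first by rewrite addn0 qpoch0 mulr1.
by rewrite addnS !qpochS IH exprD !mulrA.
Qed.

Section base.
Variable q : R.
Hypotheses (q_gt0 : 0 < q) (q_lt1 : q < 1).

Let q_ge0 : 0 <= q := ltW q_gt0.
Let oneBq_gt0 : 0 < 1 - q. Proof. by rewrite subr_gt0. Qed.

Lemma expq_ge0 n : 0 <= q ^+ n.
Proof. exact: exprn_ge0. Qed.

Lemma expq_le1 n : q ^+ n <= 1.
Proof. exact: exprn_ile1 (ltW q_lt1). Qed.

Lemma cvg_expq : q ^+ n @[n --> \oo] --> (0 : R).
Proof. by apply: cvg_expr; rewrite ger0_norm. Qed.

Lemma geometric_sum_le n : \sum_(0 <= i < n) q ^+ i <= (1 - q)^-1.
Proof.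
rewrite -[leRHS]mul1r ler_pdivlMr// mulrC.
suff -> : (1 - q) * (\sum_(0 <= i < n) q ^+ i) = 1 - q ^+ n.
  by rewrite gerBl expq_ge0.
elim: n => [|n IH]; first by rewrite big_geq// mulr0 expr0 subrr.
by rewrite big_nat_recr//= mulrDr IH exprS; ring.
Qed.

Lemma qpoch_factor_le1 c n : 0 <= c <= 1 -> 0 <= 1 - c * q ^+ n <= 1.
Proof.
move=> /andP[c0 c1]; rewrite gerBl mulr_ge0 ?expq_ge0// subr_ge0 andbT.
by rewrite mulr_ile1 ?expq_ge0 ?expq_le1.
Qed.

Lemma qpoch_le1 c n : 0 <= c <= 1 -> 0 <= qpoch c q n <= 1.
Proof.
move=> c01; elim: n => [|n /andP[h0 h1]]; first by rewrite qpoch0 ler01 lexx.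
have /andP[g0 g1] := qpoch_factor_le1 c n c01.
by rewrite qpochS mulr_ge0//= mulr_ile1.
Qed.

(** A product of factors 1 - t_i with t_i in [0, 1] is at least 1 minus the sum of the t_i, and that
    sum is geometric. *)
Lemma qpoch_ge c n : 0 <= c <= 1 -> 1 - c / (1 - q) <= qpoch c q n.
Proof.
move=> c01; have /andP[c0 c1] := c01.
suff : 1 - c * \sum_(0 <= i < n) q ^+ i <= qpoch c q n.
  by apply: le_trans; rewrite lerD2l lerN2 ler_wpM2l// geometric_sum_le.
elim: n => [|n IH]; first by rewrite big_geq// mulr0 subr0 qpoch0.
rewrite big_nat_recr//= qpochS.
have /andP[h0 h1] := qpoch_le1 c n c01.
have : qpoch c q n * (c * q ^+ n) <= c * q ^+ n.
  by rewrite ler_piMl// mulr_ge0 ?expq_ge0.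
lra.
Qed.

Lemma qpoch_norm_le c n : 0 <= c -> `|qpoch c q n| <= expR (c / (1 - q)).
Proof.
move=> c0.
suff : `|qpoch c q n| <= expR (c * \sum_(0 <= i < n) q ^+ i).
  move/le_trans; apply; rewrite ler_expR ler_wpM2l// geometric_sum_le//.
elim: n => [|n IH]; first by rewrite big_geq// mulr0 expR0 qpoch0 normr1.
rewrite big_nat_recr//= qpochS normrM mulrDr expRD ler_pM//.
rewrite (le_trans (ler_normB _ _))// normr1 ger0_norm ?mulr_ge0 ?expq_ge0//.
exact: expR_ge1Dx.
Qed.

Lemma is_cvg_qpoch_le1 c : 0 <= c <= 1 -> cvgn (qpoch c q).
Proof.
move=> c01; apply: nonincreasing_is_cvgn.
  apply/nonincreasing_seqP => n; rewrite qpochS ler_piMr//.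
    by have /andP[] := qpoch_le1 c n c01.
  by have /andP[] := qpoch_factor_le1 c n c01.
exists 0 => _ [n _ <-]; by have /andP[] := qpoch_le1 c n c01.
Qed.

Lemma eventually_expq_le (c e : R) : 0 <= c -> 0 < e ->
  exists N, forall n, (N <= n)%N -> c * q ^+ n <= e.
Proof.
move=> c0 e0.
have : (c * q ^+ n) @[n --> \oo] --> c * 0 by apply: cvgMr; exact: cvg_expq.
rewrite mulr0 => /cvgrPdist_le/(_ e e0)[N _ HN]; exists N => n nN.
by have := HN n nN; rewrite sub0r normrN ger0_norm// mulr_ge0 ?expq_ge0.
Qed.

(** Parameters above 1 are needed because the Durfee parameter q^-k / a grows with k. Splitting off
    finitely many factors leads back to c at most 1, where the products decrease. *)
Lemma is_cvg_qpoch c : 0 <= c -> cvgn (qpoch c q).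
Proof.
move=> c0; have [N HN] := eventually_expq_le c 1 c0 ltr01.
have cv : cvgn (qpoch (c * q ^+ N) q).
  by apply: is_cvg_qpoch_le1; rewrite HN// mulr_ge0 ?expq_ge0.
apply/cvg_ex; exists (qpoch c q N * limn (qpoch (c * q ^+ N) q)).
rewrite -(cvg_shiftn N); under eq_fun do rewrite addnC qpoch_add.
exact: cvgMr.
Qed.

Lemma qpoch_infE c n : 0 <= c ->
  qpoch_inf c q = qpoch c q n * qpoch_inf (c * q ^+ n) q.
Proof.
move=> c0; apply: cvg_lim => //; rewrite -(cvg_shiftn n).
under eq_fun do rewrite addnC qpoch_add.
by apply: cvgMr; apply: is_cvg_qpoch; rewrite mulr_ge0 ?expq_ge0.
Qed.

Lemma qpoch_inf_norm_le c : 0 <= c -> `|qpoch_inf c q| <= expR (c / (1 - q)).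
Proof.
move=> c0; have /(@is_cvg_qpoch c) cv := c0.
rewrite -lim_norm//; apply: limr_le; first exact: is_cvg_norm.
by near=> n; exact: qpoch_norm_le.
Unshelve. all: by end_near. Qed.

Lemma qpoch_inf_le1 c : 0 <= c <= 1 -> 0 <= qpoch_inf c q <= 1.
Proof.
move=> c01; apply/andP; split; [apply: limr_ge|apply: limr_le];
  by [exact: is_cvg_qpoch_le1 | near=> n; have /andP[] := qpoch_le1 c n c01].
Unshelve. all: by end_near. Qed.

Lemma qpoch_inf_ge c : 0 <= c <= 1 -> 1 - c / (1 - q) <= qpoch_inf c q.
Proof.
move=> c01; apply: limr_ge; first exact: is_cvg_qpoch_le1.
by near=> n; apply: qpoch_ge.
Unshelve. all: by end_near. Qed.

Lemma qpoch_gt0 c n : 0 <= c < 1 -> 0 < qpoch c q n.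
Proof.
move=> /andP[c0 c1]; elim: n => [|n IH]; first by rewrite qpoch0.
rewrite qpochS mulr_gt0// subr_gt0 (le_lt_trans _ c1)//.
by rewrite ler_piMr// expq_le1.
Qed.

(** The denominators (q;q)_m must be bounded below uniformly in m. *)
Lemma qpoch_lb c : 0 <= c < 1 -> exists2 d : R, 0 < d & forall n, d <= qpoch c q n.
Proof.
move=> c01; have /andP[c0 c1] := c01.
(* With c q^N at most (1 - q) / 2, [qpoch_ge] keeps every product of later factors above 1/2. *)
have [N HN] := eventually_expq_le c ((1 - q) / 2) c0 (divr_gt0 oneBq_gt0 (ltr0Sn _ 1)).
have cN n : (N <= n)%N -> qpoch c q N / 2 <= qpoch c q n.
  move=> /subnKC <-; rewrite qpoch_add ler_pM2l ?qpoch_gt0//.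
  have cq := HN N (leqnn _).
  apply: le_trans (qpoch_ge _ _ _); last first.
    by rewrite mulr_ge0 ?expq_ge0//= (le_trans cq)// ler_pdivrMr//; move: q_gt0; lra.
  suff : c * q ^+ N / (1 - q) <= 2^-1 by lra.
  by rewrite ler_pdivrMr// [leRHS]mulrC.
exists (qpoch c q N / 2); first by rewrite divr_gt0// qpoch_gt0.
move=> n; have [/cN//|/ltnW nN] := leqP N n.
rewrite (@le_trans _ _ (qpoch c q N))//.
  by rewrite ler_pdivrMr// ler_peMr ?ler1n// ltW// qpoch_gt0.
rewrite -(subnKC nN) qpoch_add ler_piMr ?(ltW (qpoch_gt0 _ _ _))//.
suff /(qpoch_le1 (c * q ^+ n) (N - n))/andP[] : 0 <= c * q ^+ n <= 1 by [].
by rewrite mulr_ge0 ?expq_ge0//= mulr_ile1 ?expq_ge0 ?expq_le1// ltW.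
Qed.

(** The ratio of consecutive left-hand sides is x q^m, at most q once m >= N. Each of the first N
    steps costs at most a factor y relative to q^m, whence the constant y^N. *)
Lemma expr_bin2_le (x : R) : 0 <= x ->
  exists2 C, 0 <= C & forall m, x ^+ m * q ^+ 'C(m, 2) <= C * q ^+ m.
Proof.
move=> x0; have [N HN] := eventually_expq_le x q x0 q_gt0.
pose y := Num.max 1 (x / q); have y1 : 1 <= y by rewrite /y le_max lexx.
have y0 : 0 <= y by rewrite (le_trans _ y1).
exists (y ^+ N); first exact: exprn_ge0.
suff H m : x ^+ m * q ^+ 'C(m, 2) <= y ^+ (minn m N) * q ^+ m.
  move=> m; apply: le_trans (H m) _; rewrite ler_wpM2r ?expq_ge0//.
  by rewrite ler_weXn2l// geq_minr.
elim: m => [|m IH]; first by rewrite min0n !expr0 mulr1.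
rewrite binS bin1 exprD exprS.
have -> : x * x ^+ m * (q ^+ 'C(m, 2) * q ^+ m) =
          (x * q ^+ m) * (x ^+ m * q ^+ 'C(m, 2)) by ring.
have [mN|Nm] := ltnP m N.
  rewrite (minn_idPl mN) !exprS.
  have -> : y * y ^+ m * (q * q ^+ m) = (y * q) * (y ^+ m * q ^+ m) by ring.
  rewrite (minn_idPl (ltnW mN)) in IH.
  rewrite ler_pM ?mulr_ge0 ?expq_ge0 ?exprn_ge0//.
  rewrite (@le_trans _ _ x)// ?ler_piMr ?expq_le1//.
  by rewrite -ler_pdivrMr// /y le_max lexx orbT.
rewrite (minn_idPr Nm) in IH; rewrite (minn_idPr (leqW Nm)).
rewrite [q ^+ m.+1]exprS [leRHS]mulrCA ler_pM ?mulr_ge0 ?expq_ge0 ?exprn_ge0//.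
exact: HN.
Qed.

Lemma is_cvg_series_geometric_le (u : R^nat) (C : R) :
  (forall m, `|u m| <= C * q ^+ m) -> cvgn (series u).
Proof.
move=> uC; apply: normed_cvg.
apply: (@series_le_cvg _ _ (geometric C q)) => //.
- by move=> n; exact: normr_ge0.
- by move=> n; exact: (le_trans (normr_ge0 _) (uC n)).
- by apply: is_cvg_geometric_series; rewrite ger0_norm.
Qed.

Lemma series_geometric_le (u : R^nat) (C : R) n : 0 <= C ->
  (forall m, `|u m| <= C * q ^+ m) -> `|series u n| <= C / (1 - q).
Proof.
move=> C0 uC; rewrite /series/= (le_trans (ler_norm_sum _ _ _))//.
rewrite (@le_trans _ _ (\sum_(0 <= k < n) C * q ^+ k)) ?ler_sum//.
by rewrite -mulr_sumr ler_wpM2l// geometric_sum_le.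
Qed.

End base.
End qpoch.

(** One half of q^(m^2) will absorb the growth of P_n at the m-th atom, while the other half still
    beats every geometric sequence. *)
Lemma sqr_bin2 m : (m ^ 2 = 'C(m, 2) + 'C(m, 2) + m)%N.
Proof. by elim: m => // m IH; rewrite binS bin1; lia. Qed.

(** * The Durfee identity: the sum is invariant under b -> b q and tends to 1 as b -> 0 *)

Section Durfee.
Context {R : realType}.
Variable q : R.
Hypotheses (q_gt0 : 0 < q) (q_lt1 : q < 1).
Implicit Types b : R.

Let q_ge0 : 0 <= q := ltW q_gt0.

Definition durfee b (m : nat) : R :=
  q ^+ (m ^ 2) * b ^+ m * qpoch_inf (b * q ^+ m.+1) q / qpoch q q m.

Let q01 : 0 <= q < 1. Proof. by rewrite q_ge0. Qed.

Lemma qpoch_qq_neq0 n : qpoch q q n != 0.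
Proof. by rewrite gt_eqF// qpoch_gt0. Qed.

Lemma exprq_sqr_le m : q ^+ (m ^ 2) <= q ^+ 'C(m, 2).
Proof.
by rewrite sqr_bin2 -addnA exprD ler_piMr ?(expq_ge0 _ q_gt0) ?(expq_le1 _ q_gt0 q_lt1).
Qed.

Lemma durfee_le b : 0 <= b ->
  exists2 C, 0 <= C & forall m, `|durfee b m| <= C * q ^+ m.
Proof.
move=> b0; have [d d0 dq] := qpoch_lb _ q_gt0 q_lt1 q q01.
have [C C0 HC] := expr_bin2_le _ q_gt0 q_lt1 b b0.
pose D := expR (b / (1 - q)).
exists (C * D / d); first by rewrite divr_ge0 ?mulr_ge0 ?expR_ge0 ?(ltW d0).
move=> m; rewrite /durfee !normrM normfV.
rewrite (ger0_norm (expq_ge0 _ q_gt0 _)) (ger0_norm (exprn_ge0 _ b0)).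
rewrite (gtr0_norm (qpoch_gt0 _ q_gt0 q_lt1 _ _ q01)).
have -> : C * D / d * q ^+ m = (C * q ^+ m) * D / d by ring.
rewrite ler_pM ?invr_ge0 ?(ltW (qpoch_gt0 _ q_gt0 q_lt1 _ _ q01))//.
- by rewrite !mulr_ge0 ?exprn_ge0.
- rewrite ler_pM//; first by rewrite !mulr_ge0 ?exprn_ge0.
    by rewrite mulrC; apply: le_trans (HC m); rewrite ler_wpM2l ?exprn_ge0// exprq_sqr_le.
  have bq : 0 <= b * q ^+ m.+1 by rewrite mulr_ge0 ?exprn_ge0.
  apply: le_trans (qpoch_inf_norm_le _ q_gt0 q_lt1 _ bq) _.
  rewrite ler_expR ler_wpM2r ?invr_ge0 ?subr_ge0 ?(ltW q_lt1)//.
  by rewrite ler_piMr// (expq_le1 _ q_gt0 q_lt1).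
- by rewrite lef_pV2 ?posrE ?(qpoch_gt0 _ q_gt0 q_lt1).
Qed.

Lemma is_cvg_durfee b : 0 <= b -> cvgn (series (durfee b)).
Proof.
by move=> /durfee_le[C C0 HC]; exact: (is_cvg_series_geometric_le _ q_gt0 q_lt1 _ C).
Qed.

Let durfee1 b m := q ^+ m * durfee b m.

Let is_cvg_durfee1 b : 0 <= b -> cvgn (series (durfee1 b)).
Proof.
move=> /durfee_le[C C0 HC]; apply: (is_cvg_series_geometric_le _ q_gt0 q_lt1 _ C) => m.
rewrite normrM (ger0_norm (expq_ge0 _ q_gt0 _)) (le_trans _ (HC m))//.
by rewrite ler_piMl// (expq_le1 _ q_gt0 q_lt1).
Qed.

(** The left side is (1 - q^(m+1)) times the summand, and this factor cancels the last factor of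
    (q;q)_(m+1). *)
Let durfee_shift b m : 0 <= b ->
  durfee b m.+1 - durfee1 b m.+1 = b * q * durfee1 (b * q) m.
Proof.
move=> b0; rewrite /durfee1 /durfee qpochS.
have -> : b * q * q ^+ m.+1 = b * q ^+ m.+2 by rewrite [in RHS]exprS mulrA.
have -> : (m.+1 ^ 2 = m ^ 2 + m + m.+1)%N by lia.
have := qpoch_qq_neq0 m; have := qpoch_qq_neq0 m.+1; rewrite qpochS => h1 h2.
rewrite !exprD !exprMn [b ^+ m.+1]exprS.
move: h1; rewrite -!exprS mulf_eq0 negb_or => /andP[_ h1]; rewrite !exprS in h1 *.
by field; apply/andP.
Qed.

(** Peels the first factor 1 - b q^(m+1) off the infinite product. *)
Let durfee1E b m : 0 <= b ->
  durfee1 b m = durfee (b * q) m - b * q * durfee1 (b * q) m.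
Proof.
move=> b0; rewrite /durfee1 /durfee.
have bq : 0 <= b * q ^+ m.+1 by rewrite mulr_ge0 ?exprn_ge0.
rewrite (qpoch_infE _ q_gt0 q_lt1 (b * q ^+ m.+1) 1 bq) qpochS qpoch0 expr0 expr1.
have -> : b * q * q ^+ m.+1 = b * q ^+ m.+1 * q by ring.
rewrite exprMn !exprS; ring.
Qed.

(** Summing [durfee1E] and [durfee_shift] over m produces the series of [durfee1 (b * q)] with
    opposite signs, so it cancels. *)
Let durfee_sum_mulq b : 0 <= b ->
  limn (series (durfee b)) = limn (series (durfee (b * q))).
Proof.
move=> b0; have bq0 : 0 <= b * q by rewrite mulr_ge0.
have h1 : series (durfee1 b) =
    series (durfee (b * q)) \- (fun n => b * q * series (durfee1 (b * q)) n).
  apply/funext => n; rewrite /series/= mulr_sumr -sumrB.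
  by apply: eq_bigr => i _; rewrite durfee1E.
have l1 : limn (series (durfee1 b)) = limn (series (durfee (b * q))) -
    b * q * limn (series (durfee1 (b * q))).
  rewrite h1; apply: cvg_lim => //; apply: cvgB; first exact: is_cvg_durfee.
  by apply: cvgMr; exact: is_cvg_durfee1.
have h2 n : series (durfee b) n.+1 =
    series (durfee1 b) n.+1 + b * q * series (durfee1 (b * q)) n.
  rewrite /series/= !big_nat_recl//= mulr_sumr.
  have -> : durfee1 b 0 = durfee b 0 by rewrite /durfee1 expr0 mul1r.
  rewrite -addrA -big_split/=; congr (_ + _); apply: eq_bigr => i _.
  by rewrite -durfee_shift// addrC subrK.
have : series (durfee b) n.+1 @[n --> \oo] -->
    limn (series (durfee1 b)) + b * q * limn (series (durfee1 (b * q))).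
  under eq_fun do rewrite h2; apply: cvgD.
    by rewrite cvg_shiftS; exact: is_cvg_durfee1.
  by apply: cvgMr; exact: is_cvg_durfee1.
rewrite cvg_shiftS => /cvg_lim -> //.
by rewrite l1 subrK.
Qed.

(** The first part of C comes from the term m = 0, which is (x q;q)_oo and so within x / (1 - q) of
    1. The second part bounds all terms with m >= 1, each of which carries a factor x. *)
Let durfee_sum_small b : 0 <= b <= 1 -> exists2 C, 0 <= C &
  forall x, 0 <= x <= b -> `|limn (series (durfee x)) - 1| <= C * x.
Proof.
move=> /andP[b0 b1]; have [d d0 dq] := qpoch_lb _ q_gt0 q_lt1 q q01.
have oq : 0 < 1 - q by rewrite subr_gt0.
exists ((1 - q)^-1 + d^-1 / (1 - q)).
  by rewrite addr_ge0 ?mulr_ge0 ?invr_ge0 ?(ltW d0) ?(ltW oq).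
move=> x /andP[x0 xb]; have x1 : x <= 1 := le_trans xb b1.
have cv := is_cvg_durfee x x0.
have xq n : 0 <= x * q ^+ n <= 1.
  by rewrite mulr_ge0 ?exprn_ge0//= mulr_ile1 ?exprn_ge0// (expq_le1 _ q_gt0 q_lt1).
have -> : limn (series (durfee x)) - 1 = limn (fun n => series (durfee x) n - 1).
  by apply/esym/cvg_lim => //; apply: cvgB => //; exact: cvg_cst.
have cv1 : cvgn (fun n => series (durfee x) n - 1).
  by apply: is_cvgB => //; exact: is_cvg_cst.
rewrite -lim_norm//; apply: limr_le; first exact: is_cvg_norm.
near=> n.
have -> : n = n.-1.+1 by rewrite prednK//; near: n; exact: nbhs_infty_gt.
rewrite /series/= big_nat_recl//= addrAC mulrDl (le_trans (ler_normD _ _))// lerD//.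
  rewrite /durfee !expr0 !mul1r qpoch0 invr1 mulr1.
  have /andP[h1 h2] := qpoch_inf_le1 _ q_gt0 q_lt1 _ (xq 1%N).
  have := qpoch_inf_ge _ q_gt0 q_lt1 _ (xq 1%N).
  rewrite distrC ger0_norm ?subr_ge0// => h3.
  rewrite (@le_trans _ _ (x * q ^+ 1 / (1 - q)))//; first by lra.
  by rewrite mulrC ler_wpM2l ?invr_ge0 ?(ltW oq)// ler_piMr// ltW.
have := @series_geometric_le _ _ q_gt0 q_lt1 (fun i => durfee x i.+1) (d^-1 * x) n.-1.
have -> : d^-1 / (1 - q) * x = d^-1 * x / (1 - q) by ring.
apply; first by rewrite mulr_ge0// invr_ge0 ltW.
move=> i; rewrite /durfee !normrM normfV.
rewrite (ger0_norm (expq_ge0 _ q_gt0 _)) (ger0_norm (exprn_ge0 _ x0)).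
rewrite (gtr0_norm (qpoch_gt0 _ q_gt0 q_lt1 _ _ q01)).
have /andP[h1 h2] := qpoch_inf_le1 _ q_gt0 q_lt1 _ (xq i.+2).
rewrite (ger0_norm h1).
have -> : d^-1 * x * q ^+ i = (q ^+ i * x * 1) * d^-1 by ring.
rewrite ler_pM ?lef_pV2 ?posrE ?(qpoch_gt0 _ q_gt0 q_lt1)//.
- by rewrite !mulr_ge0 ?exprn_ge0.
- by rewrite invr_ge0 (ltW (qpoch_gt0 _ q_gt0 q_lt1 _ _ q01)).
rewrite ler_pM ?mulr_ge0 ?exprn_ge0// ler_pM ?exprn_ge0//.
  by rewrite ler_wiXn2l// ?(ltW q_lt1)//; lia.
by rewrite exprS ler_piMr// exprn_ile1.
Unshelve. all: by end_near. Qed.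

Lemma durfee_sum b : 0 <= b -> series (durfee b) @ \oo --> (1 : R).
Proof.
move=> b0; have cv := is_cvg_durfee b b0.
suff <- : limn (series (durfee b)) = 1 by [].
have inv n : limn (series (durfee b)) = limn (series (durfee (b * q ^+ n))).
  elim: n => [|n IH]; first by rewrite expr0 mulr1.
  by rewrite IH durfee_sum_mulq ?mulr_ge0 ?exprn_ge0// exprSr mulrA.
have [N HN] := eventually_expq_le _ q_gt0 q_lt1 b 1 b0 ltr01.
have c01 : 0 <= b * q ^+ N <= 1 by rewrite mulr_ge0 ?exprn_ge0//= HN.
have [C C0 HC] := durfee_sum_small _ c01.
apply/eqP; rewrite -subr_eq0 -normr_le0; apply/ler_addgt0Pr => e e0; rewrite add0r.
have [N2 HN2] := eventually_expq_le _ q_gt0 q_lt1 (C * b) e (mulr_ge0 C0 b0) e0.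
rewrite (inv (maxn N N2)); apply: le_trans (HC _ _) _.
  rewrite mulr_ge0 ?exprn_ge0//= ler_wpM2l// ler_wiXn2l ?(ltW q_lt1)//.
  exact: leq_maxl.
by rewrite mulrA HN2// leq_maxr.
Qed.

End Durfee.

(** * Integrals of the P_n against the claimed measure, and their size at the atoms *)

Section rho.
Context {R : realType}.
Variables a q : R.
Hypotheses (q_gt0 : 0 < q) (a_gt1 : 1 < a) (aq_lt1 : a * q < 1).

Let a_gt0 : 0 < a := lt_trans ltr01 a_gt1.
Let a_ge0 : 0 <= a := ltW a_gt0.
Let q_ge0 : 0 <= q := ltW q_gt0.
Let q_neq0 : q != 0 := lt0r_neq0 q_gt0.
Let a_neq0 : a != 0 := lt0r_neq0 a_gt0.

Lemma q_lt1 : q < 1.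
Proof. by move: a_gt1 aq_lt1 q_gt0; nra. Qed.

Lemma q_div_a : 0 <= q / a < 1.
Proof.
rewrite divr_ge0//= ltr_pdivrMr// mul1r (lt_trans q_lt1)//.
Qed.

Definition rho_weight (m : nat) : R := qpoch_inf (q / a) q *
  (a ^- m * q ^+ (m ^ 2) / (qpoch (q / a) q m * qpoch q q m)).

(* The atoms of the spectral measure are [rho_w m - 1]; the shift turns the
   recursions below into q-shifts of the variable. *)
Definition rho_w (m : nat) : R := a * q ^- m.

(** Dividing (q/a;q)_oo by (q/a;q)_m leaves the tail (q^(m+1)/a;q)_oo. In particular the total mass
    is 1. *)
Lemma rho_weightE m : rho_weight m = durfee q a^-1 m.
Proof.
rewrite /rho_weight /durfee (qpoch_infE q q_gt0 q_lt1 (q / a) m); last first.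
  by have /andP[] := q_div_a.
have -> : q / a * q ^+ m = a^-1 * q ^+ m.+1 by rewrite exprS; ring.
have := qpoch_gt0 q q_gt0 q_lt1 (q / a) m q_div_a.
move=> /lt0r_neq0 h1; have h2 := qpoch_qq_neq0 q q_gt0 q_lt1 m.
by rewrite exprVn; field; rewrite expf_neq0// h1 h2.
Qed.

Lemma rho_weight_ge0 m : 0 <= rho_weight m.
Proof.
have /andP[h0 h1] := q_div_a.
rewrite /rho_weight mulr_ge0//.
  have : 0 <= q / a <= 1 by rewrite h0 ltW.
  by move=> /(qpoch_inf_le1 q q_gt0 q_lt1)/andP[].
rewrite !mulr_ge0 ?invr_ge0 ?exprn_ge0//.
have q01 : 0 <= q < 1 by rewrite q_ge0 q_lt1.
by rewrite ltW// mulr_gt0// (qpoch_gt0 q q_gt0 q_lt1)// q_div_a.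
Qed.

Definition rho_sum (f : nat -> R) (v : R) :=
  series (fun m => rho_weight m * f m) @ \oo --> v.

Lemma rho_sum_ext f g v : f =1 g -> rho_sum f v -> rho_sum g v.
Proof. by move=> /funext ->. Qed.

Lemma rho_sumD f g v w : rho_sum f v -> rho_sum g w -> rho_sum (f \+ g) (v + w).
Proof.
move=> fv gw; rewrite /rho_sum.
have -> : series (fun m => rho_weight m * (f \+ g) m) =
  series (fun m => rho_weight m * f m) + series (fun m => rho_weight m * g m).
  apply/funext => n; rewrite /series/= fctE -big_split/=.
  by apply: eq_bigr => i _; rewrite mulrDr.
exact: cvgD.
Qed.

Lemma rho_sumZ f v k : rho_sum f v -> rho_sum (fun m => k * f m) (k * v).
Proof.
move=> fv; rewrite /rho_sum.
have -> : series (fun m => rho_weight m * (k * f m)) =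
  (fun n => k * series (fun m => rho_weight m * f m) n).
  apply/funext => n; rewrite /series/= mulr_sumr.
  by apply: eq_bigr => i _; rewrite mulrCA.
exact: cvgMr.
Qed.

(** Each factor (1 - a q^(k-m)) / a equals -q^(k-m) (1 - q^(m-k) / a), so it extends the infinite
    product by one factor at its start and moves the Durfee parameter from q^-k / a to q^-(k+1) /
    a. *)
Lemma rho_weight_qpoch k m :
  rho_weight m * (qpoch (rho_w m) q k * a ^- k) =
  (-1) ^+ k * q ^+ 'C(k, 2) * durfee q (a^-1 * q ^- k) m.
Proof.
rewrite rho_weightE; elim: k => [|k IH].
  by rewrite qpoch0 !expr0 invr1 !mulr1 mul1r.
have -> : durfee q a^-1 m * (qpoch (rho_w m) q k.+1 * a ^- k.+1) =
   durfee q a^-1 m * (qpoch (rho_w m) q k * a ^- k) * ((1 - rho_w m * q ^+ k) / a).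
  by rewrite qpochS [a ^+ k.+1]exprS invfM; ring.
rewrite IH /durfee.
have c0 : 0 <= a^-1 * q ^- k.+1 * q ^+ m.+1.
  by rewrite !mulr_ge0 ?invr_ge0 ?exprn_ge0.
rewrite (qpoch_infE q q_gt0 q_lt1 _ 1 c0) qpochS qpoch0 !expr0 mulr1 mul1r.
have qk : q ^+ k != 0 by rewrite expf_neq0.
have qm : q ^+ m != 0 by rewrite expf_neq0.
have -> : a^-1 * q ^- k.+1 * q ^+ m.+1 * q ^+ 1 = a^-1 * q ^- k * q ^+ m.+1.
  by rewrite !exprS expr0; field; rewrite a_neq0 qk q_neq0.
rewrite binS bin1 exprD [(-1) ^+ k.+1]exprS /rho_w.
have -> : (a^-1 * q ^- k) ^+ m = a ^- m * (q ^+ (k * m))^-1.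
  by rewrite exprMn exprM !exprVn.
have -> : (a^-1 * q ^- k.+1) ^+ m = a ^- m * (q ^+ (k * m))^-1 * q ^- m.
  by rewrite exprMn exprS invfM exprMn !exprVn exprM; ring.
have -> : a^-1 * q ^- k.+1 * q ^+ m.+1 = a^-1 * q ^- k * q ^+ m.
  by rewrite !exprS; field; rewrite a_neq0 qk q_neq0.
field.
by rewrite (qpoch_qq_neq0 q q_gt0 q_lt1) a_neq0 !expf_neq0.
Qed.

(** The statement is general in k and c because the recursion of [rs] multiplies b by q in one term
    and w by q in the other. The two induction hypotheses recombine through the first factor 1 - c a
    q^k of the value. *)
Lemma rho_sum_qpoch_rs n k c :
  rho_sum (fun m => qpoch (rho_w m) q k * a ^- k * rs q n (q ^+ k * rho_w m) c)
    ((-1) ^+ k * q ^+ 'C(k, 2) * qpoch (c * a * q ^+ k) q n).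
Proof.
elim: n k c => [|n IH] k c.
  rewrite qpoch0 mulr1 /rho_sum /=.
  have -> : series (fun m => rho_weight m * (qpoch (rho_w m) q k * a ^- k * 1)) =
    (fun n => (-1) ^+ k * q ^+ 'C(k, 2) * series (durfee q (a^-1 * q ^- k)) n).
    apply/funext => n; rewrite /series/= mulr_sumr.
    by apply: eq_bigr => i _; rewrite mulr1 rho_weight_qpoch.
  rewrite -[X in _ --> X]mulr1; apply: cvgMr; apply: (durfee_sum q q_gt0 q_lt1).
  by rewrite mulr_ge0 ?invr_ge0 ?exprn_ge0.
have -> : (-1) ^+ k * q ^+ 'C(k, 2) * qpoch (c * a * q ^+ k) q n.+1 =
  (-1) ^+ k * q ^+ 'C(k, 2) * qpoch (c * q * a * q ^+ k) q n +
  c * a * ((-1) ^+ k.+1 * q ^+ 'C(k.+1, 2) * qpoch (c * a * q ^+ k.+1) q n).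
  rewrite -[n.+1]add1n qpoch_add qpochS qpoch0 expr0 expr1 binS bin1 exprD exprS.
  have -> : c * q * a * q ^+ k = c * a * q ^+ k * q by ring.
  have -> : c * a * q ^+ k.+1 = c * a * q ^+ k * q by rewrite exprS; ring.
  ring.
apply: rho_sum_ext (rho_sumD _ _ _ _ (IH k (c * q)) (rho_sumZ _ _ (c * a) (IH k.+1 c))).
move=> m /=; rewrite qpochS !exprS.
have ak : a ^+ k != 0 by rewrite expf_neq0.
have -> : q * q ^+ k * rho_w m = q * (q ^+ k * rho_w m) by ring.
by field; rewrite ak a_neq0.
Qed.

Lemma rho_sum_rs n : rho_sum (fun m => rs q n (rho_w m) a^-1) (n == 0)%:R.
Proof.
have := rho_sum_qpoch_rs n 0 a^-1.
rewrite !expr0 mulVf// !mul1r.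
(* At k = 0 and c = 1/a the value is (1;q)_n, whose first factor is 0. *)
have -> : qpoch 1 q n = (n == 0)%:R.
  case: n => [|n]; first by rewrite qpoch0.
  by rewrite -[n.+1]add1n qpoch_add qpochS qpoch0 expr0 mulr1 subrr mulr0 mul0r.
by apply: rho_sum_ext => m; rewrite qpoch0 invr1 !mul1r.
Qed.

Definition rs_growth m : R := \prod_(0 <= i < m) (1 + a * q ^- i.+1).

Lemma rs_growth_ge0 m : 0 <= rs_growth m.
Proof.
by rewrite /rs_growth prodr_ge0// => i _; rewrite addr_ge0// mulr_ge0 ?invr_ge0 ?exprn_ge0.
Qed.

(** At the lowest atom P_n is exactly a^-n; going up one atom preserves this decay in n at the cost
    of a factor depending on m only. *)
Lemma rs_rho_w_le n m : `|rs q n (rho_w m) a^-1| <= a ^- n * rs_growth m.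
Proof.
elim: m n => [|m IH] n.
  rewrite /rs_growth big_geq// mulr1 rs_wb1 ?exprVn ?ger0_norm ?invr_ge0 ?exprn_ge0//.
  by rewrite /rho_w expr0 invr1 mulr1 mulfV.
have qw : q * rho_w m.+1 = rho_w m.
  rewrite /rho_w exprS; have : q ^+ m != 0 by rewrite expf_neq0.
  by move=> h; field; rewrite h q_neq0.
have gS : rs_growth m.+1 = rs_growth m * (1 + a * q ^- m.+1).
  by rewrite /rs_growth big_nat_recr.
have g1 : rs_growth m <= rs_growth m.+1.
  by rewrite gS ler_peMr ?rs_growth_ge0// lerDl mulr_ge0 ?invr_ge0 ?exprn_ge0.
case: n => [|n].
  by apply: le_trans (IH 0) _; rewrite expr0 invr1 !mul1r.
(* Since q w_(m+1) = w_m, [rs_mulw] expresses the value at w_(m+1) through values at w_m only. *)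
have -> : rs q n.+1 (rho_w m.+1) a^-1 = rs q n.+1 (rho_w m) a^-1 -
    rho_w m.+1 * a^-1 * (1 - q ^+ n.+1) * rs q n (rho_w m) a^-1.
  by have := rs_mulw q n (rho_w m.+1) a^-1; rewrite qw => ->; rewrite addrK.
rewrite (le_trans (ler_normB _ _))// gS.
have -> : a ^- n.+1 * (rs_growth m * (1 + a * q ^- m.+1)) =
   a ^- n.+1 * rs_growth m + a * q ^- m.+1 * a^-1 * 1 * (a ^- n * rs_growth m).
  by rewrite [a ^+ n.+1]exprS invfM; ring.
rewrite lerD ?IH// /rho_w !normrM.
rewrite (ger0_norm a_ge0) [`|q ^- _|]ger0_norm ?invr_ge0 ?exprn_ge0//.
rewrite [`|a^-1|]ger0_norm ?invr_ge0//.
rewrite ler_pM ?mulr_ge0 ?invr_ge0 ?exprn_ge0// ler_pM ?mulr_ge0 ?invr_ge0 ?exprn_ge0//.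
rewrite ger0_norm ?subr_ge0; first by rewrite gerBl exprn_ge0.
exact: (expq_le1 q q_gt0 q_lt1).
Qed.

Lemma rs_growth_le m : rs_growth m <= (1 + a) ^+ m * (q ^+ 'C(m, 2) * q ^+ m)^-1.
Proof.
elim: m => [|m IH]; first by rewrite /rs_growth big_geq// bin0n !expr0 !mul1r invr1.
have -> : rs_growth m.+1 = rs_growth m * (1 + a * q ^- m.+1).
  by rewrite /rs_growth big_nat_recr.
have -> : (1 + a) ^+ m.+1 * (q ^+ 'C(m.+1, 2) * q ^+ m.+1)^-1 =
    (1 + a) ^+ m * (q ^+ 'C(m, 2) * q ^+ m)^-1 * ((1 + a) * q ^- m.+1).
  by rewrite binS bin1 exprD [(1 + a) ^+ m.+1]exprS; field; rewrite !expf_neq0.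
rewrite ler_pM ?rs_growth_ge0//.
  by rewrite addr_ge0// mulr_ge0 ?invr_ge0 ?exprn_ge0.
rewrite mulrDl mul1r lerD2r invf_ge1 ?exprn_gt0//.
exact: (expq_le1 q q_gt0 q_lt1).
Qed.

(** The weight carries q^(m^2) and the growth bound q^-(binomial(m,2) + m). What remains is a
    geometric factor times q^binomial(m,2), which [expr_bin2_le] controls. *)
Lemma rho_weight_growth : exists2 C, 0 <= C &
  forall m, rho_weight m * rs_growth m <= C * q ^+ m.
Proof.
have [d d0 dq] : exists2 d : R, 0 < d & forall n, d <= qpoch q q n.
  by apply: (qpoch_lb q q_gt0 q_lt1); rewrite q_ge0 q_lt1.
have x0 : 0 <= a^-1 * (1 + a) by rewrite mulr_ge0 ?invr_ge0// addr_ge0.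
have [C C0 HC] := expr_bin2_le q q_gt0 q_lt1 _ x0.
exists (d^-1 * C); first by rewrite mulr_ge0 ?invr_ge0 ?(ltW d0).
move=> m; rewrite -[leRHS]mulrA (le_trans (ler_wpM2l (rho_weight_ge0 m) (rs_growth_le m)))//.
have rle : rho_weight m <= d^-1 * (q ^+ (m ^ 2) * a^-1 ^+ m).
  rewrite rho_weightE /durfee.
  have h01 : 0 <= a^-1 * q ^+ m.+1 <= 1.
    rewrite mulr_ge0 ?invr_ge0 ?exprn_ge0//= mulr_ile1 ?invr_ge0 ?exprn_ge0//.
      by rewrite invf_le1// ltW.
    exact: (expq_le1 q q_gt0 q_lt1).
  have /andP[i0 i1] := qpoch_inf_le1 q q_gt0 q_lt1 _ h01.
  rewrite [leRHS]mulrC ler_pM//.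
  - by rewrite !mulr_ge0 ?exprn_ge0 ?invr_ge0.
  - by rewrite invr_ge0 (le_trans (ltW d0)).
  - by rewrite ler_piMr// mulr_ge0 ?exprn_ge0 ?invr_ge0.
  - by rewrite lef_pV2 ?posrE// (lt_le_trans d0).
apply: (le_trans (ler_wpM2r _ rle)).
  by rewrite mulr_ge0 ?exprn_ge0 ?addr_ge0// invr_ge0 mulr_ge0 ?exprn_ge0.
rewrite -mulrA ler_wpM2l ?invr_ge0 ?(ltW d0)//; apply: le_trans (HC m).
rewrite sqr_bin2 exprMn !exprD le_eqVlt; apply/orP; left; apply/eqP.
by field; rewrite ?a_neq0 !expf_neq0.
Qed.

End rho.

Local Arguments rs : simpl never.

(** * Limits in the complex numbers, by real and imaginary parts *)

Section complex_limits.
Context {R : realType}.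
Implicit Types (x y : R) (z w : R[i]).

Lemma RecD z w : complex.Re (z + w) = complex.Re z + complex.Re w.
Proof. by case: z w => [? ?] [? ?]. Qed.
Lemma ImcD z w : complex.Im (z + w) = complex.Im z + complex.Im w.
Proof. by case: z w => [? ?] [? ?]. Qed.
Lemma RecN z : complex.Re (- z) = - complex.Re z.
Proof. by case: z. Qed.
Lemma ImcN z : complex.Im (- z) = - complex.Im z.
Proof. by case: z. Qed.
Lemma RecM z w : complex.Re (z * w) =
  complex.Re z * complex.Re w - complex.Im z * complex.Im w.
Proof. by case: z w => [? ?] [? ?]. Qed.
Lemma ImcM z w : complex.Im (z * w) =
  complex.Re z * complex.Im w + complex.Im z * complex.Re w.
Proof. by case: z w => [? ?] [? ?]. Qed.

Lemma eq_ReIm z w : complex.Re z = complex.Re w -> complex.Im z = complex.Im w -> z = w.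
Proof. by case: z w => [? ?] [? ?] /= -> ->. Qed.

Lemma Rec_sum (I : Type) (r : seq I) (P : pred I) (F : I -> R[i]) :
  complex.Re (\sum_(i <- r | P i) F i) = \sum_(i <- r | P i) complex.Re (F i).
Proof. by apply: (big_morph _ RecD). Qed.

Lemma Imc_sum (I : Type) (r : seq I) (P : pred I) (F : I -> R[i]) :
  complex.Im (\sum_(i <- r | P i) F i) = \sum_(i <- r | P i) complex.Im (F i).
Proof. by apply: (big_morph _ ImcD). Qed.

Lemma normc_le_ReIm z : `|z| <= (`|complex.Re z| + `|complex.Im z|)%:C.
Proof.
rewrite {1}(complexE z) (le_trans (ler_normD _ _))// normrM rmorphD/=.
by rewrite !normc_def/= !expr0n/= expr1n !addr0 add0r !sqrtr_sqr sqrtr1 mul1r.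
Qed.

Lemma Im_le_normc z : `|complex.Im z|%:C <= `|z|.
Proof.
by rewrite normc_def lecR -sqrtr_sqr ler_wsqrtr// lerDr sqr_ge0.
Qed.

Lemma cvgC {T : Type} (F : set_system T) {FF : ProperFilter F} (f : T -> R[i]) (l : R[i]) :
  complex.Re (f t) @[t --> F] --> complex.Re l ->
  complex.Im (f t) @[t --> F] --> complex.Im l ->
  f t @[t --> F] --> l.
Proof.
move=> /cvgrPdist_lt cr /cvgrPdist_lt ci; apply/cvgrPdist_lt => e e0.
(* The norm takes values in [R[i]], so the radius is a positive complex number, hence real. *)
have /andP[/eqP/= ime ree] : (complex.Im e == 0) && (0 < complex.Re e).
  by move: e0; rewrite ltcE.
have eE : e = (complex.Re e)%:C by apply: eq_ReIm.
have e2 : 0 < complex.Re e / 2 by rewrite divr_gt0.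
near=> t; apply: le_lt_trans (normc_le_ReIm _) _.
rewrite eE ltcR RecD ImcD RecN ImcN [ltRHS]splitr ltrD//; near: t.
  exact: cr.
exact: ci.
Unshelve. all: by end_near. Qed.

Lemma cvgC_Re {T : Type} (F : set_system T) {FF : ProperFilter F} (f : T -> R[i]) (l : R[i]) :
  f t @[t --> F] --> l -> complex.Re (f t) @[t --> F] --> complex.Re l.
Proof.
move=> /cvgrPdist_lt cf; apply/cvgrPdist_lt => e e0.
have e1 : 0 < e%:C by rewrite ltcR.
near=> t; rewrite -ltcR -RecN -RecD; apply: le_lt_trans (normc_ge_Re _) _.
by near: t; exact: cf.
Unshelve. all: by end_near. Qed.

Lemma cvgC_Im {T : Type} (F : set_system T) {FF : ProperFilter F} (f : T -> R[i]) (l : R[i]) :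
  f t @[t --> F] --> l -> complex.Im (f t) @[t --> F] --> complex.Im l.
Proof.
move=> /cvgrPdist_lt cf; apply/cvgrPdist_lt => e e0.
have e1 : 0 < e%:C by rewrite ltcR.
near=> t; rewrite -ltcR -ImcN -ImcD; apply: le_lt_trans (Im_le_normc _) _.
by near: t; exact: cf.
Unshelve. all: by end_near. Qed.

Lemma cvgC_unique (u : nat -> R[i]) (l l' : R[i]) :
  u @ \oo --> l -> u @ \oo --> l' -> l = l'.
Proof.
have Ru (f : R^nat) (x y : R) : f @ \oo --> x -> f @ \oo --> y -> x = y.
  by move=> fx fy; rewrite -(cvg_lim (@Rhausdorff R) fx) (cvg_lim (@Rhausdorff R) fy).
move=> ul ul'; apply: eq_ReIm.
  apply: (Ru (fun n => complex.Re (u n))).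
    exact: (@cvgC_Re _ \oo _ u l ul).
  exact: (@cvgC_Re _ \oo _ u l' ul').
apply: (Ru (fun n => complex.Im (u n))).
  exact: (@cvgC_Im _ \oo _ u l ul).
exact: (@cvgC_Im _ \oo _ u l' ul').
Qed.

Section cvgC_arith.
Context {T : Type} (F : set_system T) {FF : ProperFilter F}.
Variables (f g : T -> R[i]) (l l' : R[i]).
Hypotheses (fl : f @ F --> l) (gl : g @ F --> l').

Lemma cvgC_D : (fun t => f t + g t) @ F --> l + l'.
Proof. exact: cvgD fl gl. Qed.

Lemma cvgC_B : (fun t => f t - g t) @ F --> l - l'.
Proof. exact: cvgB fl gl. Qed.

Lemma cvgC_M : (fun t => f t * g t) @ F --> l * l'.
Proof. exact: cvgM fl gl. Qed.

Lemma cvgC_Mr (k : R[i]) : (fun t => k * f t) @ F --> k * l.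
Proof. exact: cvgMr fl. Qed.

Lemma cvgC_V : l != 0 -> (fun t => (f t)^-1) @ F --> l^-1.
Proof. move=> l0; exact: cvgV fl. Qed.

End cvgC_arith.

Lemma cvgC_cst {T : Type} (F : set_system T) {FF : ProperFilter F} (l : R[i]) :
  (fun=> l) @ F --> l.
Proof. exact: cvg_cst. Qed.

End complex_limits.

(** * Cauchy transforms of the P_n against the spectral measure *)

Section second_kind.
Context {R : realType}.
Variables a q : R.
Hypotheses (q_gt0 : 0 < q) (a_gt1 : 1 < a) (aq_lt1 : a * q < 1).

Let a_gt0 : 0 < a := lt_trans ltr01 a_gt1.
Let a_neq0 : a != 0 := lt0r_neq0 a_gt0.
Let q_lt1 : q < 1 := q_lt1 a q q_gt0 a_gt1 aq_lt1.
Let a_neq0C : a%:C != 0.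
Proof. by rewrite eq_complex/= negb_and a_neq0. Qed.

Local Notation rhow := (rho_weight a q).

Definition rho_sumC (f : nat -> R[i]) (v : R[i]) :=
  (fun n => \sum_(0 <= m < n) (rhow m)%:C * f m) @ \oo --> v.

Lemma rho_sumC_ext f g v : f =1 g -> rho_sumC f v -> rho_sumC g v.
Proof. by move=> /funext ->. Qed.

Lemma rho_sumCD f g v w : rho_sumC f v -> rho_sumC g w -> rho_sumC (f \+ g) (v + w).
Proof.
move=> fv gw; rewrite /rho_sumC.
have -> : (fun n => \sum_(0 <= m < n) (rhow m)%:C * (f \+ g) m) =
  (fun n => \sum_(0 <= m < n) (rhow m)%:C * f m + \sum_(0 <= m < n) (rhow m)%:C * g m).
  by apply/funext => n; rewrite -big_split/=; apply: eq_bigr => i _; rewrite mulrDr.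
exact: (@cvgC_D _ _ \oo _ _ _ _ _ fv gw).
Qed.

Lemma rho_sumCZ f v k : rho_sumC f v -> rho_sumC (fun m => k * f m) (k * v).
Proof.
move=> fv; rewrite /rho_sumC.
have -> : (fun n => \sum_(0 <= m < n) (rhow m)%:C * (k * f m)) =
  (fun n => k * \sum_(0 <= m < n) (rhow m)%:C * f m).
  by apply/funext => n; rewrite mulr_sumr; apply: eq_bigr => i _; rewrite mulrCA.
exact: (@cvgC_Mr _ _ \oo _ _ _ fv k).
Qed.

Lemma rho_sumC_ReIm f v :
  rho_sum a q (fun m => complex.Re (f m)) (complex.Re v) ->
  rho_sum a q (fun m => complex.Im (f m)) (complex.Im v) -> rho_sumC f v.
Proof.
move=> fr fi; rewrite /rho_sumC.
have hr : (fun n => complex.Re (\sum_(0 <= m < n) (rhow m)%:C * f m)) =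
    series (fun m => rhow m * complex.Re (f m)).
  by apply/funext => n; rewrite Rec_sum; apply: eq_bigr => i _; rewrite RecM/= mul0r subr0.
have hi : (fun n => complex.Im (\sum_(0 <= m < n) (rhow m)%:C * f m)) =
    series (fun m => rhow m * complex.Im (f m)).
  by apply/funext => n; rewrite Imc_sum; apply: eq_bigr => i _; rewrite ImcM/= mul0r addr0.
by apply: (@cvgC _ _ \oo); rewrite ?hr ?hi.
Qed.

Lemma rho_sumC_real f v : rho_sum a q f v -> rho_sumC (fun m => (f m)%:C) v%:C.
Proof.
move=> fv; apply: rho_sumC_ReIm => //=; rewrite /rho_sum.
rewrite (_ : series _ = cst 0); first exact: cvg_cst.
by apply/funext => n; rewrite /series/= big1// => i _; rewrite mulr0.
Qed.

Lemma rho_sumC_unique f v w : rho_sumC f v -> rho_sumC f w -> v = w.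
Proof. exact: cvgC_unique. Qed.

Section cauchy.
Variables (z : R[i]) (D : R).
Let w := 1 + z.
Let lam m : R := rho_w a q m - 1.
Let k m : R[i] := (z - (lam m)%:C)^-1.
Hypotheses (D_ge0 : 0 <= D) (zlam : forall m, z - (lam m)%:C != 0)
  (kD : forall m, `|complex.Re (k m)| <= D /\ `|complex.Im (k m)| <= D).

Let T n m : R[i] := (rs q n (rho_w a q m) a^-1)%:C * k m.

(** Applied to the real and the imaginary part of the Cauchy kernel: it gives both the existence of
    [Y n] and its decay of order a^-n. *)
Let real_part (x : nat -> R) : (forall m, `|x m| <= D) ->
  exists2 C, 0 <= C & forall n,
    let u := fun m => rhow m * (rs q n (rho_w a q m) a^-1 * x m) in
    cvgn (series u) /\ `|limn (series u)| <= C * a^-1 ^+ n.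
Proof.
move=> xD; have [C C0 HC] := rho_weight_growth a q q_gt0 a_gt1 aq_lt1.
have ub n m : `|rhow m * (rs q n (rho_w a q m) a^-1 * x m)| <= C * D * a ^- n * q ^+ m.
  rewrite normrM (ger0_norm (rho_weight_ge0 a q q_gt0 a_gt1 aq_lt1 m)) normrM.
  have h := rs_rho_w_le a q q_gt0 a_gt1 aq_lt1 n m.
  have -> : C * D * a ^- n * q ^+ m = (C * q ^+ m) * (a ^- n * D) by ring.
  apply: le_trans (ler_wpM2r _ (HC m)); last first.
    by rewrite mulr_ge0 ?invr_ge0 ?exprn_ge0 ?(ltW a_gt0).
  have -> : rhow m * rs_growth a q m * (a ^- n * D) =
            rhow m * ((a ^- n * rs_growth a q m) * D) by ring.
  rewrite ler_wpM2l ?(rho_weight_ge0 a q q_gt0 a_gt1 aq_lt1)// ler_pM//.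
exists (C * D / (1 - q)); first by rewrite !mulr_ge0 ?invr_ge0 ?subr_ge0 ?(ltW q_lt1).
move=> n u; have cv : cvgn (series u).
  exact: (is_cvg_series_geometric_le q q_gt0 q_lt1 u _ (ub n)).
split=> //; rewrite -lim_norm//; apply: limr_le; first exact: is_cvg_norm.
have h0 : 0 <= C * D * a ^- n.
  by rewrite !mulr_ge0 ?invr_ge0 ?exprn_ge0 ?(ltW a_gt0).
near=> N; rewrite exprVn mulrAC.
exact: (series_geometric_le q q_gt0 q_lt1 u _ N h0 (ub n)).
Unshelve. all: by end_near. Qed.

Let Y_exists : exists Y : nat -> R[i],
  (forall n, rho_sumC (T n) (Y n)) /\ Y @ \oo --> (0 : R[i]).
Proof.
have [C1 C10 H1] := real_part _ (fun m => (kD m).1).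
have [C2 C20 H2] := real_part _ (fun m => (kD m).2).
exists (fun n =>
  limn (series (fun m => rhow m * (rs q n (rho_w a q m) a^-1 * complex.Re (k m)))) +i*
  limn (series (fun m => rhow m * (rs q n (rho_w a q m) a^-1 * complex.Im (k m))))).
have dec (C : R) (x : R^nat) : (forall n, `|x n| <= C * a^-1 ^+ n) -> x @ \oo --> (0 : R).
  move=> xC; apply/norm_cvg0P.
  apply: (@squeeze_cvgr nat \oo _ R (fun=> 0) (fun n => C * a^-1 ^+ n)).
  - by near=> n; rewrite normr_ge0 xC.
  - exact: cvg_cst.
  - rewrite -[X in _ --> X](mulr0 C); apply: cvgMr; apply: cvg_expr.
    by rewrite ger0_norm ?invr_ge0 ?(ltW a_gt0)// invf_lt1.
split=> [n|].
  apply: rho_sumC_ReIm; rewrite /rho_sum /T /=.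
    rewrite (_ : (fun m => _) = (fun m => rhow m *
      (rs q n (rho_w a q m) a^-1 * complex.Re (k m)))); first exact: (H1 n).1.
    by apply/funext => m; rewrite RecM/= mul0r subr0.
  rewrite (_ : (fun m => _) = (fun m => rhow m *
    (rs q n (rho_w a q m) a^-1 * complex.Im (k m)))); first exact: (H2 n).1.
  by apply/funext => m; rewrite ImcM/= mul0r addr0.
apply: (@cvgC _ _ \oo) => /=.
  by apply: (dec C1) => n; exact: (H1 n).2.
by apply: (dec C2) => n; exact: (H2 n).2.
Unshelve. all: by end_near. Qed.

(* [Y n] is the integral of [rs n / (z - lambda)] against the spectral measure,
   a decaying solution of the three-term recursion. *)
Lemma second_kind_exists : exists Y : nat -> R[i],
  [/\ rho_sumC k (Y 0%N), Y @ \oo --> (0 : R[i]),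
      a%:C * Y 1%N = (a%:C - z) * Y 0%N + 1 &
      forall n, a%:C * Y n.+2 = (a%:C + 1 - w * q%:C ^+ n.+1) * Y n.+1 -
                                (1 - q%:C ^+ n.+1) * Y n].
Proof.
have [Y [HY Y0]] := Y_exists; exists Y; split; [|exact: Y0| |].
- by apply: rho_sumC_ext (HY 0%N) => m; rewrite /T rs_0 mul1r.
- apply: (rho_sumC_unique (fun m => a%:C * T 1%N m)).
    exact: (rho_sumCZ _ _ a%:C (HY 1%N)).
  (* Here a P_1 = a - lambda, so a P_1 / (z - lambda) = (a - z) / (z - lambda) + 1; the
     inhomogeneity 1 is the total mass of the measure. *)
  have h := rho_sumC_real _ _ (rho_sum_rs a q q_gt0 a_gt1 aq_lt1 0%N).
  apply: rho_sumC_ext (rho_sumCD _ _ _ _ (rho_sumCZ _ _ (a%:C - z) (HY 0%N)) h) => m.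
  have aV : (a^-1)%:C = (a%:C)^-1 by rewrite fmorphV.
  rewrite /T /= rs_0 rs_S !rs_0 !(rmorphD, rmorphM, rmorphB, rmorph1, mul1r) /= aV.
  have := zlam m; rewrite /k /lam !rmorphB !rmorph1 => zl.
  by field; rewrite zl a_neq0C.
- move=> n; apply: (rho_sumC_unique (fun m => a%:C * T n.+2 m)).
    exact: (rho_sumCZ _ _ a%:C (HY n.+2)).
  (* Exchanging 1 + lambda for 1 + z leaves q^(n+1) P_(n+1), whose integral vanishes. *)
  have h := rho_sumC_real _ _ (rho_sum_rs a q q_gt0 a_gt1 aq_lt1 n.+1).
  have := rho_sumCD _ _ _ _ (rho_sumCD _ _ _ _
    (rho_sumCZ _ _ (a%:C + 1 - w * q%:C ^+ n.+1) (HY n.+1))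
    (rho_sumCZ _ _ (- (1 - q%:C ^+ n.+1)) (HY n)))
    (rho_sumCZ _ _ (q%:C ^+ n.+1) h).
  rewrite mulr0 addr0 mulNr; apply: rho_sumC_ext => m.
  rewrite /T /= rs_three_term.
  have aV : (a^-1)%:C = (a%:C)^-1 by rewrite fmorphV.
  move: (rs q n.+1 _ _) (rs q n _ _) => x y.
  have := zlam m; rewrite /k /lam /w; move: (rho_w a q m) => W.
  rewrite !(rmorphN, rmorphD, rmorphM, rmorphB, rmorphXn, rmorph1) /= aV => zl.
  by field; rewrite zl a_neq0C.
Qed.
End cauchy.
End second_kind.

Section normc.
Context {R : realType}.
Implicit Types z : R[i].

Lemma Re_le_normcR z : `|complex.Re z| <= normc z.
Proof. by rewrite -lecR; exact: normc_ge_Re. Qed.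

Lemma Im_le_normcR z : `|complex.Im z| <= normc z.
Proof. by rewrite -lecR; exact: Im_le_normc. Qed.

Lemma normcR (x : R) : normc x%:C = `|x|.
Proof. by rewrite /normc/= expr0n/= addr0 sqrtr_sqr. Qed.

Lemma normc_ge0 z : 0 <= normc z.
Proof. by rewrite (le_trans _ (Re_le_normcR z)). Qed.

Lemma cvgC_series (r C : R) (u : nat -> R[i]) : 0 < r -> r < 1 ->
  (forall m, normc (u m) <= C * r ^+ m) ->
  exists l : R[i], (fun n => \sum_(0 <= m < n) u m) @ \oo --> l.
Proof.
move=> r0 r1 uC.
have cr : cvgn (series (fun m => complex.Re (u m))).
  apply: (is_cvg_series_geometric_le r r0 r1 _ C) => m.
  exact: le_trans (Re_le_normcR _) (uC m).
have ci : cvgn (series (fun m => complex.Im (u m))).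
  apply: (is_cvg_series_geometric_le r r0 r1 _ C) => m.
  exact: le_trans (Im_le_normcR _) (uC m).
exists (limn (series (fun m => complex.Re (u m))) +i*
        limn (series (fun m => complex.Im (u m)))).
have hr : (fun n => complex.Re (\sum_(0 <= m < n) u m)) =
    series (fun m => complex.Re (u m)) by apply/funext => n; rewrite Rec_sum.
have hi : (fun n => complex.Im (\sum_(0 <= m < n) u m)) =
    series (fun m => complex.Im (u m)) by apply/funext => n; rewrite Imc_sum.
by apply: (@cvgC _ _ \oo); rewrite ?hr ?hi.
Qed.
End normc.

(** * The Krein string and the asymptotics of its slopes *)

Section krein_string.
Context {R : realType}.
Variables a q : R.
Hypotheses (q_gt0 : 0 < q) (a_gt1 : 1 < a) (aq_lt1 : a * q < 1).

Let a_gt0 : 0 < a := lt_trans ltr01 a_gt1.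
Let a_neq0 : a != 0 := lt0r_neq0 a_gt0.
Let q_lt1 : q < 1 := q_lt1 a q q_gt0 a_gt1 aq_lt1.
Let q01 : 0 <= q < 1. Proof. by rewrite (ltW q_gt0) q_lt1. Qed.
Let a_neq0C : a%:C != 0.
Proof. by rewrite eq_complex/= negb_and a_neq0. Qed.

(* With f(x) = exp(-x/2) g(exp x), the spectral problem becomes a Krein string
   with masses [string_mass n] at [string_pos n]; on each interval between
   masses, g(s) = A s + B with the coefficients computed by [string_sol]. *)
Definition string_mass (n : nat) : R := qpoch q q n / a ^+ n.+1.
Definition string_pos (n : nat) : R := ch_sum a q n.+1.
Definition string_length (n : nat) : R := (a * q) ^+ n.+1 / qpoch q q n.+1.

Lemma string_pos0 : string_pos 0 = 1.
Proof. by rewrite /string_pos /ch_sum big_nat1 expr0 qpoch0 invr1 mulr1. Qed.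

Lemma string_posS n : string_pos n.+1 = string_pos n + string_length n.
Proof. by rewrite /string_pos /ch_sum big_nat_recr. Qed.

Lemma string_length_ge0 n : 0 <= string_length n.
Proof.
rewrite /string_length divr_ge0 ?exprn_ge0 ?mulr_ge0 ?(ltW a_gt0) ?(ltW q_gt0)//.
exact/ltW/(qpoch_gt0 q q_gt0 q_lt1).
Qed.

Lemma string_length_gt0 n : 0 < string_length n.
Proof.
by rewrite /string_length divr_gt0 ?exprn_gt0 ?mulr_gt0 ?(qpoch_gt0 q q_gt0 q_lt1).
Qed.

Lemma string_pos_ge1 n : 1 <= string_pos n.
Proof.
elim: n => [|n IH]; first by rewrite string_pos0.
by rewrite string_posS (le_trans IH)// lerDl string_length_ge0.
Qed.

Lemma string_pos_ltS n : string_pos n < string_pos n.+1.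
Proof. by rewrite string_posS ltrDl string_length_gt0. Qed.

Lemma string_pos_bounded : exists2 S : R, 0 <= S & forall n, string_pos n <= S.
Proof.
have [d d0 dq] := qpoch_lb q q_gt0 q_lt1 q q01.
have aq0 : 0 < a * q by rewrite mulr_gt0.
exists (d^-1 * (1 - a * q)^-1).
  by rewrite mulr_ge0 ?invr_ge0 ?(ltW d0)// subr_ge0 ltW.
move=> n; apply: le_trans (ler_wpM2l _ (geometric_sum_le (a * q) aq0 aq_lt1 n.+1)).
  rewrite /string_pos /ch_sum mulr_sumr; apply: ler_sum => i _.
  rewrite mulrC ler_wpM2r ?exprn_ge0 ?(ltW aq0)// lef_pV2 ?posrE//.
  exact: (lt_le_trans d0).
by rewrite invr_ge0 ltW.
Qed.

Lemma string_mass_gt0 n : 0 < string_mass n.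
Proof. by rewrite /string_mass divr_gt0 ?exprn_gt0 ?(qpoch_gt0 q q_gt0 q_lt1). Qed.

Lemma string_mass_le n : string_mass n <= a^-1 ^+ n.
Proof.
have q01' : 0 <= q <= 1 by rewrite (ltW q_gt0) ltW.
have /andP[h0 h1] := qpoch_le1 q q_gt0 q_lt1 q n q01'.
rewrite /string_mass exprVn exprS invfM mulrA ler_piMl ?invr_ge0 ?exprn_ge0 ?(ltW a_gt0)//.
by rewrite mulr_ile1 ?invr_ge0 ?(ltW a_gt0)// invf_le1// ltW.
Qed.

Let aV0 : 0 < a^-1. Proof. by rewrite invr_gt0. Qed.
Let aV1 : a^-1 < 1. Proof. by rewrite invf_lt1. Qed.

Lemma is_cvg_string_mass : cvgn (series string_mass).
Proof.
apply: (is_cvg_series_geometric_le a^-1 aV0 aV1 _ 1) => m.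
by rewrite mul1r ger0_norm ?string_mass_le// ltW// string_mass_gt0.
Qed.

Section solution.
Variables (z alpha beta : R[i]).

(** The n-th pair describes g just to the left of the n-th mass. Crossing the mass lowers the slope
    by z m g, and the intercept changes so that g stays continuous. *)
Fixpoint string_sol n : R[i] * R[i] :=
  if n is n'.+1 then
    let: (A, B) := string_sol n' in
    let S := (string_pos n')%:C in
    let m := (string_mass n')%:C in
    (A - z * m * (A * S + B), B + z * m * S * (A * S + B))
  else (alpha, beta).

Definition string_A n := (string_sol n).1.
Definition string_B n := (string_sol n).2.
Definition string_g n := string_A n * (string_pos n)%:C + string_B n.

Lemma string_AS n : string_A n.+1 = string_A n - z * (string_mass n)%:C * string_g n.
Proof. by rewrite /string_g /string_A /string_B [string_sol n.+1]/=; case: (string_sol n). Qed.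

Lemma string_BS n : string_B n.+1 = string_B n +
  z * (string_mass n)%:C * (string_pos n)%:C * string_g n.
Proof. by rewrite /string_g /string_A /string_B [string_sol n.+1]/=; case: (string_sol n). Qed.

Lemma string_gS n : string_g n.+1 = string_g n + (string_length n)%:C * string_A n.+1.
Proof.
rewrite [LHS]/string_g string_BS string_posS rmorphD/= string_AS /string_g; ring.
Qed.

Lemma string_A_sum n : string_A n =
  alpha - \sum_(0 <= k < n) z * (string_mass k)%:C * string_g k.
Proof.
elim: n => [|n IH]; first by rewrite big_geq// subr0.
by rewrite string_AS IH big_nat_recr//= opprD addrA.
Qed.

Lemma string_B_sum n : string_B n =
  beta + \sum_(0 <= k < n) z * (string_mass k)%:C * (string_pos k)%:C * string_g k.
Proof.
elim: n => [|n IH]; first by rewrite big_geq// addr0.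
by rewrite string_BS IH big_nat_recr//= addrA.
Qed.

(** A discrete Gronwall estimate: each step multiplies the size by at most 1 + K a^-n, and the
    product of these factors is bounded because a > 1. *)
Lemma string_sol_bounded : exists2 C : R, 0 <= C &
  forall n, normc (string_A n) + normc (string_B n) <= C.
Proof.
have [S S0 HS] := string_pos_bounded.
(* One factor 1 + S bounds g by the coefficients; the other collects the two jumps, of relative
   sizes 1 and S. *)
pose K := normc z * (1 + S) ^+ 2.
have K0 : 0 <= K by rewrite mulr_ge0 ?normc_ge0// sqr_ge0.
pose T n := normc (string_A n) + normc (string_B n).
have T0 n : 0 <= T n by rewrite addr_ge0 ?normc_ge0.
exists (T 0%N * expR (K * (1 - a^-1)^-1)); first by rewrite mulr_ge0 ?expR_ge0.
suff H n : T n <= T 0%N * expR (K * \sum_(0 <= k < n) a^-1 ^+ k).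
  move=> n; apply: le_trans (H n) _; rewrite ler_wpM2l// ler_expR ler_wpM2l//.
  exact: geometric_sum_le.
elim: n => [|n IH]; first by rewrite big_geq// mulr0 expR0 mulr1.
rewrite big_nat_recr//= mulrDr expRD mulrA.
apply: (@le_trans _ _ (T n * (1 + K * a^-1 ^+ n))); last first.
  apply: ler_pM; [exact: T0| |exact: IH|exact: expR_ge1Dx].
  by rewrite addr_ge0// mulr_ge0 ?exprn_ge0 ?(ltW aV0).
have m0 := ltW (string_mass_gt0 n); have S1 := string_pos_ge1 n.
have Sn0 : 0 <= string_pos n := le_trans ler01 S1.
have ng : normc (string_g n) <= T n * (1 + S).
  rewrite /string_g (le_trans (le_normcD _ _))// normcM normcR ger0_norm// /T.
  rewrite mulrDr mulr1 addrC lerD//; first by rewrite lerDr normc_ge0.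
  by rewrite ler_pM ?normc_ge0// lerDl normc_ge0.
have n0 := normc_ge0 (string_g n).
have nA : normc (string_A n.+1) <= normc (string_A n) +
    normc z * string_mass n * normc (string_g n).
  rewrite string_AS (le_trans (le_normcD _ _))// normcN !normcM normcR.
  by rewrite (ger0_norm m0).
have nB : normc (string_B n.+1) <= normc (string_B n) +
    normc z * string_mass n * S * normc (string_g n).
  rewrite string_BS (le_trans (le_normcD _ _))// !normcM !normcR.
  rewrite (ger0_norm m0) (ger0_norm Sn0) lerD2l ler_wpM2r// ler_wpM2l//.
  by rewrite mulr_ge0 ?normc_ge0.
apply: le_trans (lerD nA nB) _.
have -> : normc (string_A n) + normc z * string_mass n * normc (string_g n) +
   (normc (string_B n) + normc z * string_mass n * S * normc (string_g n)) =
   T n + normc z * string_mass n * (1 + S) * normc (string_g n) by rewrite /T; ring.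
have -> : T n * (1 + K * a^-1 ^+ n) = T n + normc z * a^-1 ^+ n * (1 + S) * (T n * (1 + S)).
  by rewrite /K; ring.
have S10 : 0 <= 1 + S by rewrite addr_ge0.
rewrite lerD2l; apply: ler_pM => //.
  by apply: mulr_ge0 => //; apply: mulr_ge0 => //; exact: normc_ge0.
by rewrite ler_wpM2r// ler_wpM2l ?normc_ge0// string_mass_le.
Qed.

Lemma string_g_bounded : exists2 C : R, 0 <= C & forall n, normc (string_g n) <= C.
Proof.
have [C C0 HC] := string_sol_bounded; have [S S0 HS] := string_pos_bounded.
exists (C * S + C); first by rewrite addr_ge0 ?mulr_ge0.
move=> n; rewrite /string_g (le_trans (le_normcD _ _))// normcM normcR.
have Sn0 : 0 <= string_pos n := le_trans ler01 (string_pos_ge1 n).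
rewrite (ger0_norm Sn0); have [hA hB] := (normc_ge0 (string_A n), normc_ge0 (string_B n)).
rewrite lerD ?ler_pM//; apply: le_trans (HC n); [by rewrite lerDl|by rewrite lerDr].
Qed.

Lemma string_A_cvg : exists l : R[i], string_A @ \oo --> l.
Proof.
have [C C0 HC] := string_g_bounded.
have [|l Hl] := cvgC_series a^-1 (normc z * C)
  (fun k => z * (string_mass k)%:C * string_g k) aV0 aV1.
  move=> m; have m0 := ltW (string_mass_gt0 m).
  rewrite !normcM normcR (ger0_norm m0).
  have -> : normc z * C * a^-1 ^+ m = normc z * a^-1 ^+ m * C by ring.
  apply: ler_pM => //; first by apply: mulr_ge0 => //; exact: normc_ge0.
    exact: normc_ge0.
  by rewrite ler_wpM2l ?normc_ge0// string_mass_le.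
exists (alpha - l).
rewrite (_ : string_A = fun n => alpha - \sum_(0 <= k < n) z * (string_mass k)%:C * string_g k).
  exact: (@cvgC_B _ _ \oo _ (fun=> alpha) _ alpha l (@cvgC_cst _ _ \oo _ alpha) Hl).
by apply/funext => n; exact: string_A_sum.
Qed.

(** Eliminating g from the string recursion gives the three-term recursion, because m_(n+1) / m_n =
    (1 - q^(n+1)) / a and m_(n+1) l_n = q^(n+1) / a, with l_n the n-th gap. The induction also
    carries the slope jumps. *)
Lemma string_A_unique (X : nat -> R[i]) : X 0%N = alpha ->
  X 0%N - X 1%N = z * (string_mass 0)%:C * string_g 0 ->
  (forall n, a%:C * X n.+2 = (a%:C + 1 - (1 + z) * q%:C ^+ n.+1) * X n.+1 -
                             (1 - q%:C ^+ n.+1) * X n) ->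
  string_A =1 X.
Proof.
move=> X0 X1 XS.
suff H n : string_A n = X n /\ z * (string_mass n)%:C * string_g n = X n - X n.+1.
  by move=> n; have [] := H n.
elim: n => [|n [IA Ig]]; first by rewrite X1 X0.
have AS : string_A n.+1 = X n.+1 by rewrite string_AS IA Ig; ring.
split=> //; rewrite string_gS AS.
have mS : (string_mass n.+1)%:C = (string_mass n)%:C * (1 - q%:C ^+ n.+1) / a%:C.
  have -> : 1 - q%:C ^+ n.+1 = (1 - q ^+ n.+1)%:C by rewrite rmorphB rmorph1 rmorphXn.
  rewrite -fmorphV -!rmorphM/=.
  congr (_%:C); rewrite /string_mass qpochS !exprS.
  by field; rewrite a_neq0 expf_neq0.
have mL : (string_mass n.+1)%:C * (string_length n)%:C = q%:C ^+ n.+1 / a%:C.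
  rewrite -rmorphXn -fmorphV -!rmorphM/=; congr (_%:C).
  rewrite /string_mass /string_length exprMn [a ^+ n.+2]exprS.
  have := qpoch_qq_neq0 q q_gt0 q_lt1 n.+1 => h.
  by field; rewrite h a_neq0 expf_neq0.
have -> : z * (string_mass n.+1)%:C * (string_g n + (string_length n)%:C * X n.+1) =
   (z * (string_mass n)%:C * string_g n) * (1 - q%:C ^+ n.+1) / a%:C +
   z * ((string_mass n.+1)%:C * (string_length n)%:C) * X n.+1.
  by rewrite mulrDr {1}mS; ring.
rewrite mL Ig; apply: (mulfI a_neq0C).
rewrite [RHS]mulrBr XS; field; exact: a_neq0C.
Qed.

End solution.
End krein_string.

(** * The Weyl-Titchmarsh value as an integral against the spectral measure *)

Section weyl_value.
Context {R : realType}.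
Variables a q : R.
Hypotheses (q_gt0 : 0 < q) (a_gt1 : 1 < a) (aq_lt1 : a * q < 1).

Let a_gt0 : 0 < a := lt_trans ltr01 a_gt1.
Let a_neq0 : a != 0 := lt0r_neq0 a_gt0.
Let q_lt1 : q < 1 := q_lt1 a q q_gt0 a_gt1 aq_lt1.
Let a_neq0C : a%:C != 0.
Proof. by rewrite eq_complex/= negb_and a_neq0. Qed.

Definition rho_pole (m : nat) : R := rho_w a q m - 1.

Lemma rho_pole_ge m : a - 1 <= rho_pole m.
Proof.
rewrite lerD2r /rho_w ler_peMr ?(ltW a_gt0)// invf_ge1 ?exprn_gt0//.
exact: (expq_le1 q q_gt0 q_lt1).
Qed.

Lemma rho_pole_gt0 m : 0 < rho_pole m.
Proof. by rewrite (lt_le_trans _ (rho_pole_ge m))// subr_gt0. Qed.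

Definition string_total : R := limn (series (string_mass a q)).

(** The integral of 1 / lambda is the total mass of the string. It is [- Y 0] at z = 0, a point
    allowed because all atoms are at least a - 1. *)
Lemma rho_sum_inv_pole :
  rho_sumC a q (fun m => (0 - (rho_pole m)%:C)^-1) (- string_total%:C).
Proof.
have a1 : 0 < a - 1 by rewrite subr_gt0.
have kE m : (0 - (rho_pole m)%:C)^-1 = (- (rho_pole m)^-1)%:C.
  by rewrite sub0r rmorphN fmorphV invrN.
have D0 : 0 <= (a - 1)^-1 by rewrite invr_ge0 ltW.
have [||Y [H0 Yoo Y1 YS]] := second_kind_exists a q q_gt0 a_gt1 aq_lt1 0 _ D0.
- by move=> m; rewrite sub0r oppr_eq0 eq_complex/= negb_and gt_eqF// rho_pole_gt0.
- move=> m; rewrite kE/= normr0 normrN; split=> //.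
  rewrite ger0_norm ?invr_ge0 ?(ltW (rho_pole_gt0 m))//.
  by rewrite lef_pV2 ?posrE ?rho_pole_gt0// rho_pole_ge.
(* At z = 0 the recursion is first order in the differences and has the same ratio (1 - q^(n+1)) / a
   as the masses. Since [Y n] tends to 0, summing gives [Y 0]. *)
have d n : Y n.+1 - Y n = (string_mass a q n)%:C.
  apply: (mulfI a_neq0C); elim: n => [|n IH].
    rewrite [LHS]mulrBr Y1 /string_mass qpoch0 mul1r expr1 fmorphV mulfV//.
    by rewrite subr0; ring.
  have -> : a%:C * (string_mass a q n.+1)%:C =
      (1 - q%:C ^+ n.+1) * (string_mass a q n)%:C.
    have -> : 1 - q%:C ^+ n.+1 = (1 - q ^+ n.+1)%:C by rewrite rmorphB rmorph1 rmorphXn.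
    rewrite -!rmorphM/=; congr (_ %:C); rewrite /string_mass qpochS !exprS.
    by field; rewrite a_neq0 expf_neq0.
  rewrite -(mulfI a_neq0C IH) [LHS]mulrBr YS; ring.
have Ys n : Y n = Y 0%N + (series (string_mass a q) n)%:C.
  elim: n => [|n IH]; first by rewrite /series/= big_geq// addr0.
  rewrite /series/= big_nat_recr//= rmorphD addrA.
  by move: IH; rewrite /series/= => <-; rewrite -d addrC subrK.
have cvC : (fun n => (series (string_mass a q) n)%:C) @ \oo --> string_total%:C.
  apply: (@cvgC _ _ \oo) => /=; last exact: cvg_cst.
  exact: is_cvg_string_mass.
have : (fun n => Y 0%N + (series (string_mass a q) n)%:C) @ \oo -->
    Y 0%N + string_total%:C.
  exact: (@cvgC_D _ _ \oo _ (fun=> Y 0%N) _ _ _ (@cvgC_cst _ _ \oo _ (Y 0%N)) cvC).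
rewrite -(_ : Y = fun n => Y 0%N + _); last by apply/funext => n; exact: Ys.
move=> /(cvgC_unique _ _ _ Yoo)/esym/eqP; rewrite addr_eq0 => /eqP <-.
exact: H0.
Qed.

Section nonreal.
Variable z : R[i].
Hypothesis z_im : complex.Im z != 0.

(* The imaginary part of A times the conjugate of g moves monotonically away
   from 0, so A cannot tend to 0 while g stays bounded. *)
Lemma string_A_lim_neq0 (l : R[i]) : string_A a q z 1 0 @ \oo --> l -> l != 0.
Proof.
move=> Al; apply/eqP => l0.
pose A := string_A a q z 1 0; pose g := string_g a q z 1 0.
pose h n := complex.Im (A n * (g n)^*).
have g0 : g 0%N = 1.
  by rewrite /g /string_g /string_A /string_B/= string_pos0// mulr1 addr0.
have hS n : h n.+1 = h n - complex.Im z * string_mass a q n * normc (g n) ^+ 2.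
  have gS : g n.+1 = g n + (string_length a q n)%:C * A n.+1 by exact: string_gS.
  rewrite /h gS rmorphD rmorphM mulrDr ImcD.
  (* The stretch between two masses contributes a real multiple of |A|^2, so only the masses change
     [h]. *)
  have -> : complex.Im (A n.+1 * ((string_length a q n)%:C^* * (A n.+1)^*)) = 0.
    rewrite ImcM ImcM RecM /=; case: (A n.+1) => x y /=; ring.
  have AS : A n.+1 = A n - z * (string_mass a q n)%:C * g n by exact: string_AS.
  rewrite addr0 AS.
  case: z (g n) (A n) => [zr zi] [x y] [x' y'].
  rewrite /normc sqr_sqrtr ?addr_ge0 ?sqr_ge0//.
  rewrite !(ImcM, RecM, ImcD, RecD, RecN, ImcN) /=; ring.
have hz n : complex.Im z * h n.+1 <= - (complex.Im z ^+ 2 * string_mass a q 0).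
  elim: n => [|n IH].
    rewrite hS g0 normc1 /h g0 /A /string_A/= !(oppr0, mulr0, mul0r, addr0) sub0r.
    by rewrite expr1n mulr1 mulrN mulrA.
  apply: le_trans IH; rewrite hS -subr_ge0.
  set m := string_mass _ _ _.
  have -> : complex.Im z * h n.+1 - complex.Im z *
      (h n.+1 - complex.Im z * m * normc (g n.+1) ^+ 2) =
      complex.Im z ^+ 2 * (m * normc (g n.+1) ^+ 2) by ring.
  apply: mulr_ge0; first exact: sqr_ge0.
  by apply: mulr_ge0; [exact/ltW/string_mass_gt0|exact: sqr_ge0].
have [C C0 HC] := string_g_bounded a q q_gt0 a_gt1 aq_lt1 z 1 0.
pose e := `|complex.Im z| * string_mass a q 0.
have m0 := string_mass_gt0 a q q_gt0 a_gt1 aq_lt1 0.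
have e0 : 0 < e by rewrite mulr_gt0// normr_gt0.
have he n : e <= `|h n.+1|.
  rewrite /e -(ler_pM2l (x := `|complex.Im z|)) ?normr_gt0//.
  have -> : `|complex.Im z| * (`|complex.Im z| * string_mass a q 0) =
      complex.Im z ^+ 2 * string_mass a q 0.
    by rewrite -[in RHS]real_normK ?num_real//; ring.
  rewrite -normrM -normrN; apply: le_trans (ler_norm _).
  by rewrite lerNr; exact: hz.
have hle n : `|h n| <= normc (A n) * C.
  rewrite (le_trans (Im_le_normcR _))// normcM ler_wpM2l ?normc_ge0//.
  have -> : normc (g n)^* = normc (g n) by case: (g n) => x y /=; rewrite sqrrN.
  exact: HC.
have : normc (A n) @[n --> \oo] --> (0 : R).
  have hr : complex.Re (A n) @[n --> \oo] --> complex.Re l.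
    exact: (@cvgC_Re _ _ \oo _ A l Al).
  have hi : complex.Im (A n) @[n --> \oo] --> complex.Im l.
    exact: (@cvgC_Im _ _ \oo _ A l Al).
  rewrite l0/= in hr hi.
  apply: (@squeeze_cvgr nat \oo _ R (fun=> 0)
    (fun n => `|complex.Re (A n)| + `|complex.Im (A n)|)).
  - near=> n; rewrite normc_ge0/= -lecR; exact: normc_le_ReIm.
  - exact: cvg_cst.
  - rewrite -[X in _ --> X](addr0 0); apply: cvgD.
      by apply/norm_cvg0P.
    by apply/norm_cvg0P.
(* The bound C may be 0, hence C + 1. *)
have eC : 0 < e / (C + 1) by rewrite divr_gt0// ltr_wpDl.
move=> /cvgrPdist_lt/(_ _ eC)[N _ HN].
have := HN N.+1 (leqnSn N); rewrite sub0r normrN ger0_norm ?normc_ge0//.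
rewrite ltr_pdivlMr ?ltr_wpDl// => h1.
have := le_trans (he N) (hle N.+1).
rewrite leNgt => /negP; apply; apply: le_lt_trans h1.
by rewrite ler_wpM2l ?normc_ge0// lerDl.
Unshelve. all: by end_near. Qed.

(** The data (1, 0) give g(s) = s, that is e^(x/2) to the left of the knots, hence phi; (z total, 1)
    are the data of theta. *)
Lemma string_weyl : exists lphi ltheta : R[i],
  [/\ string_A a q z 1 0 @ \oo --> lphi,
      string_A a q z (z * string_total%:C) 1 @ \oo --> ltheta, lphi != 0 &
      rho_sumC a q (fun m => z / ((rho_pole m)%:C * ((rho_pole m)%:C - z)))
        (- (ltheta / (z * lphi)))].
Proof.
have z0 : z != 0 by apply/eqP => zE; move: z_im; rewrite zE eqxx.
have zl m : z - (rho_pole m)%:C != 0.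
  by rewrite eq_complex/= negb_and ImcD ImcN/= subr0 z_im orbT.
have D0 : 0 <= `|complex.Im z|^-1 by rewrite invr_ge0.
have kD m : normc ((z - (rho_pole m)%:C)^-1) <= `|complex.Im z|^-1.
  have ge : `|complex.Im z| <= normc (z - (rho_pole m)%:C).
    by have := Im_le_normcR (z - (rho_pole m)%:C); rewrite ImcD ImcN/= subr0.
  rewrite normcV lef_pV2// posrE ?normr_gt0// (lt_le_trans _ ge)//.
  by rewrite normr_gt0.
have [|Y [H0 Yoo Y1 YS]] :=
    second_kind_exists a q q_gt0 a_gt1 aq_lt1 z _ D0 zl.
  move=> m; split.
    exact: le_trans (Re_le_normcR _) (kD m).
  exact: le_trans (Im_le_normcR _) (kD m).
have [lphi Hphi] := string_A_cvg a q q_gt0 a_gt1 aq_lt1 z 1 0.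
have lphi0 := string_A_lim_neq0 _ Hphi.
pose P n := rs q%:C n (1 + z) a%:C^-1.
have PS n : a%:C * P n.+2 = (a%:C + 1 - (1 + z) * q%:C ^+ n.+1) * P n.+1 -
                             (1 - q%:C ^+ n.+1) * P n.
  by rewrite /P rs_three_term; field; exact: a_neq0C.
have P0 : P 0%N = 1 by rewrite /P rs_0.
have P1 : P 1%N = 1 - z / a%:C by rewrite /P rs_S !rs_0; ring.
have m0 : (string_mass a q 0)%:C = a%:C^-1.
  by rewrite /string_mass qpoch0 mul1r expr1 fmorphV.
have AP : string_A a q z 1 0 =1 P.
  apply: string_A_unique => //; rewrite P0 P1 m0.
  by rewrite /string_g /string_A /string_B/= string_pos0//; ring.
set M := string_total%:C.
(* The coefficient of P makes X_0 = z M. The inhomogeneous first step of Y accounts for the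
   intercept 1 of theta, and Y drops out in the limit. *)
pose X n := z * (M + Y 0%N) * P n - z * Y n.
have AX : string_A a q z (z * M) 1 =1 X.
  have Y1' : Y 1%N = ((a%:C - z) * Y 0%N + 1) / a%:C.
    by rewrite -Y1 mulrAC mulfV// mul1r.
  apply: string_A_unique => //.
  - by rewrite /X P0; ring.
  - rewrite /X P0 P1 m0 Y1' /string_g /string_A /string_B/= string_pos0//.
    by field; exact: a_neq0C.
  - move=> n; rewrite /X mulrBr mulrCA PS [X in _ - X]mulrCA YS; ring.
have Poo : P @ \oo --> lphi by rewrite -(_ : string_A a q z 1 0 = P)//; exact/funext.
exists lphi, (z * (M + Y 0%N) * lphi); split; [exact: Hphi| |exact: lphi0|].
  rewrite (_ : string_A a q z (z * M) 1 = X); last exact/funext.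
  have := @cvgC_B _ _ \oo _ _ _ _ _ (@cvgC_Mr _ _ \oo _ _ _ Poo (z * (M + Y 0%N)))
     (@cvgC_Mr _ _ \oo _ _ _ Yoo z).
  rewrite mulr0 subr0; apply.
(* The two terms are the integrals of -1 / lambda and of 1 / (lambda - z), which add up to the
   required kernel. *)
have -> : - (z * (M + Y 0%N) * lphi / (z * lphi)) = - M + (-1) * Y 0%N.
  by field; rewrite z0 lphi0.
apply: rho_sumC_ext (rho_sumCD _ _ _ _ _ _ rho_sum_inv_pole (rho_sumCZ _ _ _ _ (-1) H0)).
move=> m /=; have pz : (rho_pole m)%:C - z != 0 by rewrite -opprB oppr_eq0.
have p0 : (rho_pole m)%:C != 0.
  by rewrite eq_complex/= negb_and gt_eqF// rho_pole_gt0.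
have := zl m; move: pz p0; move: (rho_pole m)%:C => p pz p0 zm.
have np : 0 - p != 0 by rewrite sub0r oppr_eq0.
by field; rewrite pz p0 zm.
Qed.
End nonreal.
End weyl_value.

Set Implicit Arguments.
Unset Strict Implicit.
Unset Printing Implicit Defensive.

(** * Calculus of absolutely continuous functions *)

Section primitives.
Context {R : realType}.
Implicit Types (f g h k : R -> R) (x y : R).
Local Notation leb := (@lebesgue_measure R).

Definition itv_integrable g := forall x y, leb.-integrable `[x, y] (EFin \o g).

Definition is_primitive f g :=
  forall x y, x <= y -> f y - f x = \int[leb]_(t in `[x, y]) g t.

Lemma integrable_bdM (D : set R) f g (C : R) : measurable D ->
  measurable_fun D f -> (forall x, D x -> `|f x| <= C) ->
  leb.-integrable D (EFin \o g) -> leb.-integrable D (EFin \o (fun x => f x * g x)).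
Proof.
move=> mD mf fC ig.
have iC : leb.-integrable D (EFin \o (fun x => C * g x)).
  have -> : EFin \o (fun x => C * g x) = (fun x => C%:E * (EFin \o g) x)%E.
    by apply/funext => x /=; rewrite EFinM.
  exact: integrableZl.
apply: le_integrable iC => //.
  apply/measurable_EFinP; apply: measurable_funM => //.
  by case/integrableP: ig => /measurable_EFinP.
move=> x Dx /=; rewrite lee_fin !normrM ler_wpM2r//.
by rewrite (le_trans (fC _ Dx))// ler_norm.
Qed.

Lemma integrable_normr (D : set R) g : measurable D ->
  leb.-integrable D (EFin \o g) -> leb.-integrable D (EFin \o (fun x => `|g x|)).
Proof.
by move=> mD ig; have := integrable_abse ig; apply: eq_integrable.
Qed.

Lemma compact_itv (K : set R) : compact K -> exists2 M : R, 0 < M & K `<=` `[- M, M].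
Proof.
move=> /compact_bounded[M [Mr HM]].
exists (`|M| + 1); first by rewrite ltr_wpDl.
move=> x Kx; have := HM (`|M| + 1) _ x Kx.
rewrite /= in_itv/= -ler_norml; apply.
by rewrite (le_lt_trans (ler_norm M))// ltrDl.
Qed.

Lemma itv_integrable_locally g : measurable_fun setT g ->
  itv_integrable g <-> locally_integrable setT g.
Proof.
move=> mg; split=> [ig|[_ _ ig] x y].
  split=> //; first exact: openT.
  move=> K _ cK; have [M M0 KM] := compact_itv cK.
  have /integrableP[_] := ig (- M) M; apply: le_lt_trans.
  apply: ge0_subset_integral => //; first exact: compact_measurable.
  by apply/measurable_EFinP; apply: measurableT_comp => //; exact: measurable_funTS.
apply/integrableP; split.
  by apply/measurable_EFinP; exact: measurable_funTS.
exact: (ig _ (@subsetT _ _) (@segment_compact _ x y)).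
Qed.

Lemma sqr_itv_integrable g : measurable_fun setT g ->
  locally_integrable setT (fun x => g x ^+ 2) -> itv_integrable g.
Proof.
move=> mg ig2 x y.
have mg2 : measurable_fun setT (fun x => g x ^+ 2) by exact: measurable_funX.
have i2 := (itv_integrable_locally mg2).2 ig2 x y.
have i1 : leb.-integrable `[x, y] (EFin \o (fun=> 1 : R)).
  apply/integrableP; split; first exact/measurable_EFinP.
  under eq_integral do rewrite /= normr1.
  rewrite integral_cst//= mul1e lebesgue_measure_itv/=.
  by case: ifP => _; rewrite ?ltry// -EFinD ltry.
have i12 : leb.-integrable `[x, y]
    ((EFin \o (fun=> 1%R : R)) \+ (EFin \o (fun x => g x ^+ 2)%R))%E.
  exact: integrableD.
apply: le_integrable i12 => //.
  by apply/measurable_EFinP; exact: measurable_funTS.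
move=> t _ /=; rewrite lee_fin.
rewrite [leRHS]ger0_norm ?addr_ge0 ?sqr_ge0//.
have := sqr_ge0 (`|g t| - 2^-1); rewrite sqrrB real_normK ?num_real//.
have := normr_ge0 (g t); nra.
Qed.

Lemma weak_derivativeP f g : is_weak_derivative f g ->
  [/\ measurable_fun setT g, itv_integrable g & is_primitive f g].
Proof. by move=> [mg ig fg]; split=> //; exact: sqr_itv_integrable. Qed.

End primitives.

Section primitives2.
Context {R : realType}.
Implicit Types (f g h k : R -> R) (x y : R).
Local Notation leb := (@lebesgue_measure R).

Lemma ae_imp (P Q : R -> Prop) : (forall x, P x -> Q x) ->
  {ae leb, forall x, P x} -> {ae leb, forall x, Q x}.
Proof. by move=> PQ; apply: filterS; first exact: (ae_filter_ringOfSetsType leb). Qed.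

Lemma primitive_continuous f g : itv_integrable g -> is_primitive f g -> continuous f.
Proof.
move=> ig fg x.
pose F t := \int[leb]_(s in `[x - 1, t]) g s.
have xx : x - 1 < x + 1 by rewrite ltrD2l; lra.
have /(continuous_within_itvP _ xx)[cF _ _] :
    {within `[x - 1, x + 1], continuous F}.
  exact: (parameterized_integral_continuous (ltW xx) (ig _ _)).
have xin : x \in `]x - 1, x + 1[ by rewrite in_itv/= ltrDl ltrBlDr ltrDl ltr01.
have cFx : (fun t => f (x - 1) + F t) t @[t --> x] --> f (x - 1) + F x.
  by apply: cvgD; [exact: cvg_cst|exact: cF].
have fE t : x - 1 <= t -> f t = f (x - 1) + F t.
  by move=> xt; rewrite /F -fg// addrC subrK.
rewrite -fE ?gerBl// in cFx; apply: cvg_trans cFx; apply: near_eq_cvg.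
have : \forall t \near x, x - 1 < t.
  by apply: (@open_nbhs_nbhs _ x); split; [exact: open_gt|rewrite /= ltrBlDr ltrDl].
by apply: filterS => t /ltW/fE.
Qed.

(** By Lebesgue differentiation both candidates are a.e. the derivative of the same function. The
    differentiation theorem starts from a fixed endpoint, so it is applied from each -n. *)
Lemma primitive_unique f g1 g2 : measurable_fun setT g1 -> measurable_fun setT g2 ->
  itv_integrable g1 -> itv_integrable g2 -> is_primitive f g1 -> is_primitive f g2 ->
  {ae leb, forall x, g1 x = g2 x}.
Proof.
move=> m1 m2 i1 i2 f1 f2.
have H (n : nat) : {ae leb, forall x, - (n%:R : R) < x -> g1 x = g2 x}.
  have E : (fun y => \int[leb]_(t in [set` Interval (BLeft (- n%:R)) (BRight y)]) g1 t) =
           (fun y => \int[leb]_(t in [set` Interval (BLeft (- n%:R)) (BRight y)]) g2 t).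
    apply/funext => y; have [xy|yx] := leP (- n%:R) y.
      by rewrite -f1// -f2.
    by rewrite set_itv_ge ?bnd_simp -?ltNge// !Rintegral_set0.
  have h1 := @FTC1 R g1 (BLeft (- n%:R)) (fun y => i1 _ y)
    ((itv_integrable_locally m1).1 i1).
  have h2 := @FTC1 R g2 (BLeft (- n%:R)) (fun y => i2 _ y)
    ((itv_integrable_locally m2).1 i2).
  rewrite /= -E in h2.
  apply: filterS2 h1 h2; first exact: (ae_filter_ringOfSetsType leb).
  move=> x h1 h2 nx; rewrite -lte_fin in nx.
  by rewrite -(h1 nx).2 -(h2 nx).2.
have := ae_foralln H; apply: ae_imp => x Hx.
by apply: (Hx (Num.truncn `|x|).+1); rewrite ltrNl (le_lt_trans (ler_norm _))// normrN real_truncnS_gt ?num_real.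
Qed.

(** Integration by parts for integrable derivatives, without continuity: both sides are the integral
    of g(t) k(s) over the triangle x <= s <= t <= y. *)
Lemma primitive_fubini f g h k x y : measurable_fun setT g -> measurable_fun setT k ->
  itv_integrable g -> itv_integrable k ->
  is_primitive f g -> is_primitive h k -> x <= y ->
  \int[leb]_(t in `[x, y]) (g t * (h t - h x)) =
  \int[leb]_(s in `[x, y]) (k s * (f y - f s)).
Proof.
move=> mg mk ig ik fg hk xy.
pose I : set R := `[x, y]%classic.
have mI : measurable (I : set (measurableTypeR R)) by exact: measurable_itv.
pose gI := g \_ I; pose kI := k \_ I.
have mgI : measurable_fun setT gI.
  by apply/(measurable_restrictT _ _).1 => //; exact: measurable_funTS.
have mkI : measurable_fun setT kI.
  by apply/(measurable_restrictT _ _).1 => //; exact: measurable_funTS.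
have igI : leb.-integrable setT (EFin \o gI).
  by rewrite -restrict_EFin; apply/(integrable_mkcond _ _).1 => //; exact: ig.
have ikI : leb.-integrable setT (EFin \o kI).
  by rewrite -restrict_EFin; apply/(integrable_mkcond _ _).1 => //; exact: ik.
pose phi (p : measurableTypeR R * measurableTypeR R) : R :=
  gI p.1 * (kI p.2 * ((p.2 : R) <= (p.1 : R))%R%:R).
have mphi : measurable_fun setT (EFin \o phi).
  apply/measurable_EFinP; apply: measurable_funM.
    by apply: measurableT_comp => //; exact: measurable_fst.
  apply: measurable_funM.
    by apply: measurableT_comp => //; exact: measurable_snd.
  have mle : measurable_fun setT
      (fun p : measurableTypeR R * measurableTypeR R => ((p.2 : R) <= (p.1 : R))%R).
    by apply: measurable_fun_ler; [exact: measurable_snd|exact: measurable_fst].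
  have -> : (fun p : measurableTypeR R * measurableTypeR R => ((p.2 : R) <= (p.1 : R))%R%:R : R) =
      (fun p => if ((p.2 : R) <= (p.1 : R))%R then 1 else 0).
    by apply/funext => p; case: ((p.2 : R) <= (p.1 : R))%R.
  by apply: measurable_fun_if => //; exact: measurable_cst.
(* The iterated integral of |phi| is at most the product of the two L^1 norms. *)
have iphi : (leb \x leb)%E.-integrable setT (EFin \o phi).
  apply/integrable12ltyP => //.
  have CkI : (\int[leb]_s `|(EFin \o kI) s| < +oo)%E by case/integrableP: ikI.
  set C : \bar R := (\int[leb]_s `|(EFin \o kI) s|)%E in CkI.
  have C0 : (0 <= C)%E by apply: integral_ge0.
  have Cfin : C \is a fin_num by rewrite ge0_fin_numE.
  apply: (@le_lt_trans _ _ (\int[leb]_t (`|(EFin \o gI) t| * C))%E).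
    apply: ge0_le_integral => //.
    - by move=> t _; exact: integral_ge0.
    - apply: (@measurable_fun_fubini_tonelli_F _ _ _ _ _ leb (abse \o (EFin \o phi))).
        exact: measurableT_comp.
      by move=> p; exact: abse_ge0.
    - apply: emeasurable_funM; last exact: measurable_cst.
      by apply: measurableT_comp => //; exact/measurable_EFinP.
    - move=> t _; rewrite -ge0_integralZl//.
      + apply: ge0_le_integral => //.
        * apply: measurableT_comp => //; exact: measurable_fun_pair2.
        * apply: emeasurable_funM; first exact: measurable_cst.
          by apply: measurableT_comp => //; exact/measurable_EFinP.
        * move=> s _ /=; rewrite lee_fin !normrM ler_wpM2l// ler_piMr//.
          by case: (s <= t)%R; rewrite ?normr1 ?normr0.
      + by apply: measurableT_comp => //; exact/measurable_EFinP.
  rewrite ge0_integralZr//.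
    have BgI : (\int[leb]_t `|(EFin \o gI) t| \is a fin_num)%E.
      rewrite ge0_fin_numE; first by case/integrableP: igI.
      exact: integral_ge0.
    by rewrite -(fineK BgI) -(fineK Cfin) -EFinM ltry.
  by apply: measurableT_comp => //; exact/measurable_EFinP.
have := Fubini iphi.
have -> : (\int[leb]_x0 \int[leb]_y0 (EFin \o phi) (x0, y0) =
   \int[leb]_(t in I) (g t * (h t - h x))%:E)%E.
  rewrite [RHS]integral_mkcond; apply: eq_integral => t _.
  rewrite [RHS]patchE; case: ifPn => [tI|tI]; last first.
    under eq_integral do rewrite /phi /gI /= patchE (negbTE tI) mul0r.
    by rewrite integral0.
  move: (tI); rewrite inE /I/= in_itv/= => /andP[xt ty].
  rewrite hk//.
  transitivity (\int[leb]_(s in `[x, t]) (g t * k s)%:E)%E.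
    rewrite [RHS]integral_mkcond; apply: eq_integral => s _.
    rewrite /phi /kI /gI /= !patchE tI /I !mem_setE !in_itv/=.
    have [xs|xs] := leP x s; last by rewrite mul0r mulr0.
    have [st|st] := leP s t; last by rewrite mulr0 mulr0.
    by rewrite (le_trans st ty) mulr1.
  rewrite EFinM /Rintegral fineK; last by apply: integrable_fin_num => //; exact: ik.
  transitivity (\int[leb]_(s in `[x, t]) ((g t)%:E * (EFin \o k) s))%E; first by [].
  by rewrite integralZl//; exact: ik.
have -> : (\int[leb]_y0 \int[leb]_x0 (EFin \o phi) (x0, y0) =
   \int[leb]_(s in I) (k s * (f y - f s))%:E)%E.
  rewrite [RHS]integral_mkcond; apply: eq_integral => s _.
  rewrite [RHS]patchE; case: ifPn => [sI|sI]; last first.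
    under eq_integral do rewrite /phi /kI /= patchE (negbTE sI) mul0r mulr0.
    by rewrite integral0.
  move: (sI); rewrite inE /I/= in_itv/= => /andP[xs sy].
  rewrite fg//.
  transitivity (\int[leb]_(t in `[s, y]) (k s * g t)%:E)%E.
    rewrite [RHS]integral_mkcond; apply: eq_integral => t _.
    rewrite /phi /kI /gI /= !patchE sI /I !mem_setE !in_itv/=.
    have [st|st] := leP s t; last by rewrite !mulr0.
    rewrite (le_trans xs st)/= mulr1.
    by case: (t <= y); rewrite ?mul0r// mulrC.
  rewrite EFinM /Rintegral fineK; last by apply: integrable_fin_num => //; exact: ig.
  transitivity (\int[leb]_(t in `[s, y]) ((k s)%:E * (EFin \o g) t))%E; first by [].
  by rewrite integralZl//; exact: ig.
by rewrite /Rintegral => ->.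
Qed.

Lemma continuous_itv_bounded f x y : continuous f ->
  exists2 C, 0 <= C & forall t, `[x, y]%classic t -> `|f t| <= C.
Proof.
move=> cf.
have : compact (f @` `[x, y]).
  by apply: continuous_compact; [exact: continuous_subspaceT|exact: segment_compact].
move=> /compact_bounded[M [_ HM]]; exists (`|M| + 1); first by rewrite addr_ge0.
move=> t xt; apply: (HM (`|M| + 1)); last by exists t.
by rewrite (le_lt_trans (ler_norm M))// ltrDl.
Qed.

Lemma itv_integrable_mul f k : continuous f -> itv_integrable k ->
  itv_integrable (fun x => f x * k x).
Proof.
move=> cf ik x y; have [C C0 HC] := continuous_itv_bounded x y cf.
apply: (@integrable_bdM _ `[x, y] f k C) => //.
by apply: measurable_funTS; exact: continuous_measurable_fun.
Qed.

Lemma itv_integrableD f k : itv_integrable f -> itv_integrable k ->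
  itv_integrable (fun x => f x + k x).
Proof.
move=> fi ik x y.
have -> : EFin \o (fun x => f x + k x) = ((EFin \o f) \+ (EFin \o k))%E by [].
by apply: integrableD; [|exact: fi|exact: ik].
Qed.

Lemma primitive_mul f g h k : measurable_fun setT g -> measurable_fun setT k ->
  itv_integrable g -> itv_integrable k ->
  is_primitive f g -> is_primitive h k ->
  itv_integrable (fun x => f x * k x + h x * g x) /\
  is_primitive (fun x => f x * h x) (fun x => f x * k x + h x * g x).
Proof.
move=> mg mk ig ik fg hk.
have cf := primitive_continuous ig fg; have ch := primitive_continuous ik hk.
have ifk := itv_integrable_mul cf ik; have ihg := itv_integrable_mul ch ig.
split; first exact: itv_integrableD.
move=> x y xy; rewrite RintegralD; [|by []|exact: ifk|exact: ihg].
have := primitive_fubini mg mk ig ik fg hk xy.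
have -> : \int[leb]_(t in `[x, y]) (g t * (h t - h x)) =
    \int[leb]_(t in `[x, y]) (h t * g t) - h x * \int[leb]_(t in `[x, y]) g t.
  rewrite -RintegralZl; [|by []|exact: ig].
  rewrite -RintegralB; [|by []|exact: ihg|
    exact: (itv_integrable_mul (f := fun=> h x) (@cst_continuous _ _ (h x)) ig)].
  by apply: eq_Rintegral => t _; ring.
have -> : \int[leb]_(t in `[x, y]) (k t * (f y - f t)) =
    f y * \int[leb]_(t in `[x, y]) k t - \int[leb]_(t in `[x, y]) (f t * k t).
  rewrite -RintegralZl; [|by []|exact: ik].
  rewrite -RintegralB; [|by []|
    exact: (itv_integrable_mul (f := fun=> f y) (@cst_continuous _ _ (f y)) ik)|exact: ifk].
  by apply: eq_Rintegral => t _; ring.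
rewrite -fg// -hk// => E.
have -> : \int[leb]_(t in `[x, y]) (h t * g t) = h x * (f y - f x) +
  (f y * (h y - h x) - \int[leb]_(t in `[x, y]) (f t * k t)).
  by rewrite -E; ring.
ring.
Qed.

End primitives2.

Section exponential_primitive.
Context {R : realType}.
Local Notation leb := (@lebesgue_measure R).
Variable s : R.

Lemma continuous_expRM : continuous (fun x : R => expR (s * x)).
Proof.
move=> x; apply: (@continuous_comp _ _ _ (fun x => s * x) expR); last exact: continuous_expR.
exact: mulrl_continuous.
Qed.

Lemma continuous_expRMd : continuous (fun x : R => s * expR (s * x)).
Proof.
move=> x; apply: (@cvgMr _ _ (nbhs x)); exact: continuous_expRM.
Qed.

Lemma continuous_itv_integrable (f : R -> R) : continuous f -> itv_integrable f.
Proof.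
move=> cf x y; apply: continuous_compact_integrable; first exact: segment_compact.
exact: continuous_subspaceT.
Qed.

Lemma primitive_expRM : is_primitive (fun x => expR (s * x)) (fun x => s * expR (s * x)).
Proof.
move=> x y; rewrite le_eqVlt => /predU1P[->|xy].
  by rewrite subrr set_itv1 Rintegral_set1.
rewrite /Rintegral (@continuous_FTC2 _ _ (fun x => expR (s * x)) _ _ xy)//.
- exact/continuous_subspaceT/continuous_expRMd.
- split.
  + by move=> t _; exact: ex_derive.
  + apply: cvg_at_right_filter; exact: continuous_expRM.
  + apply: cvg_at_left_filter; exact: continuous_expRM.
- move=> t _; rewrite derive1E.
  apply: derive_val; apply: is_derive_eq.
  by rewrite /GRing.scale/= mulr1 mulrC.
Qed.

End exponential_primitive.

(** * Exchange of a geometrically dominated series with an integral *)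

Section series_swap.
Context {R : realType}.
Local Notation leb := (@lebesgue_measure R).
Variables (r C : R) (c : nat -> R).
Hypotheses (r_gt0 : 0 < r) (r_lt1 : r < 1) (C_ge0 : 0 <= C)
  (cC : forall n, `|c n| <= C * r ^+ n).
Variables (D : set R) (F : nat -> R -> R) (G : R -> R).
Hypotheses (mD : measurable (D : set (measurableTypeR R)))
  (mF : forall n, measurable_fun D (F n))
  (FG : forall n x, D x -> `|F n x| <= G x)
  (iG : leb.-integrable D (EFin \o G)).

Let S x := limn (series (fun n => c n * F n x)).

Let cv x : D x -> cvgn (series (fun n => c n * F n x)).
Proof.
move=> Dx; apply: (is_cvg_series_geometric_le r r_gt0 r_lt1 _ (C * G x)) => n.
by rewrite normrM mulrAC ler_pM// FG.
Qed.

Let mS : measurable_fun D S.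
Proof.
apply: (@measurable_fun_cvg _ _ _ _ (fun n x => series (fun k => c k * F k x) n)) => //.
move=> n; apply: measurable_sum => k.
by apply: measurable_funM => //; exact: measurable_cst.
Qed.

Lemma series_integral_swap : leb.-integrable D (EFin \o S) /\
  series (fun n => c n * \int[leb]_(x in D) F n x) @ \oo --> \int[leb]_(x in D) S x.
Proof.
have iF n : leb.-integrable D (EFin \o F n).
  apply: le_integrable iG; [exact: mD| |].
    by apply/measurable_EFinP; exact: (mF n).
  by move=> x Dx /=; rewrite lee_fin (le_trans (FG n Dx))// ler_norm.
have icF n : leb.-integrable D (EFin \o (fun x => c n * F n x)).
  have -> : EFin \o (fun x => c n * F n x) = (fun x => (c n)%:E * (EFin \o F n) x)%E by [].
  exact: integrableZl.
have isF n : leb.-integrable D (EFin \o (fun x => series (fun k => c k * F k x) n)) /\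
    \int[leb]_(x in D) series (fun k => c k * F k x) n =
    series (fun n => c n * \int[leb]_(x in D) F n x) n.
  elim: n => [|n [IHi IHe]].
    rewrite /series/=; under eq_fun do rewrite big_geq//.
    by rewrite big_geq// (Rintegral_cst leb mD) mul0r; split=> //; exact: integrable0.
  have E : (fun x => series (fun k => c k * F k x) n.+1) =
      (fun x => series (fun k => c k * F k x) n + c n * F n x).
    by apply/funext => x; rewrite /series/= big_nat_recr.
  rewrite E; split.
    by have := integrableD mD IHi (icF n); apply: eq_integrable.
  rewrite RintegralD// IHe RintegralZl//.
  by rewrite [in RHS]/series/= big_nat_recr.
have ig : leb.-integrable D (EFin \o (fun x => C / (1 - r) * G x)).
  have -> : EFin \o (fun x => C / (1 - r) * G x) =
    (fun x => (C / (1 - r))%:E * (EFin \o G) x)%E by [].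
  exact: integrableZl.
have [] := @dominated_convergence _ _ _ leb D mD
  (fun n x => (series (fun k => c k * F k x) n)%:E) (EFin \o S)
  (EFin \o (fun x => C / (1 - r) * G x)).
- by move=> n; case/integrableP: (isF n).1.
- exact/measurable_EFinP.
- by apply/aeW => x Dx; apply: cvg_EFin; [exact: nearW|exact: cv].
- exact: ig.
- apply/aeW => x n Dx /=; rewrite lee_fin.
  have G0 : 0 <= G x := le_trans (normr_ge0 _) (FG 0 Dx).
  rewrite mulrAC; apply: (series_geometric_le r r_gt0 r_lt1); first exact: mulr_ge0.
  by move=> m; rewrite normrM mulrAC ler_pM// FG.
move=> iS _ cvS; split=> //.
have <- : (fun n => \int[leb]_(x in D) series (fun k => c k * F k x) n) =
    series (fun n => c n * \int[leb]_(x in D) F n x).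
  by apply/funext => n; exact: (isF n).2.
apply: fine_cvg; rewrite fineK//.
exact: integrable_fin_num.
Qed.

End series_swap.

Section integrable_real.
Context {R : realType}.
Local Notation leb := (@lebesgue_measure R).
Variables (D : set R) (f g : R -> R).
Hypotheses (mD : measurable (D : set (measurableTypeR R)))
  (fi : leb.-integrable D (EFin \o f)) (gi : leb.-integrable D (EFin \o g)).

Lemma integrableDR : leb.-integrable D (EFin \o (fun x => f x + g x)).
Proof. by have := integrableD mD fi gi; apply: eq_integrable. Qed.

Lemma integrableBR : leb.-integrable D (EFin \o (fun x => f x - g x)).
Proof. by have := integrableB mD fi gi; apply: eq_integrable. Qed.

Lemma integrableZR (a : R) : leb.-integrable D (EFin \o (fun x => a * f x)).
Proof. by have := integrableZl mD a fi; apply: eq_integrable. Qed.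

End integrable_real.

(** * Superpositions of infinitely many unit steps *)

Section step_sum.
Context {R : realType}.
Local Notation leb := (@lebesgue_measure R).

(* The strict inequality makes step sums left-continuous. *)
Definition step_sum (a xi : nat -> R) (x : R) : R :=
  limn (series (fun n => a n * (xi n < x)%R%:R)).

Variables (r C : R) (a xi : nat -> R).
Hypotheses (r_gt0 : 0 < r) (r_lt1 : r < 1) (C_ge0 : 0 <= C)
  (aC : forall n, `|a n| <= C * r ^+ n).

Let bd (b : bool) n : `|a n * b%:R| <= C * r ^+ n.
Proof.
rewrite normrM; case: b; first by rewrite normr1 mulr1.
by rewrite normr0 mulr0 mulr_ge0// exprn_ge0// ltW.
Qed.

Lemma step_sum_cvg x : series (fun n => a n * (xi n < x)%R%:R) @ \oo --> step_sum a xi x.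
Proof. by apply: (is_cvg_series_geometric_le r r_gt0 r_lt1 _ C) => n. Qed.

Lemma step_sum_le x : `|step_sum a xi x| <= C / (1 - r).
Proof.
have cv := @step_sum_cvg x.
have {1}-> : step_sum a xi x = limn (series (fun n => a n * (xi n < x)%R%:R)) by [].
rewrite -lim_norm; last by apply/cvg_ex; exists (step_sum a xi x).
apply: limr_le; first by apply: is_cvg_norm; apply/cvg_ex; exists (step_sum a xi x).
by near=> n; apply: (series_geometric_le r r_gt0 r_lt1).
Unshelve. all: by end_near. Qed.

Let mstep n : measurable_fun setT (fun x : R => (xi n < x)%R%:R : R).
Proof.
have -> : (fun x : R => (xi n < x)%R%:R : R) = (fun x => if xi n < x then 1 else 0).
  by apply/funext => x; case: (xi n < x).
apply: measurable_fun_if => //.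
by apply: measurable_fun_ltr => //; exact: measurable_cst.
Qed.

Lemma measurable_step_sum : measurable_fun setT (step_sum a xi).
Proof.
apply: (@measurable_fun_cvg _ _ _ _
  (fun n x => series (fun k => a k * (xi k < x)%R%:R) n)); last first.
  by move=> x _; exact: step_sum_cvg.
move=> n; apply: measurable_sum => k.
by apply: measurable_funM => //; exact: measurable_cst.
Qed.

(** The step starts the integration at xi_n; clamping that point to [x, y] covers all three relative
    positions in one formula. *)
Let step_integral1 (E E' : R -> R) x y n : itv_integrable E' ->
  is_primitive E E' -> x <= y ->
  \int[leb]_(t in `[x, y]) ((xi n < t)%R%:R * E' t) =
  E y - E (Num.min y (Num.max x (xi n))).
Proof.
move=> iE EE xy; have [xix|xxi] := ltP (xi n) x.
  rewrite (min_idPr xy) EE//; apply: eq_Rintegral => t.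
  by rewrite inE/= in_itv/= => /andP[xt _]; rewrite (lt_le_trans xix xt) mul1r.
have [yxi|xiy] := leP y (xi n).
  rewrite subrr (@eq_Rintegral _ _ _ leb _ (fun=> 0)); last first.
    move=> t; rewrite inE/= in_itv/= => /andP[_ ty].
    by rewrite ltNge (le_trans ty yxi) mul0r.
  by rewrite Rintegral_cst// mul0r.
have -> : E y - E (xi n) = (E y - E x) - (E (xi n) - E x) by ring.
rewrite !EE//.
rewrite (Rintegral_itvB (iE x y)); [|by rewrite bnd_simp|by rewrite bnd_simp ltW].
rewrite [LHS]Rintegral_mkcond [RHS]Rintegral_mkcond; apply: eq_Rintegral => t _.
rewrite !patchE !mem_setE !in_itv/=.
have [xt|tx] := leP x t; last by rewrite ltNge (le_trans (ltW tx) xxi).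
have [ty|yt] := leP t y; last by rewrite !andbF.
by rewrite !andbT /=; case: (xi n < t); rewrite ?mul1r ?mul0r.
Qed.

Lemma step_sum_integral (E E' : R -> R) x y : measurable_fun setT E' ->
  itv_integrable E' -> is_primitive E E' -> x <= y ->
  leb.-integrable `[x, y] (EFin \o (fun t => step_sum a xi t * E' t)) /\
  series (fun n => a n * (E y - E (Num.min y (Num.max x (xi n))))) @ \oo -->
    \int[leb]_(t in `[x, y]) (step_sum a xi t * E' t).
Proof.
move=> mE iE EE xy.
have mD : measurable (`[x, y]%classic : set (measurableTypeR R)) by exact: measurable_itv.
have [] := @series_integral_swap R r C a r_gt0 r_lt1 C_ge0 aC `[x, y]
  (fun n t => (xi n < t)%R%:R * E' t) (fun t => `|E' t|) mD.
- move=> n; apply: measurable_funM; first by apply: measurable_funTS; exact: mstep.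
  exact: measurable_funTS.
- move=> n t _; rewrite normrM; case: (xi n < t); rewrite ?normr1 ?normr0 ?mul1r//.
  by rewrite mul0r.
- exact: (integrable_normr mD (iE x y)).
have -> : (fun t => limn (series (fun n => a n * ((xi n < t)%R%:R * E' t)))) =
    (fun t => step_sum a xi t * E' t).
  apply/funext => t; apply/cvg_lim => //.
  have -> : series (fun n => a n * ((xi n < t)%R%:R * E' t)) =
      (fun n => series (fun n => a n * (xi n < t)%R%:R) n * E' t).
    apply/funext => n; rewrite /series/= mulr_suml.
    by apply: eq_bigr => k _; rewrite mulrA.
  by apply: cvgMl; exact: step_sum_cvg.
move=> i1 i2; split; first exact: i1.
have <- : (fun n => a n * \int[leb]_(t in `[x, y]) ((xi n < t)%R%:R * E' t)) =
    (fun n => a n * (E y - E (Num.min y (Num.max x (xi n))))).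
  by apply/funext => n; rewrite (step_integral1 _ iE EE xy).
exact: i2.
Qed.

End step_sum.

(** * The hyperbolic kernels and their derivatives *)

Section kernel.
Context {R : realType}.
Local Notation leb := (@lebesgue_measure R).
Variables (r C L k alpha beta : R) (c xi : nat -> R).
Hypotheses (r_gt0 : 0 < r) (r_lt1 : r < 1) (C_ge0 : 0 <= C)
  (k_gt0 : 0 < k) (cC : forall n, `|c n| <= C * r ^+ n)
  (xiL : forall n, 0 <= xi n <= L).

(* [kernel_f] is alpha e^(kx) + beta e^(-kx) minus the sum of
   (c_n / k) sinh (k (x - xi_n)^+), hence solves - f'' + k^2 f = sum of c_n
   delta_(xi_n); it is a.e. differentiable with derivative [kernel_d]. *)
Definition kernel_cA n := c n * expR (- (k * xi n)) / (2 * k).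
Definition kernel_cB n := c n * expR (k * xi n) / (2 * k).
Definition kernel_A x := alpha - step_sum kernel_cA xi x.
Definition kernel_B x := beta + step_sum kernel_cB xi x.
Definition kernel_f x := kernel_A x * expR (k * x) + kernel_B x * expR (- k * x).
Definition kernel_d x := k * (kernel_A x * expR (k * x) - kernel_B x * expR (- k * x)).

Let CA := C / (2 * k).
Let CB := C * expR (k * L) / (2 * k).
Let k2_gt0 : 0 < 2 * k. Proof. by rewrite mulr_gt0. Qed.

Let CA_ge0 : 0 <= CA. Proof. by rewrite divr_ge0// ltW. Qed.
Let CB_ge0 : 0 <= CB. Proof. by rewrite divr_ge0 ?(ltW k2_gt0)// mulr_ge0 ?expR_ge0. Qed.

Lemma kernel_cA_le n : `|kernel_cA n| <= C / (2 * k) * r ^+ n.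
Proof.
rewrite -/CA.
rewrite /kernel_cA !normrM normfV (gtr0_norm k2_gt0) (ger0_norm (expR_ge0 _)).
have -> : CA * r ^+ n = C * r ^+ n * 1 / (2 * k) by rewrite /CA; ring.
rewrite ler_pM2r ?invr_gt0// ler_pM ?expR_ge0//.
rewrite -[leRHS]expR0 ler_expR oppr_le0 mulr_ge0 ?(ltW k_gt0)//.
by have /andP[] := xiL n.
Qed.

Lemma kernel_cB_le n : `|kernel_cB n| <= C * expR (k * L) / (2 * k) * r ^+ n.
Proof.
rewrite -/CB.
rewrite /kernel_cB !normrM normfV (gtr0_norm k2_gt0) (ger0_norm (expR_ge0 _)).
have -> : CB * r ^+ n = C * r ^+ n * expR (k * L) / (2 * k) by rewrite /CB; ring.
rewrite ler_pM2r ?invr_gt0// ler_pM ?expR_ge0//.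
by rewrite ler_expR ler_pM2l//; have /andP[] := xiL n.
Qed.

Let cAC n : `|kernel_cA n| <= CA * r ^+ n := kernel_cA_le n.
Let cBC n : `|kernel_cB n| <= CB * r ^+ n := kernel_cB_le n.

Lemma kernel_step_A (E E' : R -> R) x y : measurable_fun setT E' ->
  itv_integrable E' -> is_primitive E E' -> x <= y ->
  leb.-integrable `[x, y] (EFin \o (fun t => step_sum kernel_cA xi t * E' t)) /\
  series (fun n => kernel_cA n * (E y - E (Num.min y (Num.max x (xi n))))) @ \oo -->
    \int[leb]_(t in `[x, y]) (step_sum kernel_cA xi t * E' t).
Proof. exact: (@step_sum_integral R r CA kernel_cA xi r_gt0 r_lt1 CA_ge0 cAC E E' x y). Qed.

Lemma kernel_step_B (E E' : R -> R) x y : measurable_fun setT E' ->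
  itv_integrable E' -> is_primitive E E' -> x <= y ->
  leb.-integrable `[x, y] (EFin \o (fun t => step_sum kernel_cB xi t * E' t)) /\
  series (fun n => kernel_cB n * (E y - E (Num.min y (Num.max x (xi n))))) @ \oo -->
    \int[leb]_(t in `[x, y]) (step_sum kernel_cB xi t * E' t).
Proof. exact: (@step_sum_integral R r CB kernel_cB xi r_gt0 r_lt1 CB_ge0 cBC E E' x y). Qed.

Let mA : measurable_fun setT kernel_A.
Proof.
apply: measurable_funB; first exact: measurable_cst.
exact: (measurable_step_sum xi r_gt0 r_lt1 CA_ge0 cAC).
Qed.

Let mB : measurable_fun setT kernel_B.
Proof.
apply: measurable_funD; first exact: measurable_cst.
exact: (measurable_step_sum xi r_gt0 r_lt1 CB_ge0 cBC).
Qed.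

Let A_le x : `|kernel_A x| <= `|alpha| + CA / (1 - r).
Proof.
rewrite (le_trans (ler_normB _ _))// lerD2l.
exact: (step_sum_le xi r_gt0 r_lt1 CA_ge0 cAC).
Qed.

Let B_le x : `|kernel_B x| <= `|beta| + CB / (1 - r).
Proof.
rewrite (le_trans (ler_normD _ _))// lerD2l.
exact: (step_sum_le xi r_gt0 r_lt1 CB_ge0 cBC).
Qed.

Let mexp s : measurable_fun setT (fun x : R => expR (s * x)).
Proof. by apply: continuous_measurable_fun; exact: continuous_expRM. Qed.

Lemma measurable_kernel_d : measurable_fun setT kernel_d.
Proof.
apply: measurable_funM; first exact: measurable_cst.
apply: measurable_funB; exact: measurable_funM.
Qed.

Let d_le x y : exists2 K, 0 <= K & forall t, `[x, y]%classic t -> `|kernel_d t| <= K.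
Proof.
have [K1 K10 H1] := continuous_itv_bounded x y (@continuous_expRM R k).
have [K2 K20 H2] := continuous_itv_bounded x y (@continuous_expRM R (- k)).
exists (k * ((`|alpha| + CA / (1 - r)) * K1 + (`|beta| + CB / (1 - r)) * K2)).
  have r1 : 0 <= (1 - r)^-1 by rewrite invr_ge0 subr_ge0 ltW.
  rewrite mulr_ge0 ?(ltW k_gt0)// addr_ge0// mulr_ge0// addr_ge0// mulr_ge0//.
move=> t xt; rewrite /kernel_d normrM (gtr0_norm k_gt0) ler_pM2l//.
rewrite (le_trans (ler_normB _ _))// !normrM.
by apply: lerD; apply: ler_pM => //; [exact: H1|exact: H2].
Qed.

Lemma itv_integrable_kernel_d : itv_integrable kernel_d.
Proof.
move=> x y; have [K K0 HK] := d_le x y.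
have -> : kernel_d = (fun t => kernel_d t * 1) by apply/funext => t; rewrite mulr1.
apply: (@integrable_bdM _ _ _ _ K) => //.
  by apply: measurable_funTS; exact: measurable_kernel_d.
exact: (continuous_itv_integrable (@cst_continuous _ _ (1 : R))).
Qed.

Lemma locally_integrable_kernel_d_sqr : locally_integrable setT (fun x => kernel_d x ^+ 2).
Proof.
apply/itv_integrable_locally; first by apply: measurable_funX; exact: measurable_kernel_d.
move=> x y; have [K K0 HK] := d_le x y.
have -> : (fun t => kernel_d t ^+ 2) = (fun t => kernel_d t * kernel_d t).
  by apply/funext => t; rewrite expr2.
apply: (@integrable_bdM _ _ _ _ K) => //.
  by apply: measurable_funTS; exact: measurable_kernel_d.
exact: itv_integrable_kernel_d.
Qed.

(** Although A and B jump, the function does not: at a knot the jumps of A e^(kx) and B e^(-kx) are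
    opposite. The proof evaluates the limit of one series in two ways, by integrals and by endpoint
    values. *)
Lemma kernel_primitive : is_primitive kernel_f kernel_d.
Proof.
move=> x y xy.
have md s : measurable_fun setT (fun x : R => s * expR (s * x)).
  by apply: continuous_measurable_fun; exact: continuous_expRMd.
have id s : itv_integrable (fun x : R => s * expR (s * x)).
  by apply: continuous_itv_integrable; exact: continuous_expRMd.
have [iA cvA] := kernel_step_A (md k) (id k)
  (@primitive_expRM R k) xy.
have [iB cvB] := kernel_step_B (md (- k)) (id (- k))
  (@primitive_expRM R (- k)) xy.
have -> : \int[leb]_(t in `[x, y]) kernel_d t =
   (alpha * (expR (k * y) - expR (k * x)) + beta * (expR (- k * y) - expR (- k * x))) +
   (\int[leb]_(t in `[x, y]) (step_sum kernel_cB xi t * (- k * expR (- k * t))) -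
    \int[leb]_(t in `[x, y]) (step_sum kernel_cA xi t * (k * expR (k * t)))).
  rewrite (primitive_expRM k xy) (primitive_expRM (- k) xy).
  have icd (s a : R) : leb.-integrable `[x, y] (EFin \o (fun t => a * (s * expR (s * t)))).
    exact: (itv_integrable_mul (f := fun=> a) (@cst_continuous _ _ a) (id s)).
  rewrite -RintegralZl; [|by []|exact: id].
  rewrite -RintegralZl; [|by []|exact: id].
  rewrite -RintegralB; [|by []|exact: iB|exact: iA].
  rewrite -RintegralD; [|by []|exact: icd|exact: icd].
  rewrite -RintegralD; [|by []| | ].
  - apply: eq_Rintegral => t _; rewrite /kernel_d /kernel_A /kernel_B; ring.
  - exact: integrableDR.
  - exact: integrableBR.
pose jump (n : nat) (s z : R) := (xi n < z)%R%:R * expR (s * z).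
pose tA n := kernel_cA n * (expR (k * y) - expR (k * Num.min y (Num.max x (xi n)))).
pose tB n := kernel_cB n * (expR (- k * y) - expR (- k * Num.min y (Num.max x (xi n)))).
pose sA z n := kernel_cA n * (xi n < z)%R%:R.
pose sB z n := kernel_cB n * (xi n < z)%R%:R.
(* When the knot lies in [x, y), each of [tA n] and [tB n] contains the jump c_n / (2 k), and these
   cancel. *)
have tE n : tA n - tB n = (sA y n * expR (k * y) - sA x n * expR (k * x)) -
    (sB y n * expR (- k * y) - sB x n * expR (- k * x)).
  rewrite /tA /tB /sA /sB; have [xix|xxi] := ltP (xi n) x.
    by rewrite (min_idPr xy) (lt_le_trans xix xy) /= mulr1n; ring.
  have [yxi|xiy] := leP y (xi n); first by rewrite /= mulr0n; ring.
  have -> : kernel_cA n * (expR (k * y) - expR (k * xi n)) =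
      kernel_cA n * expR (k * y) - c n / (2 * k).
    rewrite mulrBr; congr (_ - _); rewrite /kernel_cA.
    have := expRN (k * xi n); have := expR_gt0 (k * xi n) => /lt0r_neq0 h ->.
    by field; rewrite h (lt0r_neq0 k_gt0).
  have -> : kernel_cB n * (expR (- k * y) - expR (- k * xi n)) =
      kernel_cB n * expR (- k * y) - c n / (2 * k).
    rewrite mulrBr; congr (_ - _); rewrite /kernel_cB mulNr.
    have := expRN (k * xi n); have := expR_gt0 (k * xi n) => /lt0r_neq0 h ->.
    by field; rewrite h (lt0r_neq0 k_gt0).
  by rewrite /= mulr0n mulr1n; ring.
have cAz z : series (sA z) @ \oo --> step_sum kernel_cA xi z.
  exact: (@step_sum_cvg R r CA kernel_cA xi r_gt0 r_lt1 CA_ge0 cAC z).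
have cBz z : series (sB z) @ \oo --> step_sum kernel_cB xi z.
  exact: (@step_sum_cvg R r CB kernel_cB xi r_gt0 r_lt1 CB_ge0 cBC z).
have l1 : (fun n => series tA n - series tB n) @ \oo -->
    \int[leb]_(t in `[x, y]) (step_sum kernel_cA xi t * (k * expR (k * t))) -
    \int[leb]_(t in `[x, y]) (step_sum kernel_cB xi t * (- k * expR (- k * t))).
  exact: cvgB cvA cvB.
have l2 : (fun n => series tA n - series tB n) @ \oo -->
    (step_sum kernel_cA xi y * expR (k * y) - step_sum kernel_cA xi x * expR (k * x)) -
    (step_sum kernel_cB xi y * expR (- k * y) - step_sum kernel_cB xi x * expR (- k * x)).
  have -> : (fun n => series tA n - series tB n) = (fun n =>
     (series (sA y) n * expR (k * y) - series (sA x) n * expR (k * x)) -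
     (series (sB y) n * expR (- k * y) - series (sB x) n * expR (- k * x))).
    apply/funext => n; rewrite /series/= -sumrB !mulr_suml -!sumrB.
    by apply: eq_bigr => i _; exact: tE.
  by apply: cvgB; apply: cvgB; apply: cvgMl.
have := cvg_unique (@Rhausdorff R) l1 l2.
rewrite /kernel_f /kernel_A /kernel_B.
set IA := Rintegral _ _ _; set IB := Rintegral _ _ _ => E.
have -> : IB - IA = - (IA - IB) by ring.
rewrite E; ring.
Qed.

End kernel.

(** * Reduction of integrals with compactly supported test functions to an interval *)

Section supported.
Context {R : realType}.
Local Notation leb := (@lebesgue_measure R).
Variables (h h' : R -> R) (M : R).
Hypotheses (mh' : measurable_fun setT h') (ih' : itv_integrable h')
  (hh' : is_primitive h h') (M_gt0 : 0 < M) (hM : forall x, M <= `|x| -> h x = 0).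

Let I : set R := `[- M, M]%classic.

(** Truncating h' to the support interval gives another density of h, and densities are unique
    a.e. *)
Lemma primitive_supported : {ae leb, forall x, h' x = (h' \_ I) x}.
Proof.
have mI : measurable (I : set (measurableTypeR R)) by exact: measurable_itv.
have mr : measurable_fun setT (h' \_ I).
  by apply/(measurable_restrictT _ _).1 => //; exact: measurable_funTS.
have ir : itv_integrable (h' \_ I).
  move=> x y; apply: le_integrable (ih' x y) => //.
    by apply/measurable_EFinP; exact: measurable_funTS.
  move=> t _ /=; rewrite lee_fin patchE; case: ifP => // _.
  by rewrite normr0.
apply: (primitive_unique (f := h)) => //.
move=> x y xy; rewrite -Rintegral_mkcondr.
have h0 z : (z <= - M) || (M <= z) -> h z = 0.
  by move=> /orP[zM|Mz]; apply: hM; [rewrite ler_normr lerNr zM orbT|rewrite ler_normr Mz].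
pose a := Num.max x (- M); pose b := Num.min y M.
have -> : `[x, y] `&` I = `[a, b]%classic.
  apply/seteqP; split => t; rewrite /I /= !in_itv/= ge_max le_min.
    by move=> [/andP[-> ->] /andP[-> ->]].
  by move=> /andP[/andP[-> ->] /andP[-> ->]].
have ha : a <= M -> h a = h x.
  rewrite /a; have [xM _|//] := leP x (- M).
  by rewrite !h0// ?lexx ?xM.
have hb : - M <= b -> h b = h y.
  rewrite /b; have [//|My _] := ltP y M.
  by rewrite !h0// ?lexx ?My ?orbT.
have [ab|ba] := leP a b.
  rewrite -hh'// ha ?hb//.
    by rewrite (le_trans _ ab)// /a le_max lexx orbT.
  by rewrite (le_trans ab)// /b ge_min lexx orbT.
rewrite set_itv_ge ?bnd_simp -?ltNge// Rintegral_set0.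
move: ba; rewrite /a /b; have [yM|My] := ltP y M; have [xM|Mx] := leP x (- M) => ba.
- by rewrite !h0 ?subrr// ?xM ?(ltW ba).
- by move: (lt_le_trans ba xy); rewrite ltxx.
- by move: ba; move: M_gt0; lra.
- by rewrite !h0 ?subrr// ?(ltW ba) ?My ?orbT.
Qed.

Variables (g f' : R -> R) (f : R -> R).
Hypotheses (mg : measurable_fun setT g) (gf' : {ae leb, forall x, g x = f' x})
  (mf' : measurable_fun setT f') (if'h' : leb.-integrable I (EFin \o (fun x => f' x * h' x)))
  (ifh : leb.-integrable I (EFin \o (fun x => f x * h x))).

Let mI : measurable (I : set (measurableTypeR R)). Proof. exact: measurable_itv. Qed.

Lemma integral_supported :
  leb.-integrable setT (EFin \o (fun x => f x * h x)) /\
  \int[leb]_x (f x * h x) = \int[leb]_(x in I) (f x * h x).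
Proof.
have E : (fun x => f x * h x) \_ I = (fun x => f x * h x).
  apply/funext => x; rewrite patchE; case: ifPn => // xI.
  rewrite hM ?mulr0//; move: xI; rewrite notin_setE /I/= in_itv/= => /negP.
  by rewrite -ler_norml -ltNge => /ltW.
split; last by rewrite [RHS]Rintegral_mkcond E.
by have := (integrable_mkcond _ mI).1 ifh; rewrite restrict_EFin E.
Qed.

(** Serves to trade the chosen weak derivative [wderiv], known only a.e., for an explicit formula
    under the integral. *)
Lemma integral_supported_ae :
  leb.-integrable setT (EFin \o (fun x => g x * h' x)) /\
  \int[leb]_x (g x * h' x) = \int[leb]_(x in I) (f' x * h' x).
Proof.
have H : {ae leb, forall x, g x * h' x = ((fun x => f' x * h' x) \_ I) x}.
  have := primitive_supported; have := gf'.
  apply: filterS2; first exact: (ae_filter_ringOfSetsType leb).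
  move=> x -> ->; rewrite !patchE; case: ifP => // _.
  by rewrite mulr0.
have m1 : measurable_fun setT (fun x => g x * h' x) by exact: measurable_funM.
have m2 : measurable_fun setT ((fun x => f' x * h' x) \_ I).
  apply/(measurable_restrictT _ _).1 => //; apply: measurable_funTS.
  exact: measurable_funM.
have i2 : leb.-integrable setT (EFin \o ((fun x => f' x * h' x) \_ I)).
  by have := (integrable_mkcond _ mI).1 if'h'; rewrite restrict_EFin.
split.
  apply/integrableP; split; first exact/measurable_EFinP.
  have -> : (\int[leb]_x `|(EFin \o (fun x => (g x * h' x)%R)) x| =
      \int[leb]_x `|(EFin \o ((fun x => (f' x * h' x)%R) \_ I)) x|)%E.
    apply: ae_eq_integral => //.
    - by apply: measurableT_comp => //; exact/measurable_EFinP.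
    - by apply: measurableT_comp => //; exact/measurable_EFinP.
    - by apply: ae_imp H => x /= -> _.
  by case/integrableP: i2.
rewrite [RHS]Rintegral_mkcond /Rintegral; congr fine; apply: ae_eq_integral => //.
- exact/measurable_EFinP.
- exact/measurable_EFinP.
- by apply: ae_imp H => x /= -> _.
Qed.

End supported.

(** * The weak equation of the kernels *)

Section kernel_weak.
Context {R : realType}.
Local Notation leb := (@lebesgue_measure R).
Variables (r C L k alpha beta : R) (c xi : nat -> R).
Hypotheses (r_gt0 : 0 < r) (r_lt1 : r < 1) (C_ge0 : 0 <= C) (L_ge0 : 0 <= L)
  (k_gt0 : 0 < k) (cC : forall n, `|c n| <= C * r ^+ n)
  (xiL : forall n, 0 <= xi n <= L).
Variables (h h' : R -> R) (M : R).
Hypotheses (mh' : measurable_fun setT h') (ih' : itv_integrable h')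
  (hh' : is_primitive h h') (LM : L < M) (hM : forall x, M <= `|x| -> h x = 0).

Local Notation kf := (kernel_f k alpha beta c xi).
Local Notation kd := (kernel_d k alpha beta c xi).

Let ch : continuous h := primitive_continuous ih' hh'.
Let M_gt0 : 0 < M := le_lt_trans L_ge0 LM.
Let MM : - M <= M. Proof. by rewrite (@le_trans _ _ 0)// ?oppr_le0 ltW. Qed.

Let ikd : itv_integrable kd.
Proof. exact: (itv_integrable_kernel_d alpha beta r_gt0 r_lt1 C_ge0 k_gt0 cC xiL). Qed.

Let pkf : is_primitive kf kd.
Proof. exact: (kernel_primitive alpha beta r_gt0 r_lt1 C_ge0 k_gt0 cC xiL). Qed.

Lemma kernel_f_continuous : continuous kf.
Proof. exact: primitive_continuous ikd pkf. Qed.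

Let E' s (t : R) := expR (s * t) * h' t + h t * (s * expR (s * t)).

Let pE s : [/\ measurable_fun setT (E' s), itv_integrable (E' s) &
  is_primitive (fun t => expR (s * t) * h t) (E' s)].
Proof.
have cE := @continuous_expRM R s; have cEd := @continuous_expRMd R s.
have [i p] := primitive_mul (continuous_measurable_fun cEd) mh'
  (continuous_itv_integrable cEd) ih' (@primitive_expRM R s) hh'.
split => //; apply: measurable_funD; apply: measurable_funM => //.
- exact: continuous_measurable_fun.
- exact: continuous_measurable_fun.
- exact: continuous_measurable_fun.
Qed.

Let h0 x : M <= `|x| -> h x = 0 := @hM x.

Let intE s : \int[leb]_(t in `[- M, M]) E' s t = 0.
Proof.
have [_ _ p] := pE s; rewrite -p// !h0 ?mulr0 ?subrr//.
  by rewrite normrN ler_norm.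
exact: ler_norm.
Qed.

(** The integrand f' h' + k^2 f h equals k A (e^(kx) h)' - k B (e^(-kx) h)'. The constants alpha and
    beta integrate to 0 since h vanishes at both ends, and each knot contributes c_n h(xi_n) / 2
    through A and as much through B. *)
Lemma kernel_weak :
  [/\ leb.-integrable `[- M, M] (EFin \o (fun x => kd x * h' x)),
      leb.-integrable `[- M, M] (EFin \o (fun x => kf x * h x)) &
      series (fun n => c n * h (xi n)) @ \oo -->
        \int[leb]_(x in `[- M, M]) (kd x * h' x) +
        k ^+ 2 * \int[leb]_(x in `[- M, M]) (kf x * h x)].
Proof.
have mI : measurable (`[- M, M]%classic : set (measurableTypeR R)).
  exact: measurable_itv.
have if2 : leb.-integrable `[- M, M] (EFin \o (fun x => kf x * h x)).
  exact: (itv_integrable_mul kernel_f_continuous (continuous_itv_integrable ch)).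
have clamp n : Num.min M (Num.max (- M) (xi n)) = xi n.
  have /andP[x0 xL] := xiL n.
  have Mx : - M <= xi n by rewrite (le_trans _ x0)// oppr_le0 ltW.
  by rewrite (max_idPr Mx); apply/min_idPr; rewrite (le_trans xL)// ltW.
have [mEp iEp pEp] := pE k; have [mEm iEm pEm] := pE (- k).
have [iA cvA] := kernel_step_A r_gt0 r_lt1 C_ge0 k_gt0 cC xiL mEp iEp pEp MM.
have [iB cvB] := kernel_step_B r_gt0 r_lt1 C_ge0 k_gt0 cC xiL mEm iEm pEm MM.
have hM0 : h M = 0 by apply: h0; exact: ler_norm.
set sA := step_sum _ _ in iA cvA; set sB := step_sum _ _ in iB cvB.
have J1 := integrableBR mI (integrableZR mI (iEp (- M) M) alpha) iA.
have J2 := integrableDR mI (integrableZR mI (iEm (- M) M) beta) iB.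
have J := integrableBR mI (integrableZR mI J1 k) (integrableZR mI J2 k).
have K2 := integrableZR mI if2 (k ^+ 2).
have Ef : (fun x => kd x * h' x) = (fun x =>
   (k * (alpha * E' k x - sA x * E' k x) - k * (beta * E' (- k) x + sB x * E' (- k) x)) -
   k ^+ 2 * (kf x * h x)).
  apply/funext => x; rewrite /kernel_d /kernel_f /kernel_A /kernel_B /E'.
  rewrite -/sA -/sB; ring.
have if1 : leb.-integrable `[- M, M] (EFin \o (fun x => kd x * h' x)).
  by rewrite Ef; exact: integrableBR.
split=> //.
rewrite Ef (RintegralB mI J K2) RintegralZl// subrK.
rewrite (RintegralB mI (integrableZR mI J1 k) (integrableZR mI J2 k)).
rewrite (RintegralZl k mI J1) (RintegralZl k mI J2).
rewrite (RintegralB mI (integrableZR mI (iEp (- M) M) alpha) iA).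
rewrite (RintegralD mI (integrableZR mI (iEm (- M) M) beta) iB).
rewrite (RintegralZl alpha mI (iEp (- M) M)) (RintegralZl beta mI (iEm (- M) M)).
rewrite !intE !mulr0 sub0r add0r mulrN -opprD -mulrDr.
have -> : series (fun n => c n * h (xi n)) = (fun n => - (k *
   (series (fun n => kernel_cA k c xi n * (expR (k * M) * h M -
       expR (k * Num.min M (Num.max (- M) (xi n))) *
       h (Num.min M (Num.max (- M) (xi n))))) n +
    series (fun n => kernel_cB k c xi n * (expR (- k * M) * h M -
       expR (- k * Num.min M (Num.max (- M) (xi n))) *
       h (Num.min M (Num.max (- M) (xi n))))) n))).
  apply/funext => n; rewrite /series/= -big_split/= mulr_sumr -sumrN.
  apply: eq_bigr => i _; rewrite clamp hM0 !mulr0 !sub0r.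
  rewrite /kernel_cA /kernel_cB mulNr.
  have := expRN (k * xi i); have := expR_gt0 (k * xi i) => /lt0r_neq0 e0 ->.
  by field; rewrite e0 (lt0r_neq0 k_gt0).
by apply: cvgN; apply: cvgMr; exact: cvgD cvA cvB.
Qed.

End kernel_weak.

(** * Algebra of weak derivatives *)

Section weak_derivative.
Context {R : realType}.
Implicit Types (f g h k : R -> R).
Local Notation leb := (@lebesgue_measure R).

Lemma H1loc_wderiv f : H1loc f -> is_weak_derivative f (wderiv f).
Proof.
by move=> [g fg]; rewrite /wderiv;
  apply: (@getPex _ [set g | is_weak_derivative f g]); exists g.
Qed.

(** [wderiv] is an arbitrary choice among the weak derivatives; this is the only access to its
    values. *)
Lemma wderiv_ae f g : is_weak_derivative f g -> {ae leb, forall x, wderiv f x = g x}.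
Proof.
move=> fg; have /H1loc_wderiv/weak_derivativeP[m1 i1 p1] : H1loc f by exists g.
by have [m2 i2 p2] := weak_derivativeP fg; exact: (primitive_unique m1 m2 i1 i2 p1 p2).
Qed.

Lemma weak_derivativeI f g : measurable_fun setT g ->
  itv_integrable (fun x => g x ^+ 2) -> is_primitive f g -> is_weak_derivative f g.
Proof.
move=> mg ig fg; split=> //; apply/itv_integrable_locally => //.
exact: measurable_funX.
Qed.

Lemma weak_derivative_sqr f g : is_weak_derivative f g -> itv_integrable (fun x => g x ^+ 2).
Proof. by move=> [mg ig fg]; apply/itv_integrable_locally => //; exact: measurable_funX. Qed.

Let sqrD (g k : R -> R) : measurable_fun setT g -> measurable_fun setT k ->
  itv_integrable (fun x => g x ^+ 2) -> itv_integrable (fun x => k x ^+ 2) ->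
  itv_integrable (fun x => (g x + k x) ^+ 2).
Proof.
move=> mg mk ig ik x y.
have mI : measurable (`[x, y]%classic : set (measurableTypeR R)) by exact: measurable_itv.
have i2 := integrableZR mI (integrableDR mI (ig x y) (ik x y)) 2.
apply: le_integrable i2 => //.
  apply/measurable_EFinP; apply: measurable_funTS.
  by apply: measurable_funX; exact: measurable_funD.
move=> t _ /=; rewrite lee_fin !ger0_norm ?sqr_ge0//.
  by have := sqr_ge0 (g t - k t); rewrite sqrrB sqrrD; lra.
by rewrite mulr_ge0// addr_ge0 ?sqr_ge0.
Qed.

Let sqrM f g : continuous f -> itv_integrable (fun x => g x ^+ 2) ->
  itv_integrable (fun x => (f x * g x) ^+ 2).
Proof.
move=> cf ig.
have -> : (fun x => (f x * g x) ^+ 2) = (fun x => f x ^+ 2 * g x ^+ 2).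
  by apply/funext => x; rewrite exprMn.
apply: itv_integrable_mul => // x; apply: (@continuous_comp _ _ _ f (fun y => y ^+ 2)); first exact: cf.
exact: exprn_continuous.
Qed.

Lemma weak_derivative_continuous f g : is_weak_derivative f g -> continuous f.
Proof. by move=> /weak_derivativeP[_ ig p]; exact: primitive_continuous ig p. Qed.

Lemma weak_derivative_mul f g h k : is_weak_derivative f g -> is_weak_derivative h k ->
  is_weak_derivative (fun x => f x * h x) (fun x => f x * k x + h x * g x).
Proof.
move=> fg hk; have cf := weak_derivative_continuous fg.
have ch := weak_derivative_continuous hk.
have [mg ig pg] := weak_derivativeP fg; have [mk ik pk] := weak_derivativeP hk.
have [i p] := primitive_mul mg mk ig ik pg pk.
have m1 : measurable_fun setT (fun x => f x * k x).
  by apply: measurable_funM => //; exact: continuous_measurable_fun.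
have m2 : measurable_fun setT (fun x => h x * g x).
  by apply: measurable_funM => //; exact: continuous_measurable_fun.
apply: weak_derivativeI => //; first exact: measurable_funD.
by apply: sqrD => //; apply: sqrM => //; [exact: weak_derivative_sqr hk|exact: weak_derivative_sqr fg].
Qed.

Lemma weak_derivativeD f g h k : is_weak_derivative f g -> is_weak_derivative h k ->
  is_weak_derivative (fun x => f x + h x) (fun x => g x + k x).
Proof.
move=> fg hk.
have [mg ig pg] := weak_derivativeP fg; have [mk ik pk] := weak_derivativeP hk.
apply: weak_derivativeI; first exact: measurable_funD.
  by apply: sqrD => //; [exact: weak_derivative_sqr fg|exact: weak_derivative_sqr hk].
move=> x y xy; rewrite RintegralD; [|by []|exact: ig|exact: ik].
by rewrite -pg// -pk//; ring.
Qed.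

Lemma weak_derivativeN f g : is_weak_derivative f g ->
  is_weak_derivative (fun x => - f x) (fun x => - g x).
Proof.
move=> fg; have [mg ig pg] := weak_derivativeP fg.
apply: weak_derivativeI; first exact: measurable_funN.
  have := weak_derivative_sqr fg; congr itv_integrable.
  by apply/funext => x; rewrite sqrrN.
move=> x y xy.
have mI : measurable (`[x, y]%classic : set (measurableTypeR R)) by exact: measurable_itv.
have := RintegralZl (-1) mI (ig x y).
by under eq_Rintegral do rewrite mulN1r; move=> ->; rewrite -pg//; ring.
Qed.

Lemma weak_derivativeB f g h k : is_weak_derivative f g -> is_weak_derivative h k ->
  is_weak_derivative (fun x => f x - h x) (fun x => g x - k x).
Proof. by move=> fg /weak_derivativeN; exact: weak_derivativeD. Qed.

End weak_derivative.

Section kernel_global.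
Context {R : realType}.
Local Notation leb := (@lebesgue_measure R).
Variables (r C L k alpha beta : R) (c xi : nat -> R).
Hypotheses (r_gt0 : 0 < r) (r_lt1 : r < 1) (C_ge0 : 0 <= C) (L_ge0 : 0 <= L)
  (k_gt0 : 0 < k) (cC : forall n, `|c n| <= C * r ^+ n)
  (xiL : forall n, 0 <= xi n <= L).

Local Notation kf := (kernel_f k alpha beta c xi).
Local Notation kd := (kernel_d k alpha beta c xi).

Lemma kernel_weak_derivative : is_weak_derivative kf kd.
Proof.
split.
- exact: (@measurable_kernel_d R r C L k alpha beta c xi).
- exact: (@locally_integrable_kernel_d_sqr R r C L k alpha beta c xi).
- exact: (@kernel_primitive R r C L k alpha beta c xi).
Qed.

Lemma kernel_wderiv_ae : {ae leb, forall x, wderiv kf x = kd x}.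
Proof. exact: wderiv_ae kernel_weak_derivative. Qed.

Lemma kernel_weak_global (h h' : R -> R) (M : R) : is_weak_derivative h h' ->
  (forall x, M <= `|x| -> h x = 0) ->
  [/\ leb.-integrable setT (EFin \o (fun x => wderiv kf x * h' x)),
      leb.-integrable setT (EFin \o (fun x => kf x * h x)) &
      series (fun n => c n * h (xi n)) @ \oo -->
        \int[leb]_x (wderiv kf x * h' x) + k ^+ 2 * \int[leb]_x (kf x * h x)].
Proof.
move=> hh' hM; have [mh ih ph] := weak_derivativeP hh'.
(* The interval must also contain every knot in its interior. *)
pose M' := Num.max M (L + 1).
have LM : L < M' by rewrite /M' lt_max ltrDl ltr01 orbT.
have hM' x : M' <= `|x| -> h x = 0.
  by move=> Mx; apply: hM; rewrite (le_trans _ Mx)// /M' le_max lexx.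
have [i1 i2 cv] := kernel_weak alpha beta r_gt0 r_lt1 C_ge0 L_ge0 k_gt0 cC xiL mh ih ph LM hM'.
have M0 : 0 < M' := le_lt_trans L_ge0 LM.
have [mw _ _] := weak_derivativeP (H1loc_wderiv (ex_intro _ _ kernel_weak_derivative)).
have [md _ _] := weak_derivativeP kernel_weak_derivative.
have [j1 e1] := integral_supported_ae mh ih ph M0 hM' mw kernel_wderiv_ae md i1.
have [j2 e2] := integral_supported hM' i2.
by split=> //; rewrite e1 e2.
Qed.

End kernel_global.

(** * Values and left continuity of step sums *)

Section step_sum_values.
Context {R : realType}.
Variables (r C : R) (a xi : nat -> R).
Hypotheses (r_gt0 : 0 < r) (r_lt1 : r < 1) (C_ge0 : 0 <= C)
  (aC : forall n, `|a n| <= C * r ^+ n).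

Lemma step_sum_left x : (forall n, x <= xi n) -> step_sum a xi x = 0.
Proof.
move=> xxi; rewrite /step_sum (_ : series _ = cst 0) ?lim_cst//.
by apply/funext => n; rewrite /series/= big1// => i _; rewrite ltNge xxi mulr0.
Qed.

Lemma step_sum_right x : (forall n, xi n < x) -> step_sum a xi x = limn (series a).
Proof.
move=> xix; rewrite /step_sum; congr (limn (series _)).
by apply/funext => n; rewrite xix mulr1.
Qed.

(** The strict inequality leaves out the jump at the knot itself, which matches the convention that
    [string_sol n] describes the left side of the n-th mass. *)
Lemma step_sum_knot n : {homo xi : m p / (m < p)%N >-> m < p} ->
  step_sum a xi (xi n) = \sum_(0 <= k < n) a k.
Proof.
move=> xiS; rewrite /step_sum; apply/cvg_lim => //.
rewrite -(cvg_shiftn n); rewrite (_ : (fun _ => _) = cst (\sum_(0 <= k < n) a k)).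
  exact: cvg_cst.
apply/funext => N; rewrite /series/= addnC (big_cat_nat (n := n))//= ?leq_addr//.
rewrite [X in _ + X]big_nat_cond [X in _ + X]big1 ?addr0; last first.
  move=> i /andP[/andP[ni _] _]; rewrite ltNge; move: ni; rewrite leq_eqVlt => /predU1P[->|ni].
    by rewrite lexx mulr0.
  by rewrite (ltW (xiS _ _ ni)) mulr0.
by apply: eq_big_nat => i /andP[_ /xiS ->]; rewrite mulr1.
Qed.

Let tail N x : `|step_sum a xi x - series (fun n => a n * (xi n < x)%R%:R) N| <=
  C * r ^+ N / (1 - r).
Proof.
pose u n := a n * (xi n < x)%R%:R.
have cv : series u @ \oo --> step_sum a xi x.
  exact: (@step_sum_cvg R r C a xi r_gt0 r_lt1 C_ge0 aC x).
have cv2 : (fun n => series u (N + n)%N - series u N) @ \oo -->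
    step_sum a xi x - series u N.
  apply: cvgB; last exact: cvg_cst.
  rewrite (_ : (fun n => _) = (fun n => series u (n + N)%N)); last first.
    by apply/funext => n; rewrite addnC.
  by rewrite (cvg_shiftn N (series u) _).
rewrite -(cvg_lim (@Rhausdorff R) cv2) -lim_norm; last by apply/cvg_ex; eexists; exact: cv2.
apply: limr_le; first by apply: is_cvg_norm; apply/cvg_ex; eexists; exact: cv2.
near=> n; have -> : series u (N + n)%N - series u N = series (fun k => u (k + N)%N) n.
  rewrite /series/= (big_cat_nat (n := N))//= ?leq_addr// addrAC subrr add0r.
  by rewrite -{1}[N]add0n big_addn addKn.
apply: (series_geometric_le r r_gt0 r_lt1); first by rewrite mulr_ge0// exprn_ge0// ltW.
move=> m; rewrite /u normrM -mulrA -exprD addnC.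
apply: le_trans (aC _); case: (_ < _); first by rewrite normr1 mulr1.
by rewrite normr0 mulr0.
Unshelve. all: by end_near. Qed.

(** Each partial sum is constant just to the left of x, and the tails are small uniformly in the
    point. Accumulation of the knots is therefore harmless. *)
Lemma step_sum_left_continuous x : step_sum a xi t @[t --> x^'-] --> step_sum a xi x.
Proof.
have loc (N : nat) : \forall t \near x^'-,
    series (fun n => a n * (xi n < t)%R%:R) N = series (fun n => a n * (xi n < x)%R%:R) N.
  elim: N => [|N IH]; first by apply: nearW => t; rewrite /series/= !big_geq.
  have H : \forall t \near x^'-, (xi N < t)%R = (xi N < x)%R.
    have [xx|xx] := ltP (xi N) x.
      by near=> t; near: t; exact: nbhs_left_gt.
    near=> t; apply/negbTE; rewrite -leNgt (le_trans _ xx)// ltW//.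
  near=> t; rewrite /series/= !big_nat_recr//=.
  have -> : (xi N < t)%R = (xi N < x)%R by near: t.
  congr (_ + _); near: t; exact: IH.
apply/cvgrPdist_le => e e0.
have c0 : 0 <= 2 * C / (1 - r) by rewrite !mulr_ge0 ?invr_ge0 ?subr_ge0 ?(ltW r_lt1).
have [N HN] := eventually_expq_le r r_gt0 r_lt1 (2 * C / (1 - r)) e c0 e0.
near=> t.
have E : series (fun n => a n * (xi n < t)%R%:R) N = series (fun n => a n * (xi n < x)%R%:R) N.
  by near: t; exact: loc.
have -> : step_sum a xi x - step_sum a xi t =
   (step_sum a xi x - series (fun n => a n * (xi n < x)%R%:R) N) -
   (step_sum a xi t - series (fun n => a n * (xi n < t)%R%:R) N) by rewrite E; ring.
rewrite (le_trans (ler_normB _ _))// (le_trans (lerD (tail N x) (tail N t)))//.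
apply: le_trans (HN N (leqnn N)).
by rewrite le_eqVlt; apply/orP; left; apply/eqP; ring.
Unshelve. all: by end_near. Qed.

End step_sum_values.

(** * From the string back to the line *)

Section string_in_x.
Context {R : realType}.
Local Notation leb := (@lebesgue_measure R).
Variables a q : R.
Hypotheses (q_gt0 : 0 < q) (a_gt1 : 1 < a) (aq_lt1 : a * q < 1).

Let a_gt0 : 0 < a := lt_trans ltr01 a_gt1.
Let aV0 : 0 < a^-1. Proof. by rewrite invr_gt0. Qed.
Let aV1 : a^-1 < 1. Proof. by rewrite invf_lt1. Qed.

Local Notation mass := (string_mass a q).
Local Notation pos := (string_pos a q).

Definition knot (n : nat) : R := ch_x a q n.+1.
Definition knot_omega (n : nat) : R := ch_omega a q n.+1.

Lemma pos_gt0 n : 0 < pos n.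
Proof. by rewrite (lt_le_trans ltr01)// string_pos_ge1. Qed.

Lemma mass_ge0 n : 0 <= mass n.
Proof. exact/ltW/string_mass_gt0. Qed.

Lemma expR_knot n : expR (knot n) = pos n.
Proof. by rewrite /knot /ch_x lnK// posrE; exact: pos_gt0. Qed.

Lemma knot_omegaE n : knot_omega n = mass n * pos n.
Proof. by []. Qed.

Lemma knot_omega_ge0 n : 0 <= knot_omega n.
Proof. by rewrite knot_omegaE mulr_ge0 ?mass_ge0// ltW// pos_gt0. Qed.

Lemma knot_lt : {homo knot : m p / (m < p)%N >-> m < p}.
Proof.
move=> m p mp; rewrite -ltr_expR !expR_knot.
elim: p mp => // p IH; rewrite ltnS leq_eqVlt => /predU1P[->|/IH mp].
  exact: string_pos_ltS.
by rewrite (lt_trans mp)// string_pos_ltS.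
Qed.

Lemma knot_ge0 n : 0 <= knot n.
Proof. by rewrite -ler_expR expR0 expR_knot string_pos_ge1. Qed.

Lemma knot_bounded : exists2 L, 0 <= L & forall n, 0 <= knot n <= L.
Proof.
have [S S0 HS] := string_pos_bounded a q q_gt0 a_gt1 aq_lt1.
have S1 : 1 <= S by rewrite (le_trans _ (HS 0%N))// string_pos_ge1.
exists (ln S); first exact: ln_ge0.
move=> n; rewrite knot_ge0/= -ler_expR expR_knot lnK ?HS//.
by rewrite posrE (lt_le_trans ltr01).
Qed.

Lemma knot_omega_le : exists2 C, 0 <= C & forall n, `|knot_omega n| <= C * a^-1 ^+ n.
Proof.
have [S S0 HS] := string_pos_bounded a q q_gt0 a_gt1 aq_lt1.
exists S => // n; rewrite ger0_norm ?knot_omega_ge0// knot_omegaE mulrC.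
by rewrite ler_pM ?mass_ge0// ?string_mass_le// ltW// pos_gt0.
Qed.

Section solution.
Variables (z alpha beta : R[i]).

Local Notation sA := (string_A a q z alpha beta).
Local Notation sB := (string_B a q z alpha beta).
Local Notation sg := (string_g a q z alpha beta).

(** The weight of the point source at the n-th knot. It is read off the string, so that [sol] is
    explicit and not defined through its own values. *)
Definition sol_c (n : nat) : R[i] := z * (mass n)%:C * (expR (knot n / 2))%:C * sg n.

Definition sol_A x : R[i] :=
  kernel_A 2^-1 (complex.Re alpha) (fun n => complex.Re (sol_c n)) knot x +i*
  kernel_A 2^-1 (complex.Im alpha) (fun n => complex.Im (sol_c n)) knot x.

Definition sol_B x : R[i] :=
  kernel_B 2^-1 (complex.Re beta) (fun n => complex.Re (sol_c n)) knot x +i*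
  kernel_B 2^-1 (complex.Im beta) (fun n => complex.Im (sol_c n)) knot x.

Definition sol x : R[i] :=
  kernel_f 2^-1 (complex.Re alpha) (complex.Re beta) (fun n => complex.Re (sol_c n)) knot x +i*
  kernel_f 2^-1 (complex.Im alpha) (complex.Im beta) (fun n => complex.Im (sol_c n)) knot x.

Lemma solE x : sol x = sol_A x * (expR (x / 2))%:C + sol_B x * (expR (- x / 2))%:C.
Proof.
rewrite /sol /sol_A /sol_B /kernel_f.
have -> : 2^-1 * x = x / 2 by rewrite mulrC.
have -> : - 2^-1 * x = - x / 2 by rewrite mulNr mulNr mulrC.
by apply: eq_ReIm; rewrite !(RecD, RecM, ImcD, ImcM)/=; ring.
Qed.

Lemma sol_c_le : exists2 C, 0 <= C & forall n,
  `|complex.Re (sol_c n)| <= C * a^-1 ^+ n /\ `|complex.Im (sol_c n)| <= C * a^-1 ^+ n.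
Proof.
have [G G0 HG] := string_g_bounded a q q_gt0 a_gt1 aq_lt1 z alpha beta.
have [L L0 HL] := knot_bounded.
pose C := normc z * expR (L / 2) * G.
have C0 : 0 <= C by rewrite !mulr_ge0 ?normc_ge0 ?expR_ge0.
have H n : normc (sol_c n) <= C * a^-1 ^+ n.
  rewrite /sol_c !normcM !normcR (ger0_norm (mass_ge0 n)) (ger0_norm (expR_ge0 _)).
  have -> : C * a^-1 ^+ n = normc z * a^-1 ^+ n * expR (L / 2) * G by rewrite /C; ring.
  have m0 := mass_ge0 n; have e0 := expR_ge0 (knot n / 2).
  apply: ler_pM => //; [|exact: normc_ge0|].
    by apply: mulr_ge0 => //; apply: mulr_ge0 => //; exact: normc_ge0.
  apply: ler_pM => //; [by apply: mulr_ge0 => //; exact: normc_ge0| |].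
    by rewrite ler_wpM2l ?normc_ge0// string_mass_le.
  by rewrite ler_expR ler_pM2r//; have /andP[] := HL n.
exists C => // n; split.
  exact: le_trans (Re_le_normcR _) (H n).
exact: le_trans (Im_le_normcR _) (H n).
Qed.

Let cA_mass n : expR (- (2^-1 * knot n)) * expR (knot n / 2) = 1.
Proof. by rewrite -expRD (mulrC _ 2^-1) addNr expR0. Qed.

Let cB_mass n : expR (2^-1 * knot n) * expR (knot n / 2) = pos n.
Proof. by rewrite -expRD (mulrC _ 2^-1) -expR_knot; congr expR; lra. Qed.

Lemma sol_cA_Re n : kernel_cA 2^-1 (fun n => complex.Re (sol_c n)) knot n =
  complex.Re (z * (mass n)%:C * sg n).
Proof.
rewrite /kernel_cA mulfV// divr1 /= /sol_c.
have -> : z * (mass n)%:C * (expR (knot n / 2))%:C * sg n =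
  (z * (mass n)%:C * sg n) * (expR (knot n / 2))%:C by ring.
by rewrite RecM/= mulr0 subr0 -mulrA (mulrC (expR _)) cA_mass mulr1.
Qed.

Lemma sol_cA_Im n : kernel_cA 2^-1 (fun n => complex.Im (sol_c n)) knot n =
  complex.Im (z * (mass n)%:C * sg n).
Proof.
rewrite /kernel_cA mulfV// divr1 /= /sol_c.
have -> : z * (mass n)%:C * (expR (knot n / 2))%:C * sg n =
  (z * (mass n)%:C * sg n) * (expR (knot n / 2))%:C by ring.
by rewrite ImcM/= mulr0 add0r -mulrA (mulrC (expR _)) cA_mass mulr1.
Qed.

Lemma sol_cB_Re n : kernel_cB 2^-1 (fun n => complex.Re (sol_c n)) knot n =
  complex.Re (z * (mass n)%:C * (pos n)%:C * sg n).
Proof.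
rewrite /kernel_cB mulfV// divr1 /= /sol_c.
have -> : z * (mass n)%:C * (expR (knot n / 2))%:C * sg n =
  (z * (mass n)%:C * sg n) * (expR (knot n / 2))%:C by ring.
have -> : z * (mass n)%:C * (pos n)%:C * sg n =
  (z * (mass n)%:C * sg n) * (pos n)%:C by ring.
by rewrite RecM [in RHS]RecM/= !mulr0 !subr0 -(cB_mass n) [in RHS](mulrC (expR _)) mulrA.
Qed.

Lemma sol_cB_Im n : kernel_cB 2^-1 (fun n => complex.Im (sol_c n)) knot n =
  complex.Im (z * (mass n)%:C * (pos n)%:C * sg n).
Proof.
rewrite /kernel_cB mulfV// divr1 /= /sol_c.
have -> : z * (mass n)%:C * (expR (knot n / 2))%:C * sg n =
  (z * (mass n)%:C * sg n) * (expR (knot n / 2))%:C by ring.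
have -> : z * (mass n)%:C * (pos n)%:C * sg n =
  (z * (mass n)%:C * sg n) * (pos n)%:C by ring.
by rewrite ImcM [in RHS]ImcM/= !mulr0 !add0r -(cB_mass n) [in RHS](mulrC (expR _)) mulrA.
Qed.

Lemma sol_A_left x : x <= 0 -> sol_A x = alpha.
Proof.
move=> x0; have xk n : x <= knot n by rewrite (le_trans x0)// knot_ge0.
by rewrite /sol_A /kernel_A !step_sum_left// !subr0; case: alpha.
Qed.

Lemma sol_B_left x : x <= 0 -> sol_B x = beta.
Proof.
move=> x0; have xk n : x <= knot n by rewrite (le_trans x0)// knot_ge0.
by rewrite /sol_B /kernel_B !step_sum_left// !addr0; case: beta.
Qed.

Lemma sol_A_knot n : sol_A (knot n) = sA n.
Proof.
rewrite /sol_A /kernel_A !step_sum_knot//; try exact: knot_lt.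
rewrite string_A_sum; apply: eq_ReIm => /=.
  by rewrite RecD RecN Rec_sum; congr (_ - _); apply: eq_bigr => k _; rewrite sol_cA_Re.
by rewrite ImcD ImcN Imc_sum; congr (_ - _); apply: eq_bigr => k _; rewrite sol_cA_Im.
Qed.

Lemma sol_B_knot n : sol_B (knot n) = sB n.
Proof.
rewrite /sol_B /kernel_B !step_sum_knot//; try exact: knot_lt.
rewrite string_B_sum; apply: eq_ReIm => /=.
  by rewrite RecD Rec_sum; congr (_ + _); apply: eq_bigr => k _; rewrite sol_cB_Re.
by rewrite ImcD Imc_sum; congr (_ + _); apply: eq_bigr => k _; rewrite sol_cB_Im.
Qed.

(** Uses g = e^(x/2) f and m e^x = omega at a knot. This consistency is what turns the kernel
    formula into a solution of the spectral equation. *)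
Lemma sol_knot n : sol_c n = z * (knot_omega n)%:C * sol (knot n).
Proof.
rewrite solE sol_A_knot sol_B_knot knot_omegaE /sol_c /string_g.
have e1 : expR (- knot n / 2) * pos n = expR (knot n / 2).
  by rewrite -expR_knot -expRD; congr expR; lra.
have e2 : expR (knot n / 2) * expR (- knot n / 2) = 1.
  by rewrite -expRD -expR0; congr expR; lra.
have e3 : pos n = expR (knot n / 2) * expR (knot n / 2).
  by rewrite -expR_knot -expRD; congr expR; lra.
set e := expR (knot n / 2) in e1 e2 e3 *; set f := expR (- knot n / 2) in e1 e2 *.
have eC : e%:C = f%:C * (pos n)%:C by rewrite -rmorphM e1.
have e2C : e%:C * f%:C = 1 by rewrite -rmorphM e2.
have e3C : (pos n)%:C = e%:C * e%:C by rewrite -rmorphM -e3.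
have -> : (mass n * pos n)%:C = (mass n)%:C * (pos n)%:C by exact: rmorphM.
rewrite e3C.
transitivity (z * (mass n)%:C * e%:C * (e%:C * f%:C * (sA n * (e%:C * e%:C) + sB n))).
  by rewrite e2C mul1r.
have -> : sA n * e%:C + sB n * f%:C = f%:C * (sA n * (e%:C * e%:C) + sB n).
  by have := e2C => E; rewrite mulrDr mulrCA (mulrA f%:C) (mulrC f%:C) E mul1r (mulrC f%:C).
ring.
Qed.

Lemma sol_A_right x (l : R[i]) : (forall n, knot n < x) -> sA @ \oo --> l -> sol_A x = l.
Proof.
move=> kx Al; rewrite /sol_A /kernel_A !step_sum_right//.
have hr : complex.Re (sA n) @[n --> \oo] --> complex.Re l.
  exact: (@cvgC_Re _ _ \oo _ sA l Al).
have hi : complex.Im (sA n) @[n --> \oo] --> complex.Im l.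
  exact: (@cvgC_Im _ _ \oo _ sA l Al).
apply: eq_ReIm => /=; apply/eqP; rewrite subr_eq addrC -subr_eq eq_sym; apply/eqP;
    apply/cvg_lim => //.
  have -> : series (kernel_cA 2^-1 (fun n => complex.Re (sol_c n)) knot) =
      (fun n => complex.Re alpha - complex.Re (sA n)).
    apply/funext => n; rewrite string_A_sum RecD RecN Rec_sum opprB addrC subrK.
    by rewrite /series/=; apply: eq_bigr => k _; rewrite sol_cA_Re.
  by apply: cvgB => //; exact: cvg_cst.
have -> : series (kernel_cA 2^-1 (fun n => complex.Im (sol_c n)) knot) =
    (fun n => complex.Im alpha - complex.Im (sA n)).
  apply/funext => n; rewrite string_A_sum ImcD ImcN Imc_sum opprB addrC subrK.
  by rewrite /series/=; apply: eq_bigr => k _; rewrite sol_cA_Im.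
by apply: cvgB => //; exact: cvg_cst.
Qed.

End solution.
End string_in_x.

(** * Compactly supported complex test functions *)

Section test_functions.
Context {R : realType}.
Implicit Types f h : R -> R[i].

Lemma H1cC_support h : H1cC h -> exists M, forall x, M <= `|x| -> h x = 0.
Proof.
move=> [_ ch]; have [M M0 HM] := compact_itv ch.
exists (M + 1) => x Mx; apply/eqP/negP => /negP hx.
have /HM : closure [set x | h x != 0] x by apply: subset_closure.
rewrite /= in_itv/= -ler_norml => xM.
by move: (le_trans Mx xM); rewrite gerDl ler10.
Qed.

Lemma H1cC_Re h : H1cC h -> is_weak_derivative (fun x => complex.Re (h x))
  (wderiv (fun x => complex.Re (h x))).
Proof. by move=> [[hr _] _]; exact: H1loc_wderiv. Qed.

Lemma H1cC_Im h : H1cC h -> is_weak_derivative (fun x => complex.Im (h x))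
  (wderiv (fun x => complex.Im (h x))).
Proof. by move=> [[_ hi] _]; exact: H1loc_wderiv. Qed.

(** Needed because the spectral equation applies omega to the product f h. *)
Lemma H1cC_mul f h : H1locC f -> H1cC h -> H1cC (fun x => f x * h x).
Proof.
move=> [fr fi] [[hr hi] ch]; split.
  split.
    have := weak_derivativeB
      (weak_derivative_mul (H1loc_wderiv fr) (H1loc_wderiv hr))
      (weak_derivative_mul (H1loc_wderiv fi) (H1loc_wderiv hi)).
    set D := (D in is_weak_derivative _ D) => wd; exists D.
    by move: wd; congr is_weak_derivative; apply/funext => x; rewrite RecM.
  have := weak_derivativeD
    (weak_derivative_mul (H1loc_wderiv fr) (H1loc_wderiv hi))
    (weak_derivative_mul (H1loc_wderiv fi) (H1loc_wderiv hr)).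
  set D := (D in is_weak_derivative _ D) => wd; exists D.
  by move: wd; congr is_weak_derivative; apply/funext => x; rewrite ImcM.
apply: (subclosed_compact _ ch); first exact: closed_closure.
apply: closure_subset => x /=; apply: contra => /eqP ->.
by rewrite mulr0.
Qed.

End test_functions.

Lemma Re_intC {R : realType} (m : {measure set (measurableTypeR R) -> \bar R}) (F : R -> R[i]) :
  complex.Re (intC m F) = \int[m]_x complex.Re (F x).
Proof. by []. Qed.

Lemma Im_intC {R : realType} (m : {measure set (measurableTypeR R) -> \bar R}) (F : R -> R[i]) :
  complex.Im (intC m F) = \int[m]_x complex.Im (F x).
Proof. by []. Qed.

(** * The distribution omega and the spectral equation on the line *)

Section weak_equation.
Context {R : realType}.
Local Notation leb := (@lebesgue_measure R).
Variables a q : R.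
Hypotheses (q_gt0 : 0 < q) (a_gt1 : 1 < a) (aq_lt1 : a * q < 1).

Let a_gt0 : 0 < a := lt_trans ltr01 a_gt1.
Let aV0 : 0 < a^-1. Proof. by rewrite invr_gt0. Qed.
Let aV1 : a^-1 < 1. Proof. by rewrite invf_lt1. Qed.

Local Notation mass := (string_mass a q).
Local Notation pos := (string_pos a q).
Local Notation total := (string_total a q).
Local Notation om := (knot_omega a q).
Local Notation xi := (knot a q).
Local Notation u := (ch_u a q).

Definition ch_u_A x := kernel_A 1 (total / 2) om xi x.

Let om_cA n : kernel_cA 1 om xi n = mass n / 2.
Proof.
rewrite /kernel_cA mulr1 mul1r; congr (_ / _).
by rewrite knot_omegaE -(expR_knot q_gt0 a_gt1 aq_lt1) -mulrA -expRD subrr expR0 mulr1.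
Qed.

(** Writes e^(-|t|) = e^t - 2 sinh(t^+) with t = x - x_n. Since omega_n e^(-x_n) is the n-th mass,
    the terms e^t sum to total e^x. *)
Lemma ch_uE : u = kernel_f 1 (total / 2) 0 om xi.
Proof.
have [C C0 HC] := knot_omega_le q_gt0 a_gt1 aq_lt1.
have [L L0 HL] := knot_bounded q_gt0 a_gt1 aq_lt1.
have CA0 : 0 <= C / (2 * 1) by rewrite divr_ge0// mulr1.
have CB0 : 0 <= C * expR (1 * L) / (2 * 1).
  by rewrite divr_ge0 ?mulr1// mulr_ge0 ?expR_ge0.
apply/funext => x; rewrite /ch_u /kernel_f.
set sA := step_sum (kernel_cA 1 om xi) xi x.
set sB := step_sum (kernel_cB 1 om xi) xi x.
have cA : series (fun n => kernel_cA 1 om xi n * (xi n < x)%R%:R) @ \oo --> sA.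
  exact: (@step_sum_cvg _ _ _ _ xi aV0 aV1 CA0 (kernel_cA_le ltr01 HC HL) x).
have cB : series (fun n => kernel_cB 1 om xi n * (xi n < x)%R%:R) @ \oo --> sB.
  exact: (@step_sum_cvg _ _ _ _ xi aV0 aV1 CB0 (kernel_cB_le ltr01 HC HL) x).
have cM : series mass @ \oo --> total by exact: is_cvg_string_mass.
have lim1 : (fun N => expR x * series mass N -
    2 * expR x * series (fun n => kernel_cA 1 om xi n * (xi n < x)%R%:R) N +
    2 * expR (- x) * series (fun n => kernel_cB 1 om xi n * (xi n < x)%R%:R) N) @ \oo -->
    expR x * total - 2 * expR x * sA + 2 * expR (- x) * sB.
  exact: cvgD (cvgB (cvgMr cM) (cvgMr cA)) (cvgMr cB).
rewrite (_ : (fun N => _) = (fun N => expR x * series mass N -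
    2 * expR x * series (fun n => kernel_cA 1 om xi n * (xi n < x)%R%:R) N +
    2 * expR (- x) * series (fun n => kernel_cB 1 om xi n * (xi n < x)%R%:R) N)).
  rewrite (cvg_lim (@Rhausdorff R) lim1) /kernel_A /kernel_B -/sA -/sB mulN1r mul1r.
  by field.
apply/funext => N; rewrite big_add1/= /series/= !mulr_sumr -sumrB -big_split/=.
apply: eq_bigr => n _; rewrite -/(knot_omega a q n) -/(knot a q n) om_cA.
rewrite /kernel_cB mul1r mulr1 knot_omegaE -(expR_knot q_gt0 a_gt1 aq_lt1).
have [xix|xxi] := ltP (xi n) x.
  rewrite gtr0_norm ?subr_gt0// opprB mulr1n expRB.
  have /lt0r_neq0 h := expR_gt0 x; rewrite expRN.
  by field.
rewrite ler0_norm ?subr_le0// opprK mulr0n expRB.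
have /lt0r_neq0 h := expR_gt0 (xi n).
by field.
Qed.

Lemma ch_u_weak_derivative : is_weak_derivative u (kernel_d 1 (total / 2) 0 om xi).
Proof.
have [C C0 HC] := knot_omega_le q_gt0 a_gt1 aq_lt1.
have [L L0 HL] := knot_bounded q_gt0 a_gt1 aq_lt1.
by rewrite ch_uE; exact: (kernel_weak_derivative _ _ aV0 aV1 C0 ltr01 HC HL).
Qed.

Lemma ch_u_weak (h h' : R -> R) (M : R) : is_weak_derivative h h' ->
  (forall x, M <= `|x| -> h x = 0) ->
  [/\ leb.-integrable setT (EFin \o (fun x => wderiv u x * h' x)),
      leb.-integrable setT (EFin \o (fun x => u x * h x)) &
      series (fun n => om n * h (xi n)) @ \oo -->
        \int[leb]_x (wderiv u x * h' x) + \int[leb]_x (u x * h x)].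
Proof.
move=> hh' hM.
have [C C0 HC] := knot_omega_le q_gt0 a_gt1 aq_lt1.
have [L L0 HL] := knot_bounded q_gt0 a_gt1 aq_lt1.
have := kernel_weak_global (total / 2) 0 aV0 aV1 C0 L0 ltr01 HC HL hh' hM.
by rewrite -ch_uE expr1n mul1r.
Qed.

(** Identifies u - u'' with the sum of omega_n times the Dirac measure at x_n. *)
Lemma omega_cvg (w : R -> R[i]) : H1cC w ->
  (fun n => \sum_(0 <= m < n) (om m)%:C * w (xi m)) @ \oo --> omega u w.
Proof.
move=> cw; have [M HM] := H1cC_support cw.
have HMr x : M <= `|x| -> complex.Re (w x) = 0 by move=> /HM ->.
have HMi x : M <= `|x| -> complex.Im (w x) = 0 by move=> /HM ->.
have [_ _ cr] := ch_u_weak (H1cC_Re cw) HMr.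
have [_ _ ci] := ch_u_weak (H1cC_Im cw) HMi.
have er : complex.Re (omega u w) = \int[leb]_x (wderiv u x * wderiv (fun x => complex.Re (w x)) x) +
    \int[leb]_x (u x * complex.Re (w x)).
  rewrite /omega RecD !Re_intC addrC; congr (_ + _); apply: eq_Rintegral => x _.
    by rewrite RecM mul0r subr0.
  by rewrite RecM mul0r subr0.
have ei : complex.Im (omega u w) = \int[leb]_x (wderiv u x * wderiv (fun x => complex.Im (w x)) x) +
    \int[leb]_x (u x * complex.Im (w x)).
  rewrite /omega ImcD !Im_intC addrC; congr (_ + _); apply: eq_Rintegral => x _.
    by rewrite ImcM mul0r addr0.
  by rewrite ImcM mul0r addr0.
apply: (@cvgC _ _ \oo).
  rewrite er (_ : (fun n => _) = series (fun n => om n * complex.Re (w (xi n)))).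
    exact: cr.
  by apply/funext => n; rewrite Rec_sum; apply: eq_bigr => i _; rewrite RecM mul0r subr0.
rewrite ei (_ : (fun n => _) = series (fun n => om n * complex.Im (w (xi n)))).
  exact: ci.
by apply/funext => n; rewrite Imc_sum; apply: eq_bigr => i _; rewrite ImcM mul0r addr0.
Qed.

Section solution_equation.
Variables (z alpha beta : R[i]).
Local Notation f := (sol a q z alpha beta).
Local Notation c := (sol_c a q z alpha beta).

Lemma sol_Re_wd : is_weak_derivative (fun x => complex.Re (f x))
  (kernel_d 2^-1 (complex.Re alpha) (complex.Re beta) (fun n => complex.Re (c n)) xi).
Proof.
have [C C0 HC] := sol_c_le q_gt0 a_gt1 aq_lt1 z alpha beta.
have [L L0 HL] := knot_bounded q_gt0 a_gt1 aq_lt1.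
have k0 : 0 < 2^-1 :> R by rewrite invr_gt0.
exact: (kernel_weak_derivative _ _ aV0 aV1 C0 k0 (fun n => (HC n).1) HL).
Qed.

Lemma sol_Im_wd : is_weak_derivative (fun x => complex.Im (f x))
  (kernel_d 2^-1 (complex.Im alpha) (complex.Im beta) (fun n => complex.Im (c n)) xi).
Proof.
have [C C0 HC] := sol_c_le q_gt0 a_gt1 aq_lt1 z alpha beta.
have [L L0 HL] := knot_bounded q_gt0 a_gt1 aq_lt1.
have k0 : 0 < 2^-1 :> R by rewrite invr_gt0.
exact: (kernel_weak_derivative _ _ aV0 aV1 C0 k0 (fun n => (HC n).2) HL).
Qed.

Lemma sol_H1locC : H1locC f.
Proof. by split; eexists; [exact: sol_Re_wd|exact: sol_Im_wd]. Qed.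

Lemma sol_weak (h h' : R -> R) (M : R) : is_weak_derivative h h' ->
  (forall x, M <= `|x| -> h x = 0) ->
  [/\ leb.-integrable setT (EFin \o (fun x => wderiv (fun x => complex.Re (f x)) x * h' x)),
      leb.-integrable setT (EFin \o (fun x => complex.Re (f x) * h x)) &
      series (fun n => complex.Re (c n) * h (xi n)) @ \oo -->
        \int[leb]_x (wderiv (fun x => complex.Re (f x)) x * h' x) +
        2^-1 ^+ 2 * \int[leb]_x (complex.Re (f x) * h x)] /\
  [/\ leb.-integrable setT (EFin \o (fun x => wderiv (fun x => complex.Im (f x)) x * h' x)),
      leb.-integrable setT (EFin \o (fun x => complex.Im (f x) * h x)) &
      series (fun n => complex.Im (c n) * h (xi n)) @ \oo -->
        \int[leb]_x (wderiv (fun x => complex.Im (f x)) x * h' x) +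
        2^-1 ^+ 2 * \int[leb]_x (complex.Im (f x) * h x)].
Proof.
move=> hh' hM.
have [C C0 HC] := sol_c_le q_gt0 a_gt1 aq_lt1 z alpha beta.
have [L L0 HL] := knot_bounded q_gt0 a_gt1 aq_lt1.
have k0 : 0 < 2^-1 :> R by rewrite invr_gt0.
split.
  exact: (kernel_weak_global (complex.Re alpha) (complex.Re beta) aV0 aV1 C0 L0 k0
    (fun n => (HC n).1) HL hh' hM).
exact: (kernel_weak_global (complex.Im alpha) (complex.Im beta) aV0 aV1 C0 L0 k0
    (fun n => (HC n).2) HL hh' hM).
Qed.

Lemma sol_cvg (h : R -> R[i]) : H1cC h ->
  (fun n => \sum_(0 <= m < n) c m * h (xi m)) @ \oo -->
  intC leb (fun x => wderivC f x * wderivC h x) +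
    4^-1 * intC leb (fun x => f x * h x).
Proof.
move=> ch; have [M HM] := H1cC_support ch.
have HMr x : M <= `|x| -> complex.Re (h x) = 0 by move=> /HM ->.
have HMi x : M <= `|x| -> complex.Im (h x) = 0 by move=> /HM ->.
have [[r1 r2 r3] [r4 r5 r6]] := sol_weak (H1cC_Re ch) HMr.
have [[i1 i2 i3] [i4 i5 i6]] := sol_weak (H1cC_Im ch) HMi.
have q4 : (4 : R[i])^-1 = ((2^-1 : R) ^+ 2)%:C.
  by rewrite rmorphXn fmorphV rmorph_nat; field.
set v := (v in _ --> v).
have er : complex.Re v =
  (\int[leb]_x (wderiv (fun x => complex.Re (f x)) x * wderiv (fun x => complex.Re (h x)) x) +
        2^-1 ^+ 2 * \int[leb]_x (complex.Re (f x) * complex.Re (h x))) -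
  (\int[leb]_x (wderiv (fun x => complex.Im (f x)) x * wderiv (fun x => complex.Im (h x)) x) +
        2^-1 ^+ 2 * \int[leb]_x (complex.Im (f x) * complex.Im (h x))).
  rewrite /v q4 RecD RecM mul0r subr0 !Re_intC.
  transitivity (\int[leb]_x (wderiv (fun x => complex.Re (f x)) x * wderiv (fun x => complex.Re (h x)) x -
     wderiv (fun x => complex.Im (f x)) x * wderiv (fun x => complex.Im (h x)) x) +
    2^-1 ^+ 2 * \int[leb]_x (complex.Re (f x) * complex.Re (h x) - complex.Im (f x) * complex.Im (h x))).
    congr (_ + _ * _); apply: eq_Rintegral => x _; exact: RecM.
  rewrite (RintegralB (@measurableT _ _) r1 i4) (RintegralB (@measurableT _ _) r2 i5).
  by ring.
have ei : complex.Im v =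
  (\int[leb]_x (wderiv (fun x => complex.Re (f x)) x * wderiv (fun x => complex.Im (h x)) x) +
        2^-1 ^+ 2 * \int[leb]_x (complex.Re (f x) * complex.Im (h x))) +
  (\int[leb]_x (wderiv (fun x => complex.Im (f x)) x * wderiv (fun x => complex.Re (h x)) x) +
        2^-1 ^+ 2 * \int[leb]_x (complex.Im (f x) * complex.Re (h x))).
  rewrite /v q4 ImcD ImcM mul0r addr0 !Im_intC.
  transitivity (\int[leb]_x (wderiv (fun x => complex.Re (f x)) x * wderiv (fun x => complex.Im (h x)) x +
     wderiv (fun x => complex.Im (f x)) x * wderiv (fun x => complex.Re (h x)) x) +
    2^-1 ^+ 2 * \int[leb]_x (complex.Re (f x) * complex.Im (h x) + complex.Im (f x) * complex.Re (h x))).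
    congr (_ + _ * _); apply: eq_Rintegral => x _; exact: ImcM.
  rewrite (RintegralD (@measurableT _ _) i1 r4) (RintegralD (@measurableT _ _) i2 r5).
  by ring.
apply: (@cvgC _ _ \oo).
  rewrite er (_ : (fun n => _) = (fun n =>
    series (fun n => complex.Re (c n) * complex.Re (h (xi n))) n -
    series (fun n => complex.Im (c n) * complex.Im (h (xi n))) n)).
    exact: cvgB r3 i6.
  apply/funext => n; rewrite Rec_sum /series/= -sumrB.
  by apply: eq_bigr => i _; rewrite RecM.
rewrite ei (_ : (fun n => _) = (fun n =>
    series (fun n => complex.Re (c n) * complex.Im (h (xi n))) n +
    series (fun n => complex.Im (c n) * complex.Re (h (xi n))) n)).
  exact: cvgD i3 r6.
apply/funext => n; rewrite Imc_sum /series/= -big_split/=.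
by apply: eq_bigr => i _; rewrite ImcM.
Qed.

Lemma sol_is_solution (ups : {measure set (measurableTypeR R) -> \bar R}) :
  (forall B, measurable B -> ups B = 0%E) -> is_solution u ups z f.
Proof.
move=> ups0; split; first exact: sol_H1locC.
move=> h ch.
have -> : intC ups (fun x => f x * h x) = 0.
  rewrite /intC; have E (F : R -> R) : \int[ups]_x F x = 0.
    rewrite /Rintegral (eq_measure_integral (mzero : {measure set (measurableTypeR R) -> \bar R})).
      by rewrite integral_measure_zero.
    by move=> A mA _; rewrite ups0.
  by rewrite !E.
rewrite mulr0 addr0.
have l1 := sol_cvg ch.
have l2 := omega_cvg (H1cC_mul sol_H1locC ch).
have l3 := @cvgC_Mr _ _ \oo _ _ _ l2 z.
(* Both sides of the equation are limits of the same partial sums over the knots, by [sol_knot]. *)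
apply: (cvgC_unique _ _ _ l1).
rewrite (_ : (fun n => _) = (fun n =>
  z * \sum_(0 <= m < n) (om m)%:C * (f (xi m) * h (xi m)))); first exact: l3.
apply/funext => n; rewrite mulr_sumr; apply: eq_bigr => i _.
by rewrite (sol_knot q_gt0 a_gt1 aq_lt1); ring.
Qed.

End solution_equation.
End weak_equation.

Section cvgC_extra.
Context {R : realType}.

Lemma cvgC_near_eq {T : Type} (F : set_system T) {FF : Filter F} (f g : T -> R[i]) (l : R[i]) :
  (\forall t \near F, f t = g t) -> g @ F --> l -> f @ F --> l.
Proof.
move=> fg gl A /gl; rewrite !nbhs_simpl /= => gA.
by apply: filterS2 fg gA => t /= ->.
Qed.

Lemma cvgC_real {T : Type} (F : set_system T) {FF : ProperFilter F} (f : T -> R) (l : R) :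
  f @ F --> l -> (f t)%:C @[t --> F] --> l%:C.
Proof. by move=> fl; apply: cvgC => //=; exact: cvg_cst. Qed.

Lemma expRC_neq0 (x : R) : (expR x)%:C != 0.
Proof. by rewrite eq_complex/= negb_and expR_eq0. Qed.

Lemma cvg_expR_ninfty : expR x @[x --> -oo] --> (0 : R).
Proof.
have := @cvgr_expR R; move=> /cvgNy_compNP; apply.
Qed.

End cvgC_extra.

(** * Behaviour at both ends and the Weyl-Titchmarsh limit *)

Section solution_asymptotics.
Context {R : realType}.
Local Notation leb := (@lebesgue_measure R).
Variables a q : R.
Hypotheses (q_gt0 : 0 < q) (a_gt1 : 1 < a) (aq_lt1 : a * q < 1).

Let a_gt0 : 0 < a := lt_trans ltr01 a_gt1.
Let aV0 : 0 < a^-1. Proof. by rewrite invr_gt0. Qed.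
Let aV1 : a^-1 < 1. Proof. by rewrite invf_lt1. Qed.

Local Notation total := (string_total a q).
Local Notation om := (knot_omega a q).
Local Notation xi := (knot a q).
Local Notation u := (ch_u a q).

Lemma ch_u_A_left x : x <= 0 -> ch_u_A a q x = total / 2.
Proof.
move=> x0; rewrite /ch_u_A /kernel_A step_sum_left ?subr0// => n.
by rewrite (le_trans x0)// knot_ge0.
Qed.

Section solution.
Variables (z alpha beta : R[i]).
Local Notation f := (sol a q z alpha beta).

(* f' + f/2 = A e^(x/2), and u + u' = 2 [ch_u_A] e^x. *)
Definition sol_qd x : R[i] :=
  sol_A a q z alpha beta x * (expR (x / 2))%:C -
  z * (2 * ch_u_A a q x * expR x)%:C * f x.

Let cont_left (g : R -> R) x : continuous g -> g t @[t --> x^'-] --> g x.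
Proof. by move=> cg; apply: cvg_at_left_filter; exact: cg. Qed.

Lemma sol_qd_left_continuous x : sol_qd t @[t --> x^'-] --> sol_qd x.
Proof.
have [C C0 HC] := knot_omega_le q_gt0 a_gt1 aq_lt1.
have [C' C'0 HC'] := sol_c_le q_gt0 a_gt1 aq_lt1 z alpha beta.
have [L L0 HL] := knot_bounded q_gt0 a_gt1 aq_lt1.
have k0 : 0 < 2^-1 :> R by rewrite invr_gt0.
have C20 (k D : R) : 0 < k -> 0 <= D -> 0 <= D / (2 * k).
  by move=> k0' D0; rewrite divr_ge0// mulr_ge0// ltW.
have cA (k D al : R) c : 0 < k -> 0 <= D -> (forall n, `|c n| <= D * a^-1 ^+ n) ->
    kernel_A k al c xi t @[t --> x^'-] --> kernel_A k al c xi x.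
  move=> kk0 D0 HD; apply: cvgB; first exact: cvg_cst.
  exact: (step_sum_left_continuous aV0 aV1 (C20 _ _ kk0 D0) (kernel_cA_le kk0 HD HL)).
have c1 : sol_A a q z alpha beta t @[t --> x^'-] --> sol_A a q z alpha beta x.
  apply: (@cvgC _ _ (x^'-)) => /=.
    exact: (cA _ C' _ _ k0 C'0 (fun n => (HC' n).1)).
  exact: (cA _ C' _ _ k0 C'0 (fun n => (HC' n).2)).
have c2 : (expR (t / 2))%:C @[t --> x^'-] --> (expR (x / 2))%:C.
  apply: (@cvgC_real _ _ (x^'-) _ (fun t => expR (t / 2))).
  apply: (cont_left (g := fun t => expR (t / 2))) => y.
  by under eq_fun do rewrite mulrC; exact: continuous_expRM.
have c3 : (2 * ch_u_A a q t * expR t)%:C @[t --> x^'-] --> (2 * ch_u_A a q x * expR x)%:C.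
  apply: (@cvgC_real _ _ (x^'-) _ (fun t => 2 * ch_u_A a q t * expR t)).
  apply: cvgM; last by apply: cont_left; exact: continuous_expR.
  by apply: cvgMr; exact: (cA _ C _ _ ltr01 C0 HC).
have c4 : f t @[t --> x^'-] --> f x.
  apply: (@cvgC _ _ (x^'-)).
    exact/cont_left/(weak_derivative_continuous (sol_Re_wd q_gt0 a_gt1 aq_lt1 z alpha beta)).
  exact/cont_left/(weak_derivative_continuous (sol_Im_wd q_gt0 a_gt1 aq_lt1 z alpha beta)).
have c5 := @cvgC_Mr _ _ (x^'-) (at_left_proper_filter x) _ _ c3 z.
have c6 := @cvgC_M _ _ (x^'-) (at_left_proper_filter x) _ _ _ _ c5 c4.
have c7 := @cvgC_M _ _ (x^'-) (at_left_proper_filter x) _ _ _ _ c1 c2.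
exact: (@cvgC_B _ _ (x^'-) _ _ _ _ _ c7 c6).
Qed.

Lemma sol_quasi_derivative : is_quasi_derivative u z f sol_qd.
Proof.
split; first exact: sol_qd_left_continuous.
have w1 := wderiv_ae (sol_Re_wd q_gt0 a_gt1 aq_lt1 z alpha beta).
have w2 := wderiv_ae (sol_Im_wd q_gt0 a_gt1 aq_lt1 z alpha beta).
have w3 := wderiv_ae (ch_u_weak_derivative q_gt0 a_gt1 aq_lt1).
have w12 : {ae leb, forall x, wderivC f x =
   2^-1 * (sol_A a q z alpha beta x * (expR (x / 2))%:C -
           sol_B a q z alpha beta x * (expR (- x / 2))%:C)}.
  apply: filterS2 w1 w2; first exact: (ae_filter_ringOfSetsType leb).
  move=> x e1 e2; rewrite /wderivC e1 e2 /kernel_d /sol_A /sol_B.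
  have -> : 2^-1 * x = x / 2 by rewrite mulrC.
  have -> : - 2^-1 * x = - x / 2 by rewrite mulNr mulNr mulrC.
  have q2 : (2 : R[i])^-1 = (2^-1 : R)%:C by rewrite fmorphV rmorph_nat.
  rewrite q2; move: (kernel_A _ _ _ _ _) (kernel_A _ _ _ _ _) (kernel_B _ _ _ _ _)
    (kernel_B _ _ _ _ _) (expR _) (expR _) => A1 A2 B1 B2 e f'.
  by apply: eq_ReIm; rewrite !(RecM, ImcM, RecD, RecN, ImcD, ImcN)/=; ring.
apply: filterS2 w12 w3; first exact: (ae_filter_ringOfSetsType leb).
move=> x e1 e3; rewrite e1 e3 /sol_qd.
have -> : u x + kernel_d 1 (total / 2) 0 om xi x = 2 * ch_u_A a q x * expR x.
  rewrite (ch_uE q_gt0 a_gt1 aq_lt1) /kernel_f /kernel_d -/(ch_u_A a q x) !mul1r.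
  ring.
by rewrite solE; field.
Qed.

Lemma sol_left x : x <= 0 -> f x = alpha * (expR (x / 2))%:C + beta * (expR (- x / 2))%:C.
Proof.
by move=> x0; rewrite solE (sol_A_left q_gt0 a_gt1 aq_lt1)// (sol_B_left q_gt0 a_gt1 aq_lt1).
Qed.

Lemma sol_qd_left x : x <= 0 -> sol_qd x = alpha * (expR (x / 2))%:C -
  z * (total%:C * (expR x)%:C) * (alpha * (expR (x / 2))%:C + beta * (expR (- x / 2))%:C).
Proof.
move=> x0; rewrite /sol_qd -(sol_left x0) (ch_u_A_left x0).
rewrite (_ : 2 * (total / 2) = total); last by field.
by rewrite (sol_A_left q_gt0 a_gt1 aq_lt1 _ _ _ x0) rmorphM.
Qed.

(** Past all knots A and B are constant, so the formula is exact there; b is read off at the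
    arbitrary point L + 1. *)
Lemma sol_right (l : R[i]) : string_A a q z alpha beta @ \oo --> l ->
  exists b : R[i], \forall x \near +oo,
    f x = (l + b * (expR (- x))%:C) * (expR (x / 2))%:C.
Proof.
move=> Al; have [L L0 HL] := knot_bounded q_gt0 a_gt1 aq_lt1.
exists (sol_B a q z alpha beta (L + 1)).
have kL x : L < x -> forall n, knot a q n < x.
  by move=> Lx n; have /andP[_ kn] := HL n; exact: le_lt_trans kn Lx.
near=> x.
have Lx : L < x by near: x; apply: nbhs_pinfty_gt; rewrite num_real.
have -> : sol_B a q z alpha beta (L + 1) = sol_B a q z alpha beta x.
  have L1 : L < L + 1 by rewrite ltrDl.
  by rewrite /sol_B /kernel_B !(step_sum_right _ (kL _ Lx)) !(step_sum_right _ (kL _ L1)).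
rewrite solE (sol_A_right (kL _ Lx) Al).
have -> : expR (- x / 2) = expR (- x) * expR (x / 2).
  by rewrite -expRD; congr expR; lra.
by rewrite rmorphM mulrDl mulrA.
Unshelve. all: by end_near. Qed.

End solution.

Section weyl.
Variable ups : {measure set (measurableTypeR R) -> \bar R}.
Hypothesis ups0 : forall B, measurable B -> ups B = 0%E.

Let phi z := sol a q z 1 0.
(** The slope z total cancels the term z (u + u') e^(-x/2) = z total e^(x/2) of the
    quasi-derivative, as the condition theta^[1] = o(e^(x/2)) demands. *)
Let theta z := sol a q z (z * total%:C) 1.

Let FFn := @proper_ninfty_nbhs R.
Let FFp := @proper_pinfty_nbhs R.

Let near0 : \forall x \near -oo, (x : R) <= 0.
Proof. by apply: nbhs_ninfty_le; rewrite num_real. Qed.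

(** To the left of the knots, each of the four quotients in the normalisation at -oo is an affine
    function of e^x. *)
Let lim_affine (c0 c1 : R[i]) (g : R -> R[i]) :
  (forall x, x <= 0 -> g x = c0 + c1 * (expR x)%:C) -> g x @[x --> -oo] --> c0.
Proof.
move=> gE; apply: (@cvgC_near_eq _ _ -oo _ _ (fun x => c0 + c1 * (expR x)%:C)).
  by apply: filterS near0 => x; exact: gE.
have e0 := @cvgC_real _ _ -oo FFn _ _ (@cvg_expR_ninfty R).
have e1 := @cvgC_Mr _ _ -oo FFn _ _ e0 c1.
have e2 := @cvgC_D _ _ -oo FFn _ _ _ _ (@cvgC_cst _ _ -oo FFn c0) e1.
by move: e2; rewrite mulr0 addr0.
Qed.

Lemma sol_fundamental_system : fundamental_system u ups phi theta.
Proof.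
have eM (x : R) : (expR x)%:C = (expR (x / 2))%:C * (expR (x / 2))%:C.
  by rewrite -rmorphM -expRD -splitr.
have eV (x : R) : (expR (- x / 2))%:C = ((expR (x / 2))%:C)^-1.
  by rewrite mulNr expRN fmorphV.
move=> z; exists (sol_qd z 1 0), (sol_qd z (z * total%:C) 1); split.
- by split; exact: sol_is_solution.
- by split; exact: sol_quasi_derivative.
- split.
    apply: (@lim_affine 1 0) => x x0; rewrite /phi (sol_left _ _ _ x0) !mul0r !addr0 mul1r.
    exact: divff (expRC_neq0 _).
  apply: (@lim_affine 1 (z * total%:C)) => x x0; rewrite /theta (sol_left _ _ _ x0) [(expR x)%:C]eM eV.
  by have := expRC_neq0 (x / 2); set e := _%:C; set t := _%:C => e0; field.
- split.
    apply: (@lim_affine 1 (- (z * total%:C))) => x x0.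
    rewrite (sol_qd_left _ _ _ x0).
    rewrite [(expR (- x / 2))%:C]eV.
  rewrite [(expR x)%:C]eM.
    by have := expRC_neq0 (x / 2); set e := (expR _)%:C; set t := total%:C => e0; field.
  apply: (@lim_affine 0 (- (z * total%:C) ^+ 2)) => x x0.
  rewrite (sol_qd_left _ _ _ x0).
    rewrite [(expR (- x / 2))%:C]eV.
  rewrite [(expR x)%:C]eM.
  by have := expRC_neq0 (x / 2); set e := (expR _)%:C; set t := total%:C => e0; field.
Qed.

Lemma sol_weyl (m : R[i] -> R[i]) :
  (forall z, complex.Im z != 0 -> rho_sumC a q (fun k =>
     z / ((rho_pole a q k)%:C * ((rho_pole a q k)%:C - z))) (m z)) ->
  is_Weyl_Titchmarsh u ups m.
Proof.
move=> mE; exists phi, theta; split; first exact: sol_fundamental_system.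
move=> z z_im.
have z0 : z != 0 by apply: contra z_im => /eqP ->.
have [lp [lt [lpE ltE lp0 rE]]] := string_weyl a q q_gt0 a_gt1 aq_lt1 z z_im.
have [b pE] := sol_right lpE; have [c tE] := sol_right ltE.
(* Replaces m z by the quotient of slope limits; the common factor e^(x/2) then cancels from theta /
   phi. *)
rewrite (rho_sumC_unique _ _ _ _ _ (mE z z_im) rE).
apply: (@cvgC_near_eq _ _ +oo _ _ (fun x =>
  - ((lt + c * (expR (- x))%:C) / (z * (lp + b * (expR (- x))%:C))))).
  apply: filterS2 pE tE => x; rewrite /phi /theta => -> ->.
  rewrite mulrA -mulf_div (divff (expRC_neq0 _)) mulr1//.
have e0 := @cvgC_real _ _ +oo FFp _ _ (@cvgr_expR R).
have lin (k l : R[i]) : (fun x => k + l * (expR (- x))%:C) @ +oo --> k.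
  have e1 := @cvgC_Mr _ _ +oo FFp _ _ e0 l.
  have e2 := @cvgC_D _ _ +oo FFp _ _ _ _ (@cvgC_cst _ _ +oo FFp k) e1.
  by move: e2; rewrite mulr0 addr0.
have d1 := @cvgC_Mr _ _ +oo FFp _ _ (lin lp b) z.
have d2 := @cvgC_V _ _ +oo FFp _ _ d1 (mulf_neq0 z0 lp0).
have d3 := @cvgC_M _ _ +oo FFp _ _ _ _ (lin lt c) d2.
have d4 := @cvgC_Mr _ _ +oo FFp _ _ d3 (-1).
move: d4; rewrite mulN1r; under eq_fun do rewrite mulN1r; exact.
Qed.

End weyl.
End solution_asymptotics.

(** * Integration against a weighted sum of Dirac measures *)

Section discrete_measure.
Context {R : realType}.
Variables (c p : nat -> R).
Hypothesis c_ge0 : forall n, 0 <= c n.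

Definition point_mass (n : nat) : {measure set (measurableTypeR R) -> \bar R} :=
  mscale (NngNum (c_ge0 n)) (@dirac _ (measurableTypeR R) (p n) R).

Definition discrete_measure : {measure set (measurableTypeR R) -> \bar R} :=
  mseries point_mass 0.

Lemma discrete_measureE B :
  discrete_measure B = (\sum_(0 <= n <oo) (c n)%:E * \d_(p n) B)%E.
Proof. by []. Qed.

Lemma nneseries_EFin (f : nat -> R) (v : R) : series f @ \oo --> v ->
  (\sum_(0 <= n <oo) (f n)%:E = v%:E)%E.
Proof.
move=> fv; apply/cvg_lim => //.
rewrite (_ : (fun n => _) = EFin \o series f); last first.
  by apply/funext => n /=; rewrite sumEFin.
by apply: cvg_EFin => //; exact: nearW.
Qed.

Let integral_ge0 (f : R -> R) (v : R) : measurable_fun setT f -> (forall x, 0 <= f x) ->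
  series (fun n => c n * f (p n)) @ \oo --> v ->
  (\int[discrete_measure]_x (f x)%:E = v%:E)%E.
Proof.
move=> mf f0 fv; have mF : measurable_fun [set: measurableTypeR R] (EFin \o f).
  exact/measurable_EFinP.
rewrite (ge0_integral_measure_series point_mass measurableT) => //; last first.
  by move=> x _; rewrite lee_fin.
rewrite -(nneseries_EFin fv); apply: eq_eseriesr => n _.
rewrite ge0_integral_mscale//; last by move=> x _; rewrite lee_fin.
by rewrite integral_dirac// diracT mul1e EFinM.
Qed.

(** Absolute summability lets the positive and the negative part be integrated separately as
    nonnegative series. *)
Lemma integral_discrete (f : R -> R) (v : R) : measurable_fun setT f ->
  cvgn (series (fun n => c n * `|f (p n)|)) ->
  series (fun n => c n * f (p n)) @ \oo --> v ->
  \int[discrete_measure]_x f x = v.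
Proof.
move=> mf cv fv.
have cvp (g : R -> R) : (forall x, `|g x| <= `|f x|) -> cvgn (series (fun n => c n * g (p n))).
  move=> gf; apply: normed_cvg; apply: (series_le_cvg _ _ _ cv) => n /=.
  - exact: normr_ge0.
  - by rewrite mulr_ge0.
  - by rewrite normrM (ger0_norm (c_ge0 n)) ler_wpM2l.
have cp : cvgn (series (fun n => c n * f^\+ (p n))).
  by apply: cvp => x; rewrite ger0_norm ?funrpos_ge0// /funrpos ge_max ler_norm normr_ge0.
have cn : cvgn (series (fun n => c n * f^\- (p n))).
  apply: cvp => x; rewrite ger0_norm ?funrneg_ge0// /funrneg ge_max -normrN ler_norm.
  exact: normr_ge0.
rewrite /Rintegral integralE (_ : (fun x => (f x)%:E) = EFin \o f)// funerpos funerneg.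
rewrite (integral_ge0 (measurable_funrpos mf) _ cp) ?(integral_ge0 (measurable_funrneg mf) _ cn).
- rewrite -EFinB/=; apply: (cvg_unique (@Rhausdorff R) _ fv).
  rewrite (_ : series _ = fun n => series (fun n => c n * f^\+ (p n)) n -
    series (fun n => c n * f^\- (p n)) n); first exact: cvgB cp cn.
  apply/funext => n; rewrite /series/= -sumrB; apply: eq_bigr => i _.
  rewrite -mulrBr /funrpos /funrneg; congr (_ * _).
  by have [f0|f0] := leP 0 (f (p i)); [rewrite max_r ?subr0 ?oppr_le0|rewrite max_l ?oppr_ge0 ?ltW//; lra].
- by move=> x; exact: funrneg_ge0.
- by move=> x; exact: funrpos_ge0.
Qed.

End discrete_measure.

Lemma measurable_invr {R : realType} : measurable_fun setT (fun x : R => x^-1).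
Proof.
have -> : [set: R] = [set 0] `|` ~` [set 0] by rewrite setUv.
apply/measurable_funU; [exact: measurable_set1|by apply: measurableC; exact: measurable_set1|].
split; first exact: measurable_fun_set1.
apply: open_continuous_measurable_fun; first by apply: closed_openC; exact: closed_eq.
by move=> x /set_mem/= /eqP; exact: inv_continuous.
Qed.

Section measurable_complex.
Context {R : realType}.
Implicit Types F G : R -> R[i].

Definition measurableC F := measurable_fun setT (fun x => complex.Re (F x)) /\
  measurable_fun setT (fun x => complex.Im (F x)).

Lemma measurableC_M F G : measurableC F -> measurableC G -> measurableC (fun x => F x * G x).
Proof.
move=> [Fr Fi] [Gr Gi]; split.
  under eq_fun do rewrite RecM.
  by apply: measurable_funB; exact: measurable_funM.
under eq_fun do rewrite ImcM.
by apply: measurable_funD; exact: measurable_funM.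
Qed.

Lemma measurableC_V F : measurableC F -> measurableC (fun x => (F x)^-1).
Proof.
move=> [Fr Fi].
have md : measurable_fun setT (fun x => (complex.Re (F x) ^+ 2 + complex.Im (F x) ^+ 2)^-1).
  apply: (measurableT_comp (@measurable_invr R)).
  by apply: measurable_funD; exact: measurable_funX.
have -> : (fun x => (F x)^-1) =
    (fun x => (complex.Re (F x) / (complex.Re (F x) ^+ 2 + complex.Im (F x) ^+ 2)) +i*
              (- complex.Im (F x) / (complex.Re (F x) ^+ 2 + complex.Im (F x) ^+ 2))).
  by apply/funext => x; case: (F x) => c d; rewrite mulNr.
by split; apply: measurable_funM => //; exact: measurable_funN.
Qed.

(** The bound is asked only at the atoms, because the spectral kernel is unbounded near 0. *)
Lemma intC_discrete (c p : nat -> R) (c_ge0 : forall n, 0 <= c n) F (v : R[i]) (K : R) :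
  cvgn (series c) -> measurableC F ->
  (forall n, `|complex.Re (F (p n))| <= K /\ `|complex.Im (F (p n))| <= K) ->
  (fun n => \sum_(0 <= m < n) (c m)%:C * F (p m)) @ \oo --> v ->
  intC (discrete_measure p c_ge0) F = v.
Proof.
move=> cc [Fr Fi] FK Fv.
have cv (f : nat -> R) : (forall n, `|f n| <= K) -> cvgn (series (fun n => c n * `|f n|)).
  move=> fK; have cK : cvgn (series (fun n => K * c n)).
    have -> : series (fun n => K * c n) = (fun n => K * series c n).
      by apply/funext => n; rewrite /series/= mulr_sumr.
    exact: is_cvgMr.
  apply: (series_le_cvg _ _ _ cK) => n /=; first by rewrite mulr_ge0.
    by rewrite mulr_ge0// (le_trans _ (fK 0%N)).
  by rewrite mulrC ler_wpM2r.
apply: eq_ReIm => /=; apply: integral_discrete => //.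
- by apply: (cv (fun n => complex.Re (F (p n)))) => n; have [] := FK n.
- rewrite (_ : series _ = fun n => complex.Re (\sum_(0 <= m < n) (c m)%:C * F (p m))).
    exact: (@cvgC_Re _ _ \oo _ _ v Fv).
  by apply/funext => n; rewrite Rec_sum; apply: eq_bigr => i _; rewrite RecM mul0r subr0.
- by apply: (cv (fun n => complex.Im (F (p n)))) => n; have [] := FK n.
- rewrite (_ : series _ = fun n => complex.Im (\sum_(0 <= m < n) (c m)%:C * F (p m))).
    exact: (@cvgC_Im _ _ \oo _ _ v Fv).
  by apply/funext => n; rewrite Imc_sum; apply: eq_bigr => i _; rewrite ImcM mul0r addr0.
Qed.

End measurable_complex.

(** * The claimed spectral measure *)

Section spectral_measure.
Context {R : realType}.
Variables a q : R.
Hypotheses (q_gt0 : 0 < q) (a_gt1 : 1 < a) (aq_lt1 : a * q < 1).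

Let a_gt0 : 0 < a := lt_trans ltr01 a_gt1.

Definition rho0 : {measure set (measurableTypeR R) -> \bar R} :=
  discrete_measure (rho_pole a q) (rho_weight_ge0 a q q_gt0 a_gt1 aq_lt1).

Lemma rho0E B : rho0 B = ch_rho a q B.
Proof.
rewrite /rho0 discrete_measureE /ch_rho -nneseriesZl/=; last first.
  move=> n _; rewrite mule_ge0// lee_fin.
  have q_lt1 := q_lt1 a q q_gt0 a_gt1 aq_lt1.
  rewrite !mulr_ge0 ?invr_ge0 ?exprn_ge0 ?(ltW a_gt0) ?(ltW q_gt0)//.
  have q01 : 0 <= q < 1 by rewrite (ltW q_gt0).
  by rewrite ltW// mulr_gt0// (qpoch_gt0 q q_gt0 q_lt1)// (q_div_a a q q_gt0 a_gt1 aq_lt1).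
apply: eq_eseriesr => n _.
by rewrite /rho_weight EFinM -muleA.
Qed.

Lemma is_cvg_rho_weight : cvgn (series (rho_weight a q)).
Proof.
have -> : rho_weight a q = fun m => rho_weight a q m * rs q 0 (rho_w a q m) a^-1.
  by apply/funext => n; rewrite rs_0 mulr1.
by apply/cvg_ex; eexists; exact: (rho_sum_rs a q q_gt0 a_gt1 aq_lt1 0).
Qed.

(** The integrand is at most 1 and the measure is finite. *)
Lemma rho0_moment : (\int[rho0]_l ((1 + l ^+ 2)^-1)%:E < +oo)%E.
Proof.
have /cvg_ex[v hv] := is_cvg_rho_weight.
have m : measurable_fun setT (fun l : R => (1 + l ^+ 2)^-1).
  apply: (measurableT_comp (@measurable_invr R)).
  by apply: measurable_funD => //; exact: measurable_funX.
apply: (@le_lt_trans _ _ v%:E); last exact: ltry.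
have -> : v%:E = (\int[rho0]_l (cst 1%:E) l)%E.
  rewrite integral_cst//= mul1e discrete_measureE -(nneseries_EFin hv).
  by apply: eq_eseriesr => n _; rewrite diracT mule1.
apply: ge0_le_integral => //.
- by move=> x _; rewrite lee_fin invr_ge0 addr_ge0// sqr_ge0.
- exact/measurable_EFinP.
- by move=> x _; rewrite lee_fin invf_le1 ?lerDl ?sqr_ge0// ltr_pwDl ?sqr_ge0.
Qed.

Lemma rho0_support : ~ measure_support rho0 0.
Proof.
have a1 : 0 < a - 1 by rewrite subr_gt0.
(* Every atom is at least a - 1, so this neighbourhood of 0 is null. *)
have U0 : rho0 `]- (a - 1), a - 1[%classic = 0%E.
  rewrite discrete_measureE eseries0// => n _ _; rewrite diracE memNset ?mule0//=.
  by rewrite in_itv/= => /andP[_]; rewrite ltNge rho_pole_ge.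
move=> /(_ `]- (a - 1), a - 1[%classic); rewrite U0 ltxx => H; suff : false by [].
apply: H; split; first exact: interval_open.
by rewrite /= in_itv/= oppr_lt0 a1.
Qed.

Lemma rho0_intC (z : R[i]) (v : R[i]) : complex.Im z != 0 ->
  rho_sumC a q (fun k => z / ((rho_pole a q k)%:C * ((rho_pole a q k)%:C - z))) v ->
  intC rho0 (fun l => z / (l%:C * (l%:C - z))) = v.
Proof.
move=> z_im zv.
pose K := normc z * ((a - 1)^-1 * `|complex.Im z|^-1).
have K0 : 0 < a - 1 by rewrite subr_gt0.
apply: (@intC_discrete R _ _ _ (fun l => z / (l%:C * (l%:C - z))) v K) => //.
- exact: is_cvg_rho_weight.
- apply: (@measurableC_M _ (fun=> z)); first by split; exact: measurable_cst.
  apply: measurableC_V; apply: measurableC_M.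
    by split => /=; [exact: measurable_id|exact: measurable_cst].
  split.
    rewrite (_ : (fun x => _) = (fun x => x - complex.Re z)); last first.
      by apply/funext => x; rewrite RecD RecN.
    by apply: measurable_funB; [exact: measurable_id|exact: measurable_cst].
  rewrite (_ : (fun x => _) = cst (- complex.Im z)); first exact: measurable_cst.
  by apply/funext => x; rewrite ImcD ImcN/= add0r.
- move=> n; set l := rho_pole a q n.
  have l0 : a - 1 <= l by exact: rho_pole_ge.
  have H : normc (z / (l%:C * (l%:C - z))) <= K.
    rewrite normcM normcV normcM normcR /K ler_wpM2l ?normc_ge0// invfM.
    have h : `|complex.Im z| <= normc (l%:C - z).
      by have := Im_le_normcR (l%:C - z); rewrite ImcD ImcN/= sub0r normrN.
    have z0 : 0 < `|complex.Im z| by rewrite normr_gt0.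
    apply: ler_pM; rewrite ?invr_ge0 ?normr_ge0 ?normc_ge0//.
      by rewrite lef_pV2 ?posrE ?normr_gt0 ?gt_eqF ?ger0_norm ?(lt_le_trans K0 l0)// ltW// (lt_le_trans K0 l0).
    by rewrite lef_pV2 ?posrE// (lt_le_trans z0 h).
  split; first exact: le_trans (Re_le_normcR _) H.
  exact: le_trans (Im_le_normcR _) H.
Qed.

End spectral_measure.

(** * Measures with a density, for the energy of u *)

Section density.
Context {R : realType}.
Local Notation leb := (@lebesgue_measure R).
Variable f : R -> R.
Hypotheses (mf : measurable_fun setT f) (f_ge0 : forall x, 0 <= f x).

(** The hypotheses are arguments so that the measure structure can be attached to the term
    itself. *)
Definition density of measurable_fun setT f & (forall x, 0 <= f x) :=
  fun A : set (measurableTypeR R) => (\int[leb]_(x in A) (f x)%:E)%E.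

Local Notation nu := (density mf f_ge0).

Let density0 : nu set0 = 0%E. Proof. exact: integral_set0. Qed.
Let density_ge0 A : (0 <= nu A)%E.
Proof. by apply: integral_ge0 => x _; rewrite lee_fin. Qed.
Let density_sigma_additive : semi_sigma_additive nu.
Proof.
apply: semi_sigma_additive_nng_induced; first exact/measurable_EFinP.
by move=> x; rewrite lee_fin.
Qed.

HB.instance Definition _ := isMeasure.Build _ _ _ nu
  density0 density_ge0 density_sigma_additive.

Definition density_measure : {measure set (measurableTypeR R) -> \bar R} := nu.

Lemma density_locally_finite : itv_integrable f -> locally_finite density_measure.
Proof.
move=> fi K cK; have [M M0 KM] := compact_itv cK.
have le : (density_measure K <= \int[leb]_(x in `[(- M)%R, M]) (f x)%:E)%E.
  apply: ge0_subset_integral => //=.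
  - exact: compact_measurable.
  - by apply/measurable_EFinP; exact: measurable_funTS.
  - by move=> x _; rewrite lee_fin.
apply: (le_lt_trans le).
have /integrableP[_] := fi (- M) M; congr (_ < _)%E.
by apply: eq_integral => x _ /=; rewrite ger0_norm.
Qed.

End density.

Lemma integral_expR_ninfty (R : realType) :
  (\int[@lebesgue_measure R]_(x in `]-oo, 0%R]) (expR x)%:E < +oo)%E.
Proof.
have cE : continuous (fun x : R => expR (- x)).
  by move=> x; apply: continuous_comp; [exact: opp_continuous|exact: continuous_expR].
have dE (x : R) : is_derive x 1 (fun x => - expR (- x)) (expR (- x)).
  have h : is_derive x 1 (expR \o -%R) (- expR (- x)).
    by apply: is_derive_eq; rewrite /GRing.scale/= mulrN1.
  by apply: is_derive_eq (is_deriveN h) _; rewrite opprK.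
have := @ge0_integration_by_substitutionNy R expR 0; rewrite oppr0 => ->.
- rewrite (@ge0_continuous_FTC2y R (expR \o -%R) (fun x => - expR (- x)) 0 0).
  + by rewrite -EFinB ltry.
  + by move=> x _; exact: expR_ge0.
  + exact: continuous_subspaceT.
  + by rewrite -oppr0; apply: cvgN; exact: cvgr_expR.
  + by move=> x _; have [] := dE x.
  + by apply: cvg_at_right_filter; apply: cvgN; exact: cE.
  + by move=> x _; rewrite derive1E; have [_ ->] := dE x.
- by apply: continuous_subspaceT; exact: continuous_expR.
- by move=> x _; exact: expR_ge0.
Qed.

(** * Membership of the pair in the positive phase space, and conclusion *)

Section phase_space.
Context {R : realType}.
Local Notation leb := (@lebesgue_measure R).
Variables a q : R.
Hypotheses (q_gt0 : 0 < q) (a_gt1 : 1 < a) (aq_lt1 : a * q < 1).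

Let a_gt0 : 0 < a := lt_trans ltr01 a_gt1.
Let aV0 : 0 < a^-1. Proof. by rewrite invr_gt0. Qed.
Let aV1 : a^-1 < 1. Proof. by rewrite invf_lt1. Qed.

Local Notation total := (string_total a q).
Local Notation om := (knot_omega a q).
Local Notation xi := (knot a q).
Local Notation u := (ch_u a q).

Let wu := ch_u_weak_derivative q_gt0 a_gt1 aq_lt1.

Let u_H1loc : H1loc u. Proof. by eexists; exact: wu. Qed.

Let mwd : measurable_fun setT (wderiv u).
Proof. by have [] := weak_derivativeP (H1loc_wderiv u_H1loc). Qed.

Let cu : continuous u := weak_derivative_continuous wu.
Let mu : measurable_fun setT u := continuous_measurable_fun cu.

Lemma is_cvg_knot_omega : cvgn (series om).
Proof.
have [C C0 HC] := knot_omega_le q_gt0 a_gt1 aq_lt1.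
exact: (is_cvg_series_geometric_le a^-1 aV0 aV1 _ C).
Qed.

Definition ch_omega_measure : {measure set (measurableTypeR R) -> \bar R} :=
  discrete_measure xi (knot_omega_ge0 q_gt0 a_gt1 aq_lt1).

Lemma ch_omega_locally_finite : locally_finite ch_omega_measure.
Proof.
have /cvg_ex[v hv] := is_cvg_knot_omega.
move=> K _; apply: (@le_lt_trans _ _ v%:E); last exact: ltry.
rewrite discrete_measureE -(nneseries_EFin hv); apply: lee_nneseries.
  by move=> n _ _; rewrite mule_ge0// lee_fin knot_omega_ge0.
move=> n _; rewrite diracE -EFinM lee_fin ler_piMr ?knot_omega_ge0//.
by case: (_ \in _).
Qed.

Lemma omega_measureE h : H1cC h -> omega u h = intC ch_omega_measure h.
Proof.
move=> ch; have [L L0 HL] := knot_bounded q_gt0 a_gt1 aq_lt1.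
have cr := weak_derivative_continuous (H1cC_Re ch).
have ci := weak_derivative_continuous (H1cC_Im ch).
have [K1 K10 H1] := continuous_itv_bounded 0 L cr.
have [K2 K20 H2] := continuous_itv_bounded 0 L ci.
apply/esym/(@intC_discrete _ _ _ _ _ _ (K1 + K2)).
- exact: is_cvg_knot_omega.
- by split; exact: continuous_measurable_fun.
- move=> n; have xL : `[0, L]%classic (xi n) by rewrite /= in_itv/=.
  by split; [rewrite (le_trans (H1 _ xL))// lerDl|rewrite (le_trans (H2 _ xL))// lerDr].
- exact: omega_cvg.
Qed.

Let mE : measurable_fun setT (fun x => u x ^+ 2 + wderiv u x ^+ 2).
Proof. by apply: measurable_funD; exact: measurable_funX. Qed.

Let E_ge0 x : 0 <= u x ^+ 2 + wderiv u x ^+ 2.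
Proof. by rewrite addr_ge0 ?sqr_ge0. Qed.

Definition ch_mu : {measure set (measurableTypeR R) -> \bar R} := density_measure mE E_ge0.

Lemma ch_mu_locally_finite : locally_finite ch_mu.
Proof.
apply: density_locally_finite; apply: itv_integrableD.
  apply: continuous_itv_integrable => x.
  by apply: (@continuous_comp _ _ _ u (fun y => y ^+ 2)); [exact: cu|exact: exprn_continuous].
exact: weak_derivative_sqr (H1loc_wderiv u_H1loc).
Qed.

(** To the left of the knots u and, a.e., u' equal (total / 2) e^x, so the integrand is (total^2 /
    2) e^x. *)
Lemma ch_u_left_decay : left_decay u (mzero : {measure set (measurableTypeR R) -> \bar R}).
Proof.
split; last by rewrite integral_measure_zero.
have aeE : {ae leb, forall x, `]-oo, 0%R]%classic x ->
    (expR (- x) * (u x ^+ 2 + wderiv u x ^+ 2))%:E = ((total ^+ 2 / 2) * expR x)%:E}.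
  apply: ae_imp (wderiv_ae wu) => x -> /=; rewrite in_itv/= => x0.
  rewrite (ch_uE q_gt0 a_gt1 aq_lt1) /kernel_f /kernel_d.
  have xk n : x <= xi n by rewrite (le_trans x0)// knot_ge0.
  rewrite /kernel_A /kernel_B !step_sum_left// subr0 addr0 mul0r addr0 subr0 !mul1r.
  have e0 := lt0r_neq0 (expR_gt0 x).
  by rewrite expRN; congr (_%:E); field.
have mexp : measurable_fun setT (expR : R -> R).
  by apply: continuous_measurable_fun; exact: continuous_expR.
have mexpN : measurable_fun setT (fun x : R => expR (- x)).
  by apply: (measurableT_comp mexp); apply: measurable_funN; exact: measurable_id.
rewrite (@ae_eq_integral _ _ _ leb _ (fun x => ((total ^+ 2 / 2) * expR x)%:E)) //=.
- under eq_integral do rewrite EFinM.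
  have t0 : (0 <= (total ^+ 2 / 2)%:E)%E by rewrite lee_fin divr_ge0// sqr_ge0.
  rewrite ge0_integralZl//=.
  + apply: lte_mul_pinfty => //.
    exact: integral_expR_ninfty.
  + by apply/measurable_EFinP; exact: measurable_funTS.
- by apply/measurable_EFinP; apply: measurable_funTS; exact: measurable_funM.
- by apply/measurable_EFinP; apply: measurable_funTS; exact: measurable_funM.
Qed.

(** Past L all the mass has been subtracted from the coefficient of e^x, so u is a multiple of
    e^(-x) and u + u' vanishes a.e.; the supremum over x > L is then at most 0. *)
Lemma ch_u_right_decay : right_decay u (mzero : {measure set (measurableTypeR R) -> \bar R}).
Proof.
have [L L0 HL] := knot_bounded q_gt0 a_gt1 aq_lt1.
have A0 x : L < x -> ch_u_A a q x = 0.
  move=> Lx; have kx n : xi n < x by have /andP[_ kn] := HL n; exact: le_lt_trans kn Lx.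
  rewrite /ch_u_A /kernel_A step_sum_right//.
  have -> : series (kernel_cA 1 om xi) = (fun n => series (string_mass a q) n / 2).
    apply/funext => n; rewrite /series/= mulr_suml; apply: eq_bigr => i _.
    rewrite /kernel_cA mulr1 mul1r; congr (_ / _).
    by rewrite knot_omegaE -(expR_knot q_gt0 a_gt1 aq_lt1) -mulrA -expRD subrr expR0 mulr1.
  apply/eqP; rewrite subr_eq0 eq_sym; apply/eqP/cvg_lim => //; apply: cvgMl.
  exact: is_cvg_string_mass.
have ae0 : {ae leb, forall x, L < x -> u x + wderiv u x = 0}.
  apply: ae_imp (wderiv_ae wu) => x -> Lx.
  rewrite (ch_uE q_gt0 a_gt1 aq_lt1) /kernel_f /kernel_d -/(ch_u_A a q x) A0//.
  ring.
have mexpN : measurable_fun setT (fun x : R => expR (- x)).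
  apply: (measurableT_comp (f := expR)); last by apply: measurable_funN; exact: measurable_id.
  by apply: continuous_measurable_fun; exact: continuous_expR.
rewrite /right_decay /limf_esup; apply: (@le_lt_trans _ _ 0%E); last by [].
apply: ereal_inf_le; eexists.
  exists [set x : R | L < x]; last by [].
  by apply: nbhs_pinfty_gt; rewrite num_real.
apply: ub_ereal_sup => _ [x /= Lx <-].
rewrite integral_measure_zero adde0.
rewrite (@ae_eq_integral _ _ _ leb _ (cst 0%E)) ?integral0 ?mule0//=.
  apply/measurable_EFinP; apply: measurable_funTS; apply: measurable_funM => //.
  by apply: measurable_funX; exact: measurable_funD.
apply: ae_imp ae0 => y H /=; rewrite in_itv/= andbT => xy.
by rewrite H ?(lt_le_trans Lx)// expr0n/= mulr0.
Qed.

Lemma ch_mu_phase_space : phase_space_pos u ch_mu.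
Proof.
have up : is_upsilon u ch_mu mzero by move=> B mB; rewrite add0e.
split.
- split=> //; first exact: ch_mu_locally_finite.
  exists mzero; split => //; [exact: ch_u_left_decay|exact: ch_u_right_decay].
- exists ch_omega_measure; split; first exact: ch_omega_locally_finite.
  exact: omega_measureE.
- by exists mzero.
Qed.

(** Works for every admissible measure, with the null measure upsilon that its own membership
    provides. *)
Lemma ch_spectral_measure nu : phase_space_pos u nu ->
  is_spectral_measure u nu (rho0 q_gt0 a_gt1 aq_lt1).
Proof.
move=> [_ _ [ups [up ups0]]]; split.
- exact: rho0_moment.
- exact: rho0_support.
- exists ups, (fun z => intC (rho0 q_gt0 a_gt1 aq_lt1) (fun l => z / (l%:C * (l%:C - z)))).
  split=> //; apply: sol_weyl => // z z_im.
  have [lp [lt [_ _ _ rE]]] := string_weyl a q q_gt0 a_gt1 aq_lt1 z z_im.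
  by rewrite (rho0_intC q_gt0 a_gt1 aq_lt1 z_im rE).
Qed.

End phase_space.

Unset Implicit Arguments.

(** The existence clause keeps the universal clause over mu from being vacuous. *)
Theorem proposition5p15 (R : realType) (a q : R)
    (a_gt0 : 0 < a) (q_gt0 : 0 < q) (a_gt1 : 1 < a) (a_ltqV : a < 1 / q) :
  exists rho0 : {measure set (measurableTypeR R) -> \bar R},
    [/\ forall B : set R, measurable B -> rho0 B = ch_rho a q B,
        exists mu : {measure set (measurableTypeR R) -> \bar R},
          phase_space_pos (ch_u a q) mu &
        forall mu : {measure set (measurableTypeR R) -> \bar R},
          phase_space_pos (ch_u a q) mu ->
          is_spectral_measure (ch_u a q) mu rho0].
Proof.
have aq_lt1 : a * q < 1 by rewrite -ltr_pdivlMr.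
exists (rho0 q_gt0 a_gt1 aq_lt1); split.
- by move=> B _; exact: rho0E.
- by exists (ch_mu q_gt0 a_gt1 aq_lt1); exact: ch_mu_phase_space.
- exact: ch_spectral_measure.
Qed.
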